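(* Let $n\ge3$, $p\in(n,\infty)$, $\alpha=1-\frac np$, and let $u_0\in L^p_\alpha(\mathbb R^n)$ be divergence free in the weak sense. Say that a pair $(v,\pi_v)$ belongs to the existence class on $(0,T_v)$ with datum $u_0$ if it is a smooth solution on $(0,T_v)\times\mathbb R^n$ of $$v_t+v\cdot\nabla v+\nabla\pi_v=\Delta v,\qquad\nabla\cdot v=0,$$ such that: (i) for all $q>p$, with $\gamma=1-\frac nq$, for some $\rho>0$ and constants $c_0,c_1,c>0$, $$t^{\frac n{2p}}\big\|v(t)|x|^\alpha\big\|_\infty+t^{\frac12}\|v(t)\|_\infty+t^{\frac n2(\frac1n-\frac1q)}\|v(t)\|_q\le K(t,\rho)+c\|u_0\|_{\alpha,p}^{1-\gamma}K(t,\rho)^\gamma\quad\text{for all }t\in(0,T_v);$$ (ii) for all $q>p$, $\lim_{t\to0^+}\big[t^{\frac n{2p}}\|v(t)|x|^\alpha\|_\infty+t^{\frac12}\|v(t)\|_\infty+t^{\frac n2(\frac1n-\frac1q)}\|v(t)\|_q\big]=0$; (iii) $\lim_{t\to0^+}(v(t),\varphi)=(u_0,\varphi)$ for all $\varphi\in X(p)$. If $(u,\pi)$ and $(v,\pi_v)$ belong to the existence class with the same datum $u_0$, on $(0,T_u)$ and $(0,T_v)$ respectively, then on $(0,\min\{T_u,T_v\})\times\mathbb R^n$ one has $u=v$, and $\pi-\pi_v=h(t)$ is a function of $t$ only.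
   Context: For $p>n$ and $\alpha=1-\frac np$, $L^p_\alpha(\mathbb R^n)=\{u: u|x|^\alpha\in L^p(\mathbb R^n)\}$ with norm $\|u\|_{\alpha,p}=\|u|x|^\alpha\|_p$. $p'$ is the conjugate exponent of $p$, $\alpha'=-\alpha$, and $L^{p'}_{\alpha'}(\mathbb R^n)=\{u:u|x|^{-\alpha}\in L^{p'}\}$. $(\cdot,\cdot)$ is the $L^2$-type duality pairing. $u_0$ is divergence free in the weak sense if $\int u_0\cdot\nabla\phi\,dx=0$ for all $\phi\in C_0^\infty(\mathbb R^n)$. For $\rho,t>0$: $\|u_0\|_{\alpha,p,\rho}=\sup_{x\in\mathbb R^n}\big[\int_{B_\rho(x)}|u_0(y)|^p|y|^{\alpha p}dy\big]^{1/p}$ and $K(t,\rho)=c_0\|u_0\|_{\alpha,p,\rho}+c_1e^{-\rho^2/(8t)}\|u_0\|_{\alpha,p}$. $L(r,s)(\mathbb R^n)$ denotes the Lorentz space with quasinorm $\big(\int_0^\infty[t^{1/r}g^*(t)]^s\frac{dt}t\big)^{1/s}$, $s<\infty$, where $g^*$ is the nonincreasing rearrangement. The space $X(p)$ is: $L^{p'}_{\alpha'}(\mathbb R^n)\cap L^{q'}(\mathbb R^n)$, $q\in(p,2n)$, if $p\in(n,2n)$; $L^{p'}_{\alpha'}(\mathbb R^n)\cap L(\frac n{n-1},1)(\mathbb R^n)$ if $p=2n$; $L^{p'}_{\alpha'}(\mathbb R^n)\cap L\big(\frac{np}{p(n-2)+2n},1\big)(\mathbb R^n)$ if $p>2n$.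 *)

(* Defs.v *)
From HB Require Import structures.
From mathcomp Require Import all_boot all_order all_algebra.
From mathcomp Require Import all_classical all_reals all_analysis.

Set Implicit Arguments.
Unset Strict Implicit.
Unset Printing Implicit Defensive.

Import Order.TTheory GRing.Theory Num.Theory.
Import numFieldNormedType.Exports.

Local Open Scope classical_set_scope.
Local Open Scope ring_scope.

(* R^n is 'rV[R]_n.  Its sigma-algebra is generated by the coordinates, i.e.
   it is the product (= Borel) sigma-algebra. *)
Definition measure_rV_display : measure_display -> measure_display.
Proof. exact. Qed.

Section measurable_rV.
Context {d} {T : measurableType d}.
Variable n : nat.

Definition coord_rV (i : 'I_n) (x : 'rV[T]_n) : T := x 0 i.

Let rV_set0 : g_sigma_preimage coord_rV set0.
Proof. exact: sigma_algebra0. Qed.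

Let rV_setC A : g_sigma_preimage coord_rV A -> g_sigma_preimage coord_rV (~` A).
Proof. exact: sigma_algebraC. Qed.

Let rV_bigcup (F : (set 'rV[T]_n)^nat) :
  (forall i, g_sigma_preimage coord_rV (F i)) ->
  g_sigma_preimage coord_rV (\bigcup_i (F i)).
Proof. exact: sigma_algebra_bigcup. Qed.

HB.instance Definition _ := @isMeasurable.Build (measure_rV_display d)
  'rV[T]_n (g_sigma_preimage coord_rV) rV_set0 rV_setC rV_bigcup.

Lemma measurable_coord_rV (i : 'I_n) : measurable_fun [set: 'rV[T]_n] (coord_rV i).
Proof.
move=> _ Y mY; rewrite setTI; apply: sub_sigma_algebra => /=.
rewrite -bigcup_seq/=; exists i => /=; first by rewrite mem_index_enum.
by exists Y => //; rewrite setTI.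
Qed.

Lemma measurable_fun_rV {d'} {T' : measurableType d'} (f : T' -> 'rV[T]_n) :
  (forall i, measurable_fun [set: T'] (coord_rV i \o f)) ->
  measurable_fun [set: T'] f.
Proof.
move=> mf _ A mA.
suff : (g_sigma_preimage coord_rV) `<=`
    (image_set_system [set: T'] f measurable).
  by move=> /(_ A mA); rewrite /image_set_system /=.
apply: smallest_sub.
  by apply: sigma_algebra_image; exact: sigma_algebra_measurable.
rewrite -bigcup_seq => B [i _ [C mC <-]] /=.
rewrite /image_set_system /= !setTI.
by have := mf i measurableT C mC; rewrite setTI.
Qed.

End measurable_rV.

Definition cons_rV (T : Type) n (z : T * 'rV[T]_n) : 'rV[T]_n.+1 :=
  row_mx (const_mx z.1 : 'rV[T]_1) z.2.

Lemma cons_rV0 T n (z : T * 'rV[T]_n) : cons_rV z 0 ord0 = z.1.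
Proof.
by rewrite mxE; case: splitP => [j _|j //]; rewrite mxE.
Qed.

Lemma cons_rVS T n (z : T * 'rV[T]_n) (i : 'I_n) :
  cons_rV z 0 (lift ord0 i) = z.2 0 i.
Proof.
rewrite mxE; case: splitP => [j|j [ij]]; first by rewrite ord1.
by congr (_ _ _); apply/val_inj.
Qed.

Definition uncons_rV (T : Type) n (x : 'rV[T]_n.+1) : T * 'rV[T]_n :=
  (x 0 ord0, \row_i x 0 (lift ord0 i)).

Lemma cons_rVK T n : cancel (@cons_rV T n) (@uncons_rV T n).
Proof.
move=> [t x]; rewrite /uncons_rV cons_rV0; congr pair.
by apply/rowP => i; rewrite mxE cons_rVS.
Qed.

Section lebesgue_rV.
Variable R : realType.

Lemma measurable_cons_rV n :
  measurable_fun [set: measurableTypeR R * 'rV[R]_n] (@cons_rV R n).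
Proof.
apply: measurable_fun_rV => i; case: (unliftP ord0 i) => [j ->|->].
- rewrite (_ : _ \o _ = @coord_rV _ R n j \o snd); last first.
    by apply/funext => z /=; rewrite /coord_rV cons_rVS.
  by apply: measurableT_comp => //; exact: measurable_coord_rV.
- rewrite (_ : _ \o _ = fst) //.
  by apply/funext => z /=; rewrite /coord_rV cons_rV0.
Qed.

Lemma measurable_uncons_rV n :
  @measurable_fun _ _ 'rV[R]_n.+1 (measurableTypeR R * 'rV[R]_n)%type setT
    (@uncons_rV R n).
Proof.
apply/measurable_fun_pairP; split; first exact: (measurable_coord_rV ord0).
apply: measurable_fun_rV => i.
rewrite (_ : _ \o _ = @coord_rV _ R n.+1 (lift ord0 i)).
  exact: measurable_coord_rV.
by apply/funext => x /=; rewrite /coord_rV mxE.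
Qed.

Section step.
Variables (n : nat) (m : {sigma_finite_measure set 'rV[R]_n -> \bar R}).

Definition lebesgue_rV_step : set 'rV[R]_n.+1 -> \bar R :=
  pushforward (@lebesgue_measure R \x m)%E (@cons_rV R n).


Let step0 : lebesgue_rV_step set0 = 0%E.
Proof. by rewrite /lebesgue_rV_step /pushforward preimage_set0 measure0. Qed.

Let step_ge0 A : (0 <= lebesgue_rV_step A)%E.
Proof. by rewrite /lebesgue_rV_step /pushforward; exact: measure_ge0. Qed.

Let step_sigma_additive : semi_sigma_additive lebesgue_rV_step.
Proof.
move=> F mF tF mUF; rewrite /lebesgue_rV_step /pushforward preimage_bigcup.
have mcons (A : set 'rV[R]_n.+1) : measurable A ->
    measurable (@cons_rV R n @^-1` A : set (measurableTypeR R * 'rV[R]_n)).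
  by move=> mA; rewrite -[X in measurable X]setTI; exact: measurable_cons_rV.
apply: measure_semi_sigma_additive.
- by move=> k; exact: mcons.
- apply/trivIsetP => /= i j _ _ ij; rewrite -preimage_setI.
  by move/trivIsetP : tF => /(_ _ _ _ _ ij) ->//; rewrite preimage_set0.
- by rewrite -preimage_bigcup; exact: mcons.
Qed.

HB.instance Definition _ := isMeasure.Build _ _ _ lebesgue_rV_step
  step0 step_ge0 step_sigma_additive.

Let step_sigma_finite : sigma_finite setT lebesgue_rV_step.
Proof.
have /sigma_finiteP[F [TF ndF Foo]] := sigma_finiteT (@lebesgue_measure R).
have /sigma_finiteP[G [TG ndG Goo]] := sigma_finiteT m.
exists (fun k => @uncons_rV R n @^-1` (F k `*` G k)).
  rewrite -preimage_bigcup (_ : \bigcup_i _ = setT) ?preimage_setT//.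
  apply/seteqP; split => [//|[x y] _].
  have [k _ Fkx] : (\bigcup_i F i) x by rewrite -TF.
  have [l _ Gly] : (\bigcup_i G i) y by rewrite -TG.
  exists (maxn k l) => //; split => /=.
  - by move: x Fkx; exact/subsetPset/ndF/leq_maxl.
  - by move: y Gly; exact/subsetPset/ndG/leq_maxr.
move=> k; have [mF Fkoo] := Foo k; have [mG Gkoo] := Goo k; split.
  rewrite -[X in measurable X]setTI; apply: measurable_uncons_rV => //.
  exact: measurableX.
rewrite /lebesgue_rV_step /pushforward -comp_preimage.
rewrite (_ : _ \o _ = id); last by apply/funext => z /=; rewrite cons_rVK.
by rewrite preimage_id product_measure1E// lte_mul_pinfty// ge0_fin_numE.
Qed.

HB.instance Definition _ := Measure_isSigmaFinite.Build _ _ _ lebesgue_rV_step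
  step_sigma_finite.

End step.

(* Lebesgue measure on R^n, as the n-fold product of [lebesgue_measure]
   (characterized on boxes by [lebesgue_rV_box] below). *)
Fixpoint lebesgue_rV n : {sigma_finite_measure set 'rV[R]_n -> \bar R} :=
  match n with
  | 0 => \d_(0 : 'rV[R]_0)
  | k.+1 => lebesgue_rV_step (lebesgue_rV k)
  end.

Lemma lebesgue_rV_box n (A : 'I_n -> set R) : (forall i, measurable (A i)) ->
  lebesgue_rV n [set x | forall i, A i (x 0 i)] =
  (\prod_(i < n) @lebesgue_measure R (A i))%E.
Proof.
elim: n A => [|n ih] A mA /=.
  rewrite big_ord0 /dirac/= indicE mem_set//= => -[]//.
rewrite /lebesgue_rV_step /pushforward.
rewrite [X in (_ \x _)%E X](_ : _ = A ord0 `*`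
    [set x : 'rV[R]_n | forall i, A (lift ord0 i) (x 0 i)]); last first.
  apply/seteqP; split => [z /= Az|z /= [Az0 AzS] i].
    split; first by have := Az ord0; rewrite cons_rV0.
    by move=> i; have := Az (lift ord0 i); rewrite cons_rVS.
  by case: (unliftP ord0 i) => [j ->|->]; rewrite ?cons_rVS ?cons_rV0.
have mB : measurable [set x : 'rV[R]_n | forall i, A (lift ord0 i) (x 0 i)].
  rewrite (_ : mkset _ =
    \bigcap_(i in [set: 'I_n]) ((@coord_rV _ R n i) @^-1` A (lift ord0 i))).
    apply: fin_bigcap_measurable => // i _.
    by rewrite -[X in measurable X]setTI; exact: measurable_coord_rV.
  by apply/seteqP; split => [x /= xA i _|x /= xA i]; [exact: xA|exact: (xA i)].
rewrite product_measure1E//; last exact: mA.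
by rewrite big_ord_recl; congr (_ * _)%E; exact: (ih (fun i => A (lift ord0 i))).
Qed.

End lebesgue_rV.

Section norms.
Context {R : realType} {n : nat}.
Local Notation Rn := 'rV[R]_n.
Local Notation mu := (@lebesgue_rV R n).
Implicit Types (u g : Rn -> Rn) (x y : Rn).

(* The library norm on matrices is the sup norm. *)
Definition enorm x : R := Num.sqrt (\sum_i x 0 i ^+ 2).

Definition dot x y : R := \sum_i x 0 i * y 0 i.

Definition eball x (rho : R) : set Rn := [set y | enorm (y - x) < rho].

Local Open Scope ereal_scope.

Definition normLp (p : \bar R) u : \bar R := 'N[mu]_p[(fun x => (enorm (u x))%:E)].

Definition wnorm (a : R) (p : \bar R) u : \bar R :=
  'N[mu]_p[(fun x => (enorm (u x) * enorm x `^ a)%R%:E)].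

Definition inLp (p : \bar R) u : Prop :=
  measurable_fun [set: Rn] u /\ normLp p u < +oo.

Definition inwLp (a : R) (p : \bar R) u : Prop :=
  measurable_fun [set: Rn] u /\ wnorm a p u < +oo.

Definition local_wnorm (a p rho : R) u : \bar R :=
  ereal_sup (range (fun x =>
    (\int[mu]_(y in eball x rho)
       (enorm (u y) `^ p * enorm y `^ (a * p))%R%:E) `^ p^-1)).

Definition rearrangement g (t : R) : \bar R :=
  ereal_inf (EFin @`
    [set s : R | (0 <= s)%R /\ mu [set x | (s < enorm (g x))%R] <= t%:E]).

Definition lorentz_qnorm (r s : R) g : \bar R :=
  (\int[@lebesgue_measure R]_(t in `]0%R, +oo[)
     (((t `^ r^-1)%R%:E * rearrangement g t) `^ s * (t^-1)%R%:E)) `^ s^-1.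

Definition inLorentz (r s : R) g : Prop :=
  measurable_fun [set: Rn] g /\ lorentz_qnorm r s g < +oo.

End norms.

Section smoothness.
Context {R : realType} {V W : normedModType R}.

(* C^k on an open set A.  For finite-dimensional V, quantifying over all the
   directions v amounts to quantifying over a basis. *)
Fixpoint Ck (k : nat) (A : set V) (f : V -> W) : Prop :=
  (forall x, A x -> {for x, continuous f}) /\
  match k with
  | 0 => True
  | k'.+1 => forall v, (forall x, A x -> derivable f x v) /\
                       Ck k' A (fun x => 'D_v f x)
  end.

Definition smooth (A : set V) (f : V -> W) : Prop := forall k, Ck k A f.

End smoothness.

Section navier_stokes.
Context {R : realType} {n : nat}.
Local Notation Rn := 'rV[R]_n.
Local Notation mu := (@lebesgue_rV R n).

Definition partial (W : normedModType R) (i : 'I_n) (f : Rn -> W) (x : Rn) : W :=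
  'D_(delta_mx 0 i) f x.

Definition grad (f : Rn -> R) (x : Rn) : Rn := \row_i partial i f x.

Definition divergence (w : Rn -> Rn) (x : Rn) : R :=
  \sum_i partial i (fun y => w y 0 i) x.

Definition laplacian (w : Rn -> Rn) (x : Rn) : Rn :=
  \sum_i partial i (partial i w) x.

Definition convection (w z : Rn -> Rn) (x : Rn) : Rn :=
  \sum_i w x 0 i *: partial i z x.

(* The final time T may be +oo. *)
Definition slab (T : \bar R) : set (R * Rn) :=
  [set tx | 0 < tx.1 /\ (tx.1%:E < T)%E].

Definition NS_solution (T : \bar R) (v : R -> Rn -> Rn) (pr : R -> Rn -> R) : Prop :=
  [/\ smooth (slab T) (fun tx : R * Rn => v tx.1 tx.2),
      smooth (slab T) (fun tx : R * Rn => pr tx.1 tx.2) &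
      forall t x, slab T (t, x) ->
        derive1 (fun s => v s x) t + convection (v t) (v t) x + grad (pr t) x
          = laplacian (v t) x /\
        divergence (v t) x = 0].

Definition test_function (phi : Rn -> R) : Prop :=
  smooth [set: Rn] phi /\ compact (closure [set x | phi x != 0]).

Definition weakly_divergence_free (u0 : Rn -> Rn) : Prop :=
  forall phi, test_function phi ->
    (\int[mu]_x (dot (u0 x) (grad phi x))%:E = 0)%E.

(* Extended-real valued: the value is finite exactly when the measurable
   integrand is integrable, so convergence of such pairings to a finite limit
   includes their being eventually well defined. *)
Definition pairing (w phi : Rn -> Rn) : \bar R :=
  (\int[mu]_x (dot (w x) (phi x))%:E)%E.

Definition alpha (p : R) : R := 1 - n%:R / p.

(* The exponent q only matters when p < 2n. *)
Definition X (p q : R) (phi : Rn -> Rn) : Prop :=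
  inwLp (- alpha p) (hoelder_conjugate p%:E) phi /\
  if p < 2 * n%:R then inLp (hoelder_conjugate q%:E) phi
  else if p == 2 * n%:R then inLorentz (n%:R / (n%:R - 1)) 1 phi
  else inLorentz (n%:R * p / (p * (n%:R - 2) + 2 * n%:R)) 1 phi.

Local Open Scope ereal_scope.

Definition K (p : R) (u0 : Rn -> Rn) (c0 c1 t rho : R) : \bar R :=
  c0%:E * local_wnorm (alpha p) p rho u0 +
  (c1 * expR (- (rho ^+ 2 / (8 * t))))%R%:E * wnorm (alpha p) p%:E u0.

Definition decay (p q : R) (v : R -> Rn -> Rn) (t : R) : \bar R :=
  (t `^ (n%:R / (2 * p)))%R%:E * wnorm (alpha p) +oo (v t) +
  (t `^ 2^-1)%R%:E * normLp +oo (v t) +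
  (t `^ (n%:R / 2 * (n%:R^-1 - q^-1)))%R%:E * normLp q%:E (v t).

Record existence_class (p qX : R) (u0 : Rn -> Rn) (T : \bar R)
    (v : R -> Rn -> Rn) (pr : R -> Rn -> R) : Prop := ExistenceClass {
  class_time : 0 < T ;
  class_solution : NS_solution T v pr ;
  class_bound : forall q : R, (p < q)%R ->
    let gamma := (1 - n%:R / q)%R in
    exists rho c0 c1 c : R,
      [/\ (0 < rho)%R, (0 < c0)%R, (0 < c1)%R, (0 < c)%R &
        forall t : R, (0 < t)%R -> t%:E < T ->
          decay p q v t <= K p u0 c0 c1 t rho +
            c%:E * wnorm (alpha p) p%:E u0 `^ (1 - gamma) *
            K p u0 c0 c1 t rho `^ gamma] ;
  class_limit0 : forall q : R, (p < q)%R ->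
    decay p q v t @[t --> 0^'+] --> 0 ;
  class_datum : forall phi, X p qX phi ->
    pairing (v t) phi @[t --> 0^'+] --> pairing u0 phi }.

End navier_stokes.

(* Main.v *)
(** Put w = u - v. Both equations are tested with derivatives of
    prod_i theta(y_i / r) g_(t - tau + s)(y_i - x_i), arranged as a divergence-free
    field; here g is the one-dimensional heat kernel and theta a cutoff. Compact
    support and zero divergence remove the pressure, of which nothing is known at
    infinity, and the heat kernel absorbs the Laplacian up to O(1/r). This bounds
    the pairing of w with the Laplacian of the heat kernel at scale s, which is the
    derivative in s of the heat extension of w(t). Integrating from s = 0, where
    the extension is w(t), to s = oo, where it vanishes, gives for flows bounded by
    e t^(-1/2)
      sup t^(n/2p) |x_k|^alpha |w(t, x)| <= C e sup t^(n/2p) |x_k|^alpha |w(t, x)|.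
    The weight of one coordinate suffices and keeps all integrals one-dimensional;
    integrals in time are avoided by comparing derivatives.
    Near t = 0 the constant e is small by (ii), the supremum is finite by (i), and w
    has zero initial value by (iii), so w = 0. At later times u and v are bounded,
    and the estimate with a time origin inside the region where w = 0 extends w = 0
    by steps of a fixed length. Then the pressures have the same gradient. *)

(* Compact support and zero divergence exclude the Oseen kernel, since projecting [g e_j] destroys
   locality. The field [(Lap g) e_j - grad (d_j g)] stays local, and as [div w = 0], only [Lap g] is
   seen by [w]. The price is a Laplacian in place of [w]; the integral over the heat scale undoes it
   because [Lap g = d_s g]. The weight has two uses. For [0 < a < 1] a Gaussian average of
   [|y_k|^(-a)] is at most a multiple of [|x_k|^(-a)], so the estimate returns in the form in which
   it was fed in; and such averages tend to zero at large scales, which a bound on [sup |w|] alone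
   would not give. The powers of time balance exactly: [e u^(-1/2)] times [N u^(-(1-a)/2)] is
   integrable at 0 since [a > 0], and against three space derivatives of the kernel, integrated in
   [u] and in [s], it gives back [t^(-(1-a)/2)]. The scale integral converges because the time
   integral is kept as a difference of two inverse roots. The cutoff radius is chosen after the
   scales, since the [O(1/r)] error is not uniform in them. *)
Require Import Defs.
From mathcomp Require Import all_boot all_order all_algebra.
From mathcomp Require Import all_classical all_reals all_analysis.
From mathcomp Require Import measurable_realfun ess_sup_inf ring lra zify.

Import Order.TTheory GRing.Theory Num.Theory.
Import numFieldNormedType.Exports.
Local Open Scope classical_set_scope.
Local Open Scope ring_scope.

Set Implicit Arguments.
Unset Strict Implicit.
Unset Printing Implicit Defensive.

(** * Lebesgue measure on R^n *)

Section lebesgue_rV_theory.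
Context {R : realType}.
Local Notation leb := (@lebesgue_measure R).
Local Notation mu := (@lebesgue_rV R _).

Lemma continuous_coord n (i : 'I_n) : continuous (fun x : 'rV[R]_n => x 0 i).
Proof. exact: coord_continuous. Qed.

Lemma measurable_coord n (i : 'I_n) :
  measurable_fun [set: 'rV[R]_n] (fun x : 'rV[R]_n => x 0 i).
Proof. exact: (@measurable_coord_rV _ R n i). Qed.

Lemma measurable_box n (A : 'I_n -> set R) : (forall i, measurable (A i)) ->
  measurable [set x : 'rV[R]_n | forall i, A i (x 0 i)].
Proof.
move=> mA; rewrite (_ : mkset _ = \bigcap_(i in [set: 'I_n])
    ((fun x : 'rV[R]_n => x 0 i) @^-1` A i)).
  apply: fin_bigcap_measurable => // i _.
  by rewrite -[X in measurable X]setTI; exact: measurable_coord.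
by apply/seteqP; split => [x /= xA i _|x /= xA i]; [exact: xA|exact: (xA i)].
Qed.

Lemma nbhs_box n (x : 'rV[R]_n) (A : set 'rV[R]_n) : nbhs x A ->
  exists2 e : R, 0 < e & forall y : 'rV[R]_n, (forall i, `|x 0 i - y 0 i| < e) -> A y.
Proof.
rewrite -nbhs_ballE => -[e /= e0 eA]; exists e => // y xy; apply: eA; split => // i j.
by rewrite ord1; exact: xy.
Qed.

(** The sigma-algebra is generated by the coordinates, so an open set must be written as a countable
    union of boxes: those with rational centre and radius [1/(m+1)] contained in [A] suffice. *)
Lemma open_measurable_rV n (A : set 'rV[R]_n) : open A -> measurable A.
Proof.
move=> oA.
pose Q (q : 'rV[rat]_n * nat) : set 'rV[R]_n :=
  [set y | forall i, `|ratr (q.1 0 i) - y 0 i| < q.2.+1%:R^-1].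
rewrite (_ : A = \bigcup_(q in [set q | Q q `<=` A]) Q q); last first.
  apply/seteqP; split => [x Ax|x [q qA]]; last exact: qA.
  have /nbhs_box[e e0 eA] : nbhs x A by move: oA; rewrite openE; exact.
  have [m me] : exists m : nat, m.+1%:R^-1 < e / 2.
    have [m _ /(_ m (leqnn _)) /= me] :=
      near_infty_natSinv_lt (PosNum (divr_gt0 e0 (ltr0n R 2))).
    by exists m.
  have q_ (i : 'I_n) : exists q : rat, `|ratr q - x 0 i| < m.+1%:R^-1.
    have [||y [qx [/= q _ qy]]] := dense_rat (O := ball (x 0 i) m.+1%:R^-1).
      by exists (x 0 i); apply: ballxx; rewrite invr_gt0.
      exact: ball_open.
    by exists q; rewrite qy distrC; exact: qx.
  have [q qE] := choice q_.
  exists (\row_i q i, m) => /=; last by move=> i; rewrite mxE.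
  move=> y yq; apply: eA => i.
  have := yq i; rewrite mxE /= => h1; have h2 := qE i.
  rewrite (_ : _ - _ = (x 0 i - ratr (q i)) + (ratr (q i) - y 0 i)); last by ring.
  rewrite (le_lt_trans (ler_normD _ _))// distrC.
  rewrite [ltRHS](splitr e) ltrD//; exact: lt_trans me.
rewrite bigcup_mkcond; apply: countable_bigcupT_measurable => //.
move=> q; case: ifPn => // _.
apply: (@measurable_box n (fun i => [set y | `|ratr (q.1 0 i) - y| < q.2.+1%:R^-1])).
by move=> i; apply: open_measurable; exact: (@ball_open _ R^o).
Qed.

Lemma continuous_measurable_rV n (f : 'rV[R]_n -> R) :
  continuous f -> measurable_fun setT f.
Proof.
move=> cf; apply: (measurability _ (RGenOpens.measurableE R)) => _ [_ [a [b ->] <-]].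
rewrite setTI; apply: open_measurable_rV; by apply: open_comp.
Qed.


Local Open Scope ereal_scope.

(** Tonelli's theorem, as the measure in dimension [n.+1] is a pushforward of a product measure.
    Inductions on the dimension go through it. *)
Lemma ge0_integral_rVS n (f : 'rV[R]_n.+1 -> \bar R) :
  measurable_fun setT f -> (forall x, 0 <= f x) ->
  \int[mu]_x f x = \int[leb]_t \int[mu]_y f (cons_rV (t, y)).
Proof.
move=> mf f0.
have mfc := measurableT_comp mf (@measurable_cons_rV R n).
rewrite -(@fubini_tonelli1 _ _ _ _ _ leb (@lebesgue_rV R n)
  (f \o @cons_rV R n) mfc (fun z => f0 _)).
have := @ge0_integral_pushforward _ _ _ _ _ _ (@measurable_cons_rV R n)
  (leb \x (@lebesgue_rV R n)) setT f measurableT mf (fun y _ => f0 y).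
rewrite preimage_setT => <-.
by apply: eq_measure_integral; first exact: measurable_cons_rV.
Qed.

Lemma measurable_cons_rVr n (f : 'rV[R]_n.+1 -> \bar R) t :
  measurable_fun setT f -> measurable_fun setT (fun y => f (cons_rV (t, y))).
Proof.
move=> mf; apply: measurableT_comp => //.
exact: measurableT_comp (@measurable_cons_rV R n) (pair1_measurable _).
Qed.

Lemma measurable_ge0_integral_rVr n (f : 'rV[R]_n.+1 -> \bar R) :
  measurable_fun setT f -> (forall x, 0 <= f x) ->
  measurable_fun setT (fun t : measurableTypeR R => \int[mu]_y f (cons_rV (t, y))).
Proof.
move=> mf f0.
apply: (@measurable_fun_fubini_tonelli_F _ _ _ _ _ (@lebesgue_rV R n) (f \o @cons_rV R n)).
  exact: measurableT_comp (@measurable_cons_rV R n).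
by move=> z; exact: f0.
Qed.

Lemma lebesgue_measure_shift (c : R) (A : set R) : measurable A ->
  pushforward leb (fun t : measurableTypeR R => t + c : measurableTypeR R)%R A = leb A.
Proof.
move=> mA.
have mc : measurable_fun [set: measurableTypeR R]
    (fun t : measurableTypeR R => t + c : measurableTypeR R)%R.
  exact: measurable_funD.
apply/esym/lebesgue_measure_unique; last exact: mA.
move=> _ [[a b]] _ <-.
rewrite [RHS](_ : _ = leb `](a - c)%R, (b - c)%R]%classic); last first.
  congr (leb _); apply/seteqP.
  by split => x /=; rewrite !in_itv/= ltrBlDr lerBrDr.
by rewrite !lebesgue_measure_itv/= !lte_fin ltrD2r -!EFinD; case: ifP => // _; congr _%:E; ring.
Qed.

Lemma ge0_integral_shift (c : R) (f : R -> \bar R) :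
  measurable_fun setT f -> (forall x, 0 <= f x) ->
  \int[leb]_t f (t + c)%R = \int[leb]_t f t.
Proof.
move=> mf f0.
have mc : measurable_fun [set: measurableTypeR R]
    (fun t : measurableTypeR R => t + c : measurableTypeR R)%R.
  exact: measurable_funD.
have := @ge0_integral_pushforward _ _ _ _ _ _ mc leb setT f measurableT mf (fun y _ => f0 y).
rewrite preimage_setT => <-.
apply: eq_measure_integral => A mA _.
exact: lebesgue_measure_shift.
Qed.

Lemma cons_rVD n (t s : R) (x y : 'rV[R]_n) :
  cons_rV ((t + s)%R, (x + y)%R) = (cons_rV (t, x) + cons_rV (s, y))%R.
Proof.
apply/rowP => i; rewrite [RHS]mxE; case: (unliftP ord0 i) => [j ->|->].
  by rewrite !cons_rVS /= mxE.
by rewrite !cons_rV0.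
Qed.

Lemma uncons_rVK n : cancel (@uncons_rV R n) (@cons_rV R n).
Proof.
move=> x; apply/rowP => i; case: (unliftP ord0 i) => [j ->|->].
  by rewrite cons_rVS mxE.
by rewrite cons_rV0.
Qed.

Lemma measurable_shift_rV n (c : 'rV[R]_n) :
  measurable_fun setT (fun x : 'rV[R]_n => (x + c)%R).
Proof.
apply: measurable_fun_rV => i.
rewrite (_ : _ \o _ = fun x : 'rV[R]_n => (x 0 i + c 0 i)%R); last first.
  by apply/funext => x /=; rewrite /coord_rV mxE.
by apply: measurable_funD => //; exact: measurable_coord.
Qed.

Lemma ge0_integral_shift_rV n (c : 'rV[R]_n) (f : 'rV[R]_n -> \bar R) :
  measurable_fun setT f -> (forall x, 0 <= f x) ->
  \int[mu]_x f (x + c)%R = \int[mu]_x f x.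
Proof.
elim: n c f => [|n ih] c f mf f0.
  by apply: eq_integral => x _; congr f; apply/rowP => -[].
have mfc : measurable_fun setT (fun x : 'rV[R]_n.+1 => f (x + c)%R).
  by apply: measurableT_comp => //; exact: measurable_shift_rV.
rewrite !ge0_integral_rVS//.
rewrite -(uncons_rVK c); set c0 := (uncons_rV c).1; set c' := (uncons_rV c).2.
transitivity (\int[leb]_t \int[mu]_y f (cons_rV ((t + c0)%R, (y + c')%R))).
  by apply: eq_integral => t _; apply: eq_integral => y _; rewrite cons_rVD -surjective_pairing.
under eq_integral => t _ do
  rewrite (ih c' (fun y => f (cons_rV ((t + c0)%R, y))) (measurable_cons_rVr _ mf))//.
apply: (ge0_integral_shift c0 (f := fun t => \int[mu]_y f (cons_rV (t, y)))).
  exact: measurable_ge0_integral_rVr.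
by move=> x; apply: integral_ge0.
Qed.

Lemma ge0_integral_prod_rV n (f : 'I_n -> R -> R) :
  (forall i, measurable_fun setT (f i)) -> (forall i t, 0 <= f i t)%R ->
  \int[mu]_x (\prod_i f i (x 0%R i))%:E = \prod_i \int[leb]_t (f i t)%:E.
Proof.
elim: n f => [|n ih] f mf f0.
  rewrite big_ord0; under eq_integral do rewrite big_ord0.
  by rewrite integral_cst//= diracT mul1e.
have mp m (g : 'I_m -> R -> R) : (forall i, measurable_fun setT (g i)) ->
    measurable_fun setT (fun x : 'rV[R]_m => (\prod_i g i (x 0%R i)))%R.
  move=> mg; apply: measurable_prod => i _.
  by apply: measurableT_comp => //; exact: measurable_coord.
have mF : measurable_fun setT (fun x : 'rV[R]_n.+1 => (\prod_i f i (x 0%R i))%:E).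
  by apply/measurable_EFinP; exact: mp.
rewrite (ge0_integral_rVS mF); last by move=> x; rewrite lee_fin prodr_ge0.
rewrite big_ord_recl -ih//.
transitivity (\int[leb]_t ((f ord0 t)%:E *
   \int[mu]_x (\prod_(i < n) f (lift ord0 i) (x 0%R i))%:E)).
  apply: eq_integral => t _; rewrite -ge0_integralZl//.
  - apply: eq_integral => y _; rewrite big_ord_recl EFinM cons_rV0.
    by congr (_ * (_)%:E); apply: eq_bigr => i _; rewrite cons_rVS.
  - by apply/measurable_EFinP; apply: (mp _ (fun i => f (lift ord0 i))).
  - by move=> x _; rewrite lee_fin prodr_ge0.
  - by rewrite lee_fin.
rewrite ge0_integralZr//.
- by apply/measurable_EFinP; exact: mf.
- by move=> x _; rewrite lee_fin.
- by apply: integral_ge0 => x _; rewrite lee_fin prodr_ge0.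
Qed.

End lebesgue_rV_theory.

(** * Differentiation under the integral sign *)

Section calculus_rV.
Context {R : realType} {n : nat}.
Local Notation Rn := 'rV[R]_n.
Local Notation mu := (@lebesgue_rV R n).
Local Notation e_ k := (delta_mx 0 k : Rn).

Definition box (r : R) : set Rn := [set x | forall i, `|x 0 i| <= r].

Lemma box_itv r : box r = [set x : Rn | forall i, `[- r, r]%classic (x 0 i)].
Proof.
by apply/seteqP; split=> x /= xr i; move: (xr i); rewrite in_itv/= -ler_norml.
Qed.

Lemma measurable_cube r : measurable (box r).
Proof. by rewrite box_itv; apply: (@measurable_box _ _ (fun _ => `[- r, r]%classic)). Qed.

Lemma lebesgue_cube_lty r : (mu (box r) < +oo)%E.
Proof.
rewrite box_itv (@lebesgue_rV_box R n (fun _ => `[- r, r]%classic))//.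
rewrite (_ : \prod_(i < n) _ = \prod_(i < n) (fine (@lebesgue_measure R `[- r, r]%classic))%:E)%E.
  by rewrite prodEFin ltry.
apply: eq_bigr => i _; rewrite fineK//.
by rewrite lebesgue_measure_itv; case: ifP.
Qed.

Lemma compact_cube r : compact (box r).
Proof.
by rewrite box_itv; apply: (@rV_compact _ _ (fun _ => `[- r, r]%classic)) => i; exact: segment_compact.
Qed.

Lemma pair_continuous_r (U V : topologicalType) (s : U) :
  continuous (fun y : V => (s, y)).
Proof.
by move=> y; exact: (cvg_pair (cvg_cst s) cvg_id).
Qed.

Lemma bounded_on_cylinder (f : R * Rn -> R) (a b r : R) :
  (forall t y, a <= t <= b -> {for (t, y), continuous f}) ->
  exists M, forall t y, a <= t <= b -> box r y -> `|f (t, y)| <= M.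
Proof.
move=> cf; pose A := `[a, b]%classic `*` box r.
have [[x0 Ax0]|A0] := pselect (A !=set0); last first.
  exists 0 => t y tab yr; case: A0; exists (t, y).
  by split; rewrite //= in_itv.
have cA : compact A by apply: compact_setX; [exact: segment_compact|exact: compact_cube].
have [||c cA' fc] := @compact_EVT_max _ R (fun x => `|f x|) A _ cA.
  by exists x0.
  apply: continuous_in_subspaceT => -[t y]; rewrite inE => -[/= tab _].
  apply: (@continuous_comp _ _ _ f (fun x => `|x|)); last exact: norm_continuous.
  by apply: cf; move: tab; rewrite in_itv.
exists `|f c| => t y tab yr; by apply: fc; rewrite inE; split => //=; rewrite in_itv.
Qed.

Lemma integrable_cube (f : Rn -> R) (M r : R) : measurable_fun setT f ->
  (forall x, `|f x| <= M) -> (forall x, ~ box r x -> f x = 0) ->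
  mu.-integrable setT (EFin \o f).
Proof.
move=> mf fM f0.
have : mu.-integrable (box r) (EFin \o f).
  apply: measurable_bounded_integrable; [exact: measurable_cube|exact: lebesgue_cube_lty| |].
    exact: measurable_funTS.
  by exists M; split; [exact: num_real|move=> x Mx y _ /=; rewrite (le_trans (fM _))// ltW].
rewrite (integrable_mkcond _ (measurable_cube r)); congr (integrable _ _ _).
apply/funext => x; rewrite /patch; case: ifPn => //.
by rewrite notin_setE => /f0 /= ->.
Qed.

Lemma continuous_cube_integrable (f : Rn -> R) (r : R) : continuous f ->
  (forall x, ~ box r x -> f x = 0) -> mu.-integrable setT (EFin \o f).
Proof.
move=> cf f0.
have [|M fM] := @bounded_on_cylinder (f \o snd) 0 0 r.
  move=> t y _; apply: (@continuous_comp _ _ _ snd f); [exact: cvg_snd|exact: cf].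
apply: (@integrable_cube _ (Num.max M 0) r) => //; first exact: continuous_measurable_rV.
move=> x; have [xr|/f0 ->] := pselect (box r x); last by rewrite normr0 le_max lexx orbT.
by rewrite le_max (fM 0)// lexx.
Qed.

Lemma integral_shift_rV (c : Rn) (f : Rn -> R) : measurable_fun setT f ->
  \int[mu]_x f (x + c) = \int[mu]_x f x.
Proof.
move=> mf; rewrite /Rintegral.
suff -> : (\int[mu]_x (f (x + c)%R)%:E = \int[mu]_x (f x)%:E)%E by [].
rewrite [LHS]integralE [RHS]integralE.
have mF : measurable_fun setT (EFin \o f) by exact/measurable_EFinP.
congr (_ - _)%E.
- rewrite -[RHS](ge0_integral_shift_rV c (measurable_funepos mF)).
    by apply: eq_integral => x _; rewrite !funeposE.
  by move=> x; exact: funepos_ge0.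
- rewrite -[RHS](ge0_integral_shift_rV c (measurable_funeneg mF)).
    by apply: eq_integral => x _; rewrite !funenegE.
  by move=> x; exact: funeneg_ge0.
Qed.

(** Domination comes from compactness: [dF] is continuous, hence bounded on a closed time interval
    around [t] (between two midpoints) times the box that carries the support. *)
Lemma is_derive_integral (a b t r : R) (F dF : R -> Rn -> R) : a < t < b ->
  (forall s y, a < s < b -> is_derive s 1 (F^~ y) (dF s y)) ->
  (forall s y, a < s < b -> {for (s, y), continuous (fun z : R * Rn => F z.1 z.2)}) ->
  (forall s y, a < s < b -> {for (s, y), continuous (fun z : R * Rn => dF z.1 z.2)}) ->
  (forall s y, a < s < b -> ~ box r y -> F s y = 0) ->
  (forall s y, a < s < b -> ~ box r y -> dF s y = 0) ->
  is_derive t 1 (fun s => \int[mu]_y F s y) (\int[mu]_y dF t y).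
Proof.
move=> /andP[at_ tb] Fd cF cdF F0 dF0.
pose u := (a + t) / 2; pose v := (t + b) / 2.
have uv s : u <= s <= v -> a < s < b by rewrite /u /v; lra.
have uv' s : `]u, v[%classic s -> a < s < b by rewrite /= in_itv/= => /andP[? ?]; apply: uv; lra.
have tuv : `]u, v[%classic t by rewrite /= in_itv/= /u /v; lra.
have [|M dFM] := @bounded_on_cylinder (fun z : R * Rn => dF z.1 z.2) u v r.
  by move=> s y /uv; exact: cdF.
have ct (G : R -> Rn -> R) s : (forall y, {for (s, y), continuous (fun z : R * Rn => G z.1 z.2)}) -> continuous (G s).
  move=> cG y; apply: (@continuous_comp _ _ _ (fun y => (s, y)) (fun z : R * Rn => G z.1 z.2)).
    exact: pair_continuous_r.
  exact: cG.
have iF s : `]u, v[%classic s -> mu.-integrable setT (EFin \o F s).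
  by move=> /uv' sab; apply: (@continuous_cube_integrable _ r); [apply: ct => y; exact: cF|move=> y; exact: F0].
have dFE s y : a < s < b -> partial1of2 F s y = dF s y.
  by move=> sab; rewrite partial1of2E; have := Fd s y sab => -[_ ->].
pose G y := Num.max M 0 * (\1_(box r) y : R).
have G0 y : 0 <= G y by rewrite /G mulr_ge0// le_max lexx orbT.
have iG : mu.-integrable setT (EFin \o G).
  apply: (@integrable_cube _ (Num.max M 0) r).
  - apply: measurable_funM => //; apply: measurable_indic; exact: measurable_cube.
  - move=> x; rewrite ger0_norm// /G indicE ler_piMr//; first by rewrite le_max lexx orbT.
    by case: (_ \in _).
  - by move=> x xr; rewrite /G indicE memNset// mulr0.
have bG s y : `]u, v[%classic s -> setT y -> `|partial1of2 F s y| <= G y.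
  move=> suv _; rewrite dFE; last exact: uv'.
  have [yr|yr] := pselect (box r y); last by rewrite dF0 ?normr0//; exact: uv'.
  rewrite /G indicE mem_set//= mulr1 le_max dFM//.
  by move: suv; rewrite /= in_itv/= => /andP[? ?]; lra.
have dd s y : `]u, v[%classic s -> setT y -> derivable (F^~ y) s 1.
  by move=> /uv' sab _; have [] := Fd s y sab.
rewrite (_ : \int[mu]_y dF t y = \int[mu]_y partial1of2 F t y); last first.
  by apply: eq_Rintegral => y _; rewrite dFE//; lra.
apply: DeriveDef.
  exact: (derivable_under_integral measurableT tuv iF dd G0 iG bG).
rewrite -derive1E.
exact: (differentiation_under_integral measurableT tuv iF dd G0 iG bG).
Qed.

Definition is_partial (k : 'I_n) (f : Rn -> R) (x : Rn) (d : R) :=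
  is_derive (0 : R) (1 : R) (fun s : R => f (x + s *: e_ k)) d.

Lemma is_derive_line (k : 'I_n) (f df : Rn -> R) x (s : R) :
  (forall y, is_partial k f y (df y)) ->
  is_derive s 1 (fun s : R => f (x + s *: e_ k)) (df (x + s *: e_ k)).
Proof.
move=> fd; have := fd (x + s *: e_ k); rewrite /is_partial => h.
have -> : (fun s0 : R => f (x + s0 *: e_ k)) =
    (fun s0 : R => f (x + s *: e_ k + s0 *: e_ k)) \o (fun s0 => s0 - s).
  by apply/funext => s0 /=; rewrite -addrA -scalerDl (addrC s) subrK.
rewrite -[df _]mulr1; apply: is_derive1_comp; rewrite ?subrr//.
by apply: is_derive_eq; rewrite subr0.
Qed.

(** Translation invariance makes the integral of [h (y + s e_k)] constant in [s], and the integral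
    of [dh] is its derivative at [s = 0]. *)
Lemma integral_partial0 (k : 'I_n) (h dh : Rn -> R) (r : R) :
  (forall x, is_partial k h x (dh x)) -> continuous h -> continuous dh ->
  (forall x, ~ box r x -> h x = 0) -> (forall x, ~ box r x -> dh x = 0) ->
  \int[mu]_x dh x = 0.
Proof.
move=> hd ch cdh h0 dh0.
have in1 i s : -1 < s < 1 -> `|(s *: e_ k : Rn) 0 i| <= 1.
  move=> s1; rewrite !mxE eqxx/=; case: (i == k) => /=.
    by rewrite mulr1 ler_norml; lra.
  by rewrite mulr0 normr0.
(* Shifts by less than one enlarge the support by at most one, hence the box of radius [r + 1]. *)
have out s y : -1 < s < 1 -> ~ box (r + 1) y -> ~ box r (y + s *: e_ k).
  move=> s1 + yr; apply => i.
  have := yr i; rewrite [_ 0 i]mxE => yri.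
  rewrite -(addrK ((s *: e_ k) 0 i) (y 0 i)) (le_trans (ler_normB _ _))//.
  by rewrite lerD// in1.
have cont (g : Rn -> R) s y : continuous g ->
    {for (s, y), continuous (fun z : R * Rn => g (z.2 + z.1 *: e_ k))}.
  move=> cg; apply: (@continuous_comp _ _ _ (fun z : R * Rn => z.2 + z.1 *: e_ k) g); last exact: cg.
  apply: cvgD; first exact: cvg_snd.
  by apply: cvgZr_tmp; exact: cvg_fst.
have := @is_derive_integral (-1) 1 0 (r + 1) (fun s y => h (y + s *: e_ k))
  (fun s y => dh (y + s *: e_ k)).
rewrite (_ : (fun s : R => _) = cst (\int[mu]_x h x)); last first.
  by apply/funext => s; rewrite integral_shift_rV//; exact: continuous_measurable_rV.
rewrite (_ : \int[mu]_y dh (y + 0 *: e_ k) = \int[mu]_y dh y); last first.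
  by apply: eq_Rintegral => y _; rewrite scale0r addr0.
move=> /(_ _ _ _ _ _ _)[].
- by rewrite ltrN10 ltr01.
- by move=> s y s1; exact: is_derive_line.
- by move=> s y s1; exact: cont.
- by move=> s y s1; exact: cont.
- by move=> s y s1 yr; apply: h0; exact: out.
- by move=> s y s1 yr; apply: dh0; exact: out.
by move=> _ <-; rewrite derive_cst.
Qed.

End calculus_rV.

(** * Gaussian kernel and cutoff *)

Section gaussian.
Context {R : realType}.
Implicit Types (x y z l s : R) (k m : nat).

(** Hermite polynomials in the scaling that makes [gam k] below the [k]-th derivative of
    [exp (- z^2 / 4)]; the recursion is the product rule. *)
Fixpoint herm k : {poly R} :=
  if k is k'.+1 then (herm k')^`() - 2^-1 *: ('X * herm k') else 1.

(** The Appell property of Hermite polynomials. It eliminates the derivative from the recursion and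
    leaves the three-term relation [herm_rec]. *)
Lemma deriv_herm k : (herm k.+1)^`() = - (k.+1%:R / 2) *: herm k.
Proof.
elim: k => [|k ih].
  by rewrite /= mulr1 derivB derivZ derivX -polyC1 !derivC sub0r scaleNr mul1r alg_polyC.
have hk : (herm k)^`() = herm k.+1 + 2^-1 *: ('X * herm k) by rewrite /= subrK.
have -> : herm k.+2 = (herm k.+1)^`() - 2^-1 *: ('X * herm k.+1) by [].
rewrite derivB derivZ derivM derivX mul1r ih derivZ hk.
move: (herm k.+1) (herm k) => p q.
have -> : k.+2%:R / 2 = k.+1%:R / 2 + 2^-1 :> R by rewrite -natr1; field.
rewrite -!mul_polyC !raddfN /= !raddfD /=.
by ring.
Qed.

Lemma herm_rec k : herm k.+2 = - (k.+1%:R / 2) *: herm k - 2^-1 *: ('X * herm k.+1).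
Proof. by rewrite [LHS]/= -/(herm k.+1) deriv_herm. Qed.

Definition gam k z := (herm k).[z] * expR (- (z ^+ 2 / 4)).

(** The heat equation in self-similar variables: the right side is what a time derivative makes of
    the prefactor and of the argument [z / l]. *)
Lemma gam_rec k z : 2 * gam k.+2 z = - (k.+1%:R * gam k z) - z * gam k.+1 z.
Proof.
rewrite /gam herm_rec; move: (herm k.+1) => p; rewrite !(hornerD,hornerN,hornerZ,hornerM,hornerX); lra.
Qed.

Lemma is_derive_gam k z : is_derive z 1 (gam k) (gam k.+1 z).
Proof.
rewrite /gam.
have h1 : is_derive z 1 (fun z => - (z ^+ 2 / 4)) (- (z / 2)).
  have -> : (fun z : R => - (z ^+ 2 / 4)) = (fun z => (- 4^-1) *: (z ^+ 2)).
    by apply/funext => y /=; rewrite /GRing.scale/=; field.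
  by apply: is_derive_eq; rewrite /GRing.scale/=; field.
have h2 := @is_derive1_comp _ expR (fun z : R => - (z ^+ 2 / 4)) _ _ _ (is_derive_expR (- (z ^+ 2 / 4))) h1.
have h3 := is_derive_poly (herm k) z.
have := is_deriveM h3 h2.
move=> h; apply: (is_derive_eq h).
by rewrite /= !hornerE /GRing.scale/=; field.
Qed.

Lemma continuous_gam k : continuous (gam k).
Proof.
move=> z; apply: differentiable_continuous; apply/derivable1_diffP.
by have [] := is_derive_gam k z.
Qed.

Lemma normX_expR k z : `|z| ^+ k * expR (- (z ^+ 2 / 8)) <= (1 + 8 * k%:R) ^+ k.
Proof.
case: k => [|k].
  by rewrite !expr0 mul1r -[leRHS]expR0 ler_expR oppr_le0 divr_ge0// sqr_ge0.
rewrite expRN ler_pdivrMr ?expR_gt0//.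
have K0 : 0 < k.+1%:R :> R by rewrite ltr0n.
(* With [m = k.+1] and [z^2 / 8 = m a] the claim is the [m]-th power of [|z| <= (1 + 8 m) exp a],
   which follows from [|z| <= 1 + z^2] and [1 + a <= exp a]. *)
pose a := z ^+ 2 / 8 / k.+1%:R.
have aE : z ^+ 2 / 8 = k.+1%:R * a by rewrite /a; field; rewrite gt_eqF.
rewrite aE expRM_natl -exprMn.
have a0 : 0 <= a by rewrite !divr_ge0 ?sqr_ge0// ltW.
rewrite lerXn2r ?nnegrE//.
have h1 : 1 + a <= expR a by exact: expR_ge1Dx.
have h2 : `|z| <= 1 + z ^+ 2.
  have := sqr_ge0 (`|z| - 1); rewrite sqrrB1 real_normK ?num_real//.
  by have := normr_ge0 z; have := sqr_ge0 z; lra.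
nra.
Qed.

Lemma poly_expR_bound (p : {poly R}) : exists2 C, 0 < C &
  forall z, `|p.[z]| * expR (- (z ^+ 2 / 8)) <= C.
Proof.
exists (1 + \sum_(i < size p) `|p`_i| * (1 + 8 * i%:R) ^+ i).
  rewrite ltr_pwDl// sumr_ge0// => i _; rewrite mulr_ge0// exprn_ge0// addr_ge0// mulr_ge0//.
move=> z; rewrite horner_coef -[leLHS]add0r lerD//.
apply: (@le_trans _ _ ((\sum_(i < size p) `|p`_i * z ^+ i|) * expR (- (z ^+ 2 / 8)))).
  by rewrite ler_wpM2r ?expR_ge0// ler_norm_sum.
rewrite mulr_suml ler_sum// => i _.
by rewrite normrM normrX -mulrA ler_wpM2l// normX_expR.
Qed.

(** Half of the exponent absorbs the polynomial; the other half is the wider Gaussian that majorizes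
    all derivatives at once. *)
Lemma gam_bound k : exists2 C, 0 < C & forall z, `|gam k z| <= C * expR (- (z ^+ 2 / 8)).
Proof.
have [C C0 HC] := poly_expR_bound (herm k); exists C => // z.
rewrite /gam normrM (ger0_norm (expR_ge0 _)).
rewrite (_ : - (z ^+ 2 / 4) = - (z ^+ 2 / 8) + - (z ^+ 2 / 8)); last by field.
by rewrite expRD mulrA ler_wpM2r ?expR_ge0.
Qed.

(* the k-th derivative of z |-> l^-1 exp (- z^2 / (4 l^2)); l^2 is the time *)
Definition gk k l z := l^-1 ^+ k.+1 * gam k (z / l).

(* A wider Gaussian, for which |gk k l z| <= C l^-k gh l z. *)
Definition gh l z := l^-1 * expR (- ((z / l) ^+ 2 / 8)).

Lemma gh_ge0 l z : 0 < l -> 0 <= gh l z.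
Proof. by move=> l0; rewrite mulr_ge0 ?expR_ge0// invr_ge0 ltW. Qed.

Lemma gk_bound k : exists2 C, 0 < C &
  forall l z, 0 < l -> `|gk k l z| <= C * l^-1 ^+ k * gh l z.
Proof.
have [C C0 HC] := gam_bound k; exists C => // l z l0.
rewrite /gk /gh normrM ger0_norm; last by rewrite exprn_ge0// invr_ge0 ltW.
rewrite [X in _ <= X](_ : _ = l^-1 ^+ k.+1 * (C * expR (- ((z / l) ^+ 2 / 8)))); last by rewrite [_ ^+ k.+1]exprSr; ring.
by rewrite ler_wpM2l// exprn_ge0// invr_ge0 ltW.
Qed.

Lemma is_derive_gk k l x y : 0 < l ->
  is_derive y 1 (fun y => gk k l (y - x)) (gk k.+1 l (y - x)).
Proof.
move=> l0; rewrite /gk.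
have h : is_derive y 1 (fun y => (y - x) / l) (l^-1).
  have -> : (fun y => (y - x) / l) = (fun y => l^-1 *: (y - x)).
    by apply/funext => z; rewrite /GRing.scale/= mulrC.
  by apply: is_derive_eq; rewrite /GRing.scale/= subr0 mulr1.
have h2 := @is_derive1_comp _ (gam k) (fun y => (y - x) / l) _ _ _ (is_derive_gam k ((y - x) / l)) h.
have := @is_deriveZ _ _ _ _ (l^-1 ^+ k.+1) _ _ _ h2.
move=> h3; apply: (is_derive_eq h3).
by rewrite /GRing.scale/= [in RHS]exprSr; ring.
Qed.

(** With [l = sqrt s] this is the one-dimensional heat equation for the kernel and all its space
    derivatives; after the chain rule it reduces to [gam_rec]. *)
Lemma is_derive_gk_time k s z : 0 < s ->
  is_derive s 1 (fun s => gk k (Num.sqrt s) z) (gk k.+2 (Num.sqrt s) z).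
Proof.
move=> s0; rewrite /gk.
have l0 : 0 < Num.sqrt s by rewrite sqrtr_gt0.
set l := Num.sqrt s in l0 *.
have h0 : is_derive s 1 Num.sqrt (2 * l)^-1 by exact: is_derive1_sqrt.
have h1 : is_derive s 1 (fun s => (Num.sqrt s)^-1) (- l^-1 ^+ 2 * (2 * l)^-1).
  have := @is_deriveV _ Num.sqrt s _ 1 _ h0.
  move=> h; apply: (is_derive_eq (h _)); first by rewrite gt_eqF.
  by rewrite /GRing.scale/= -/l exprVn.
have h2 : is_derive s 1 (fun s => z / Num.sqrt s) (z * (- l^-1 ^+ 2 * (2 * l)^-1)).
  exact: (@is_deriveZ _ _ _ _ z _ _ _ h1).
have h3 := @is_derive1_comp _ (gam k) (fun s => z / Num.sqrt s) _ _ _ (is_derive_gam k (z / l)) h2.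
have h4 := @is_deriveX _ _ _ k.+1 _ _ _ h1; rewrite exprfctE in h4.
have h5 := is_deriveM h4 h3.
apply: (is_derive_eq h5).
rewrite /GRing.scale/= -/l.
have := gam_rec k (z / l).
set A := gam k.+2 _; set B := gam k.+1 _; set C := gam k _ => hr.
have -> : A = (- (k.+1%:R * C) - z / l * B) / 2 by rewrite -hr; field.
rewrite ![_ ^+ k.+3]exprS ![_ ^+ k.+2]exprS ![_ ^+ k.+1]exprS.
by field; rewrite gt_eqF.
Qed.

End gaussian.

(** * A polynomial cutoff of finite smoothness *)

Section cutoff.
Context {R : realType}.
Implicit Types (x y z l r A B C : R) (k m : nat).

Lemma horner_bound (p : {poly R}) y : `|y| <= 1 ->
  `|p.[y]| <= \sum_(i < size p) `|p`_i|.
Proof.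
move=> y1; rewrite horner_coef (le_trans (ler_norm_sum _ _ _))// ler_sum// => i _.
by rewrite normrM normrX ler_piMr// exprn_ile1.
Qed.

(** The exponent 7 leaves a factor [(1 - y^2)^2] in every derivative up to order five, so that
    [theta k] is differentiable across [|y| = 1] for [k <= 5]. Test functions of finite smoothness
    suffice against smooth solutions, and polynomials make all bounds explicit. *)
Definition cutp k : {poly R} := ((1 - 'X^2) ^+ 7)^`(k).

Lemma cutp_factor k : (k <= 7)%N -> exists q, cutp k = (1 - 'X^2) ^+ (7 - k) * q.
Proof.
elim: k => [|k ih] k7; first by exists 1; rewrite mulr1 /cutp derivn0.
have [q qE] := ih (ltnW k7); rewrite /cutp derivnS -/(cutp k) qE.
rewrite (_ : 7 - k = (7 - k.+1).+1)%N; last by lia.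
set m := (7 - k.+1)%N.
exists ((1 - 'X^2)^`() * q *+ m.+1 + (1 - 'X^2) * q^`()).
rewrite derivM deriv_exp -[m.+1.-1]/m; move: ((1 - 'X^2 : {poly R})^`()) (1 - 'X^2 : {poly R}) => d p.
by rewrite mulrDr mulrnAr mulrnAl exprSr; congr (_ *+ _ + _); ring.
Qed.

Definition theta k y : R := if `|y| < 1 then (cutp k).[y] else 0.

Lemma theta0_0 : theta 0 0 = 1.
Proof. by rewrite /theta normr0 ltr01 /cutp derivn0 horner_exp !hornerE expr0n/= subr0 expr1n. Qed.

Lemma theta_out k y : 1 <= `|y| -> theta k y = 0.
Proof. by rewrite /theta leNgt => /negbTE ->. Qed.

Lemma theta_bound : exists2 A, 0 < A & forall k y, (k <= 6)%N -> `|theta k y| <= A.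
Proof.
pose b k := \sum_(i < size (cutp k)) `|(cutp k)`_i|.
exists (1 + \sum_(k < 7) b k).
  by rewrite ltr_pwDl// sumr_ge0// => i _; rewrite sumr_ge0.
move=> k y k6; have bk0 j : 0 <= b j by rewrite sumr_ge0.
apply: (@le_trans _ _ (b k)).
  rewrite /theta; case: ifPn => [y1|_]; last by rewrite normr0.
  by apply: horner_bound; exact: ltW.
rewrite (bigD1 (Ordinal (k6 : (k < 7)%N)))//= addrCA lerDl addr_ge0// sumr_ge0//.
Qed.

Lemma is_derive_quadratic (f : R -> R) y C :
  (forall z, `|f z| <= C * (z - y) ^+ 2) -> is_derive y 1 f 0.
Proof.
move=> fC; apply/is_derive1_caratheodory.
have fy : f y = 0.
  by have := fC y; rewrite subrr expr0n/= mulr0 normr_le0 => /eqP.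
have gC z : `|f z / (z - y)| <= C * `|z - y|.
  have [->|zy] := eqVneq z y; first by rewrite subrr invr0 !mulr0 normr0 mulr0.
  rewrite normrM normfV ler_pdivrMr ?normr_gt0 ?subr_eq0//.
  by rewrite -mulrA -expr2 real_normK ?num_real// fC.
(* At [z = y] the quotient is 0, because the inverse of 0 is 0; this is the value that
   Caratheodory's criterion needs there. *)
exists (fun z => f z / (z - y)); split.
- move=> z; rewrite fy subr0; have [->|zy] := eqVneq z y; first by rewrite fy !mul0r.
  by rewrite mulfVK// subr_eq0.
- suff : f z / (z - y) @[z --> y] --> (0 : R).
    by rewrite /prop_for /continuous_at subrr invr0 mulr0.
  apply: norm_cvg0.
  apply: (@squeeze_cvgr _ _ _ _ (cst 0) (fun z => C * `|z - y|)).
  + by apply: nearW => z; rewrite normr_ge0 gC.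
  + exact: cvg_cst.
  + rewrite -[X in _ --> X](mulr0 C); apply: cvgM; first exact: cvg_cst.
    rewrite -[X in _ --> X](normr0 R) -[X in `|X|](subrr y).
    by apply: cvg_norm; apply: cvgB; [exact: cvg_id|exact: cvg_cst].
- by rewrite subrr invr0 mulr0.
Qed.

Lemma theta_boundary k y : (k <= 5)%N -> `|y| = 1 ->
  exists C, forall z, `|theta k z| <= C * (z - y) ^+ 2.
Proof.
move=> k5 y1; have [|q qE] := @cutp_factor k; first by lia.
pose p := (1 - 'X^2) ^+ (5 - k) * q.
(* Since [y^2 = 1], the factor [(1 - z^2)^2] is [(z - y)^2 (z + y)^2]; 4 bounds the second square
   and the sum bounds the cofactor [p] on the unit interval. *)
exists (4 * \sum_(i < size p) `|p`_i|) => z; rewrite /theta.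
case: ifPn => [z1|_]; last first.
  by rewrite normr0; apply: mulr_ge0; [apply: mulr_ge0 => //; exact: sumr_ge0|exact: sqr_ge0].
have -> : cutp k = (1 - 'X^2) ^+ 2 * p.
  by rewrite /p mulrA -exprD qE; congr (_ ^+ _ * _); lia.
rewrite hornerM normrM mulrAC ler_pM//; last by apply: horner_bound; exact: ltW.
have oE : (1 - 'X^2 : {poly R}).[z] = 1 - z ^+ 2 by rewrite !hornerE.
rewrite horner_exp oE normrX real_normK ?num_real//.
have y2 : y ^+ 2 = 1 by rewrite -real_normK ?num_real// y1 expr1n.
have zy : (1 - z ^+ 2) ^+ 2 = (z - y) ^+ 2 * (z + y) ^+ 2 by rewrite -y2; ring.
rewrite zy [X in X <= _]mulrC ler_wpM2r ?sqr_ge0//.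
have : `|z + y| <= 2 by rewrite (le_trans (ler_normD _ _))// y1; lra.
move=> h; rewrite -real_normK ?num_real// (_ : 4 = 2 ^+ 2); last by rewrite expr2; lra.
by rewrite lerXn2r ?nnegrE.
Qed.

Lemma is_derive_theta k y : (k <= 5)%N -> is_derive y 1 (theta k) (theta k.+1 y).
Proof.
move=> k5; have [y1|y1|y1] := ltgtP `|y| 1.
- apply: (@near_eq_is_derive _ _ _ (horner (cutp k))).
    have : \forall z \near y, `|z| < 1.
      exact: (cvgr_lt _ (@norm_continuous _ R^o y) _ y1).
    by apply: filterS => z z1; rewrite /theta z1.
  rewrite /theta y1 /cutp derivnS; exact: is_derive_poly.
- rewrite (theta_out k.+1 (ltW y1)).
  apply: (@near_eq_is_derive _ _ _ (cst (0 : R))).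
  have : \forall z \near y, 1 < `|z|.
    exact: (cvgr_gt _ (@norm_continuous _ R^o y) _ y1).
  by apply: filterS => z z1; rewrite theta_out// ltW.
- rewrite {2}/theta y1 ltxx; have [C fC] := theta_boundary k5 y1.
  exact: is_derive_quadratic fC.
Qed.

Lemma continuous_theta k : (k <= 5)%N -> continuous (theta k).
Proof.
move=> k5 y; apply: differentiable_continuous; apply/derivable1_diffP.
by have [] := is_derive_theta y k5.
Qed.

End cutoff.

(** * The Leibniz rule for sequences of derivatives *)

Section leibniz.
Context {R : realType}.
Implicit Types (x y z l r s A B C : R) (k m : nat).

(** The [m]-th derivative of a product, where [a] and [b] list the successive derivatives of the
    factors. The [2 ^+ m] terms are left without binomial coefficients, so that inductions on [m]
    are direct. *)
Fixpoint leib m (a b : nat -> R) : R :=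
  if m is m'.+1 then leib m' (a \o succn) b + leib m' a (b \o succn)
  else a 0 * b 0.

Lemma is_derive_leib m (f g : nat -> R -> R) y :
  (forall k, (k <= m)%N -> is_derive y 1 (f k) (f k.+1 y)) ->
  (forall k, (k <= m)%N -> is_derive y 1 (g k) (g k.+1 y)) ->
  is_derive y 1 (fun y => leib m (f^~ y) (g^~ y)) (leib m.+1 (f^~ y) (g^~ y)).
Proof.
elim: m f g => [|m ih] f g df dg.
  apply: (is_derive_eq (is_deriveM (df 0 _) (dg 0 _)))%N => //.
  by rewrite /= /GRing.scale/=; ring.
apply: (is_derive_eq (is_deriveD (ih (f \o succn) g _ _) (ih f (g \o succn) _ _))) => //.
- by move=> k km; apply: df.
- by move=> k km; apply: dg; exact: leq_trans km _.
- by move=> k km; apply: df; exact: leq_trans km _.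
- by move=> k km; apply: dg.
Qed.

Lemma is_derive_leibr m (a : nat -> R) (g dg : nat -> R -> R) s :
  (forall k, (k <= m)%N -> is_derive s 1 (g k) (dg k s)) ->
  is_derive s 1 (fun s => leib m a (g^~ s)) (leib m a (dg^~ s)).
Proof.
elim: m a g dg => [|m ih] a g dg h.
  exact: (@is_deriveZ _ _ _ _ (a 0) _ _ _ (h 0 _))%N.
apply: (is_deriveD (ih (a \o succn) g dg _) (ih a (g \o succn) (dg \o succn) _)).
- by move=> k km; apply: h; exact: leq_trans km _.
- by move=> k km; apply: h.
Qed.

Lemma continuous_leib (T : topologicalType) m (f g : nat -> T -> R) t :
  (forall k, (k <= m)%N -> {for t, continuous (f k)}) ->
  (forall k, (k <= m)%N -> {for t, continuous (g k)}) ->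
  {for t, continuous (fun t => leib m (f^~ t) (g^~ t))}.
Proof.
elim: m f g => [|m ih] f g cf cg; first by apply: cvgM; [exact: cf|exact: cg].
apply: cvgD.
- by apply: (ih (f \o succn) g) => k km; [exact: cf|apply: cg; exact: leq_trans km _].
- by apply: (ih f (g \o succn)) => k km; [apply: cf; exact: leq_trans km _|exact: cg].
Qed.

(** The factor [2 ^+ m] counts the terms; each of them carries [m] derivatives in all, hence
    [q ^+ m]. *)
Lemma leib_bound m (a b : nat -> R) A B q : 0 <= A -> 0 <= B -> 0 <= q ->
  (forall k, (k <= m)%N -> `|a k| <= A * q ^+ k) ->
  (forall k, (k <= m)%N -> `|b k| <= B * q ^+ k) ->
  `|leib m a b| <= 2 ^+ m * (A * B) * q ^+ m.
Proof.
move=> + + q0; elim: m a b A B => [|m ih] a b A B A0 B0 ha hb.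
  rewrite /= !expr0 mul1r mulr1 normrM.
  by have := ha 0 isT; have := hb 0 isT; rewrite !expr0 !mulr1 => h1 h2; exact: ler_pM.
rewrite /= (le_trans (ler_normD _ _))//.
have h1 : `|leib m (a \o succn) b| <= 2 ^+ m * ((A * q) * B) * q ^+ m.
  apply: ih => //; first exact: mulr_ge0.
    by move=> k km; rewrite -mulrA -exprS; exact: ha.
  by move=> k km; apply: hb; exact: leq_trans km _.
have h2 : `|leib m a (b \o succn)| <= 2 ^+ m * (A * (B * q)) * q ^+ m.
  apply: ih => //; first exact: mulr_ge0.
    by move=> k km; apply: ha; exact: leq_trans km _.
  by move=> k km; rewrite -mulrA -exprS; exact: hb.
apply: (le_trans (lerD h1 h2)); rewrite !exprS le_eqVlt; apply/orP; left; apply/eqP; ring.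
Qed.

Lemma leib_eq0 m (a b : nat -> R) : (forall k, (k <= m)%N -> a k = 0) -> leib m a b = 0.
Proof.
elim: m a b => [|m ih] a b a0 /=; first by rewrite a0// mul0r.
rewrite (ih (a \o succn))//; last by move=> k km; exact: a0.
by rewrite ih ?addr0// => k km; apply: a0; exact: leq_trans km _.
Qed.

End leibniz.

(** * Cut-off Gaussians on the line *)

Section cut_gaussian.
Context {R : realType}.
Implicit Types (x y z l r A B C s : R) (k m : nat).

Definition cutk r y k : R := r^-1 ^+ k * theta k (y / r).

Lemma is_derive_cutk r y k : (k <= 5)%N ->
  is_derive y 1 (fun y => cutk r y k) (cutk r y k.+1).
Proof.
move=> k5.
have h : is_derive y 1 (fun y => y / r) (r^-1).
  have -> : (fun y => y / r) = (fun y => r^-1 *: y).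
    by apply/funext => z; rewrite /GRing.scale/= mulrC.
  by apply: is_derive_eq; rewrite /GRing.scale/= mulr1.
have h2 := @is_derive1_comp _ (theta k) (fun y => y / r) _ _ _ (is_derive_theta (y / r) k5) h.
apply: (is_derive_eq (@is_deriveZ _ _ _ _ (r^-1 ^+ k) _ _ _ h2)).
by rewrite /cutk /GRing.scale/= exprSr; ring.
Qed.

(* The m-th space derivative of theta(y/r) times the Gaussian of time l^2 centred at x. *)
Definition dgauss r l x m y : R := leib m (cutk r y) (fun k => gk k l (y - x)).

(** The derivative in the time [l^2] falls on the Gaussian alone, where it equals two space
    derivatives; hence the shift [k.+2]. Comparison with [dgauss] of order [m.+2] isolates the terms
    that differentiate the cutoff. *)
Definition dgauss_t r l x m y : R := leib m (cutk r y) (fun k => gk k.+2 l (y - x)).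

Lemma is_derive_dgauss r l x m y : 0 < l -> (m <= 5)%N ->
  is_derive y 1 (dgauss r l x m) (dgauss r l x m.+1 y).
Proof.
move=> l0 m5.
apply: (@is_derive_leib _ m (fun k y => cutk r y k) (fun k y => gk k l (y - x))) => k km.
- by apply: is_derive_cutk; exact: leq_trans km _.
- exact: is_derive_gk.
Qed.

Lemma is_derive_dgauss_time r s x m y : 0 < s ->
  is_derive s 1 (fun s => dgauss r (Num.sqrt s) x m y) (dgauss_t r (Num.sqrt s) x m y).
Proof.
move=> s0; apply: (@is_derive_leibr _ m _ (fun k s => gk k (Num.sqrt s) (y - x))
  (fun k s => gk k.+2 (Num.sqrt s) (y - x))) => k km.
exact: is_derive_gk_time.
Qed.

Lemma continuous_gk (T : topologicalType) k (s h : T -> R) t : 0 < s t ->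
  {for t, continuous s} -> {for t, continuous h} ->
  {for t, continuous (fun t => gk k (Num.sqrt (s t)) (h t))}.
Proof.
move=> s0 cs ch; rewrite /gk.
have cl : {for t, continuous (fun t => (Num.sqrt (s t))^-1)}.
  apply: cvgV; first by rewrite gt_eqF// sqrtr_gt0.
  by apply: (continuous_comp cs); exact: sqrt_continuous.
apply: cvgM.
  by apply: (@continuous_comp _ _ _ (fun t => (Num.sqrt (s t))^-1) (fun l => l ^+ k.+1)) => //; exact: exprn_continuous.
apply: (@continuous_comp _ _ _ (fun t => h t / Num.sqrt (s t)) (gam k)); last exact: continuous_gam.
exact: cvgM.
Qed.

Lemma continuous_cutk (T : topologicalType) r k (h : T -> R) t : (k <= 5)%N ->
  {for t, continuous h} -> {for t, continuous (fun t => cutk r (h t) k)}.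
Proof.
move=> k5 ch; apply: cvgM; first exact: cvg_cst.
apply: (@continuous_comp _ _ _ (fun t => h t / r) (theta k)); last exact: continuous_theta.
by apply: cvgM => //; exact: cvg_cst.
Qed.

Lemma continuous_dgauss (T : topologicalType) r x m (s h : T -> R) t : (m <= 5)%N ->
  0 < s t -> {for t, continuous s} -> {for t, continuous h} ->
  {for t, continuous (fun t => dgauss r (Num.sqrt (s t)) x m (h t))}.
Proof.
move=> m5 s0 cs ch.
apply: (@continuous_leib _ _ m (fun k t => cutk r (h t) k) (fun k t => gk k (Num.sqrt (s t)) (h t - x))) => k km.
- by apply: continuous_cutk => //; exact: leq_trans km _.
- by apply: continuous_gk => //; apply: cvgB => //; exact: cvg_cst.
Qed.

Lemma continuous_dgauss_t (T : topologicalType) r x m (s h : T -> R) t : (m <= 5)%N ->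
  0 < s t -> {for t, continuous s} -> {for t, continuous h} ->
  {for t, continuous (fun t => dgauss_t r (Num.sqrt (s t)) x m (h t))}.
Proof.
move=> m5 s0 cs ch.
apply: (@continuous_leib _ _ m (fun k t => cutk r (h t) k) (fun k t => gk k.+2 (Num.sqrt (s t)) (h t - x))) => k km.
- by apply: continuous_cutk => //; exact: leq_trans km _.
- by apply: continuous_gk => //; apply: cvgB => //; exact: cvg_cst.
Qed.

Lemma dgauss_out r l x m y : 0 < r -> r <= `|y| -> dgauss r l x m y = 0.
Proof.
move=> r0 ry; apply: leib_eq0 => k _; rewrite /cutk theta_out ?mulr0//.
by rewrite normrM normfV (gtr0_norm r0) ler_pdivlMr// mul1r.
Qed.

Lemma dgauss_t_out r l x m y : 0 < r -> r <= `|y| -> dgauss_t r l x m y = 0.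
Proof.
move=> r0 ry; apply: leib_eq0 => k _; rewrite /cutk theta_out ?mulr0//.
by rewrite normrM normfV (gtr0_norm r0) ler_pdivlMr// mul1r.
Qed.

Lemma gk_bound_le N : exists2 C, 0 < C &
  forall k l z, (k <= N)%N -> 0 < l -> `|gk k l z| <= C * l^-1 ^+ k * gh l z.
Proof.
elim: N => [|N [C C0 HC]].
  have [C C0 HC] := @gk_bound R 0; exists C => // k l z; rewrite leqn0 => /eqP ->; exact: HC.
have [C' C'0 HC'] := @gk_bound R N.+1; exists (C + C'); first exact: addr_gt0.
move=> k l z; rewrite leq_eqVlt ltnS => /orP[/eqP ->|kN] l0.
  rewrite (le_trans (HC' l z l0))// -!mulrA ler_wpM2r ?lerDr ?ltW// mulr_gt0//.
  by rewrite exprn_gt0 ?invr_gt0.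
  by rewrite mulr_gt0 ?expR_gt0 ?invr_gt0.
rewrite (le_trans (HC k l z kN l0))// -!mulrA ler_wpM2r ?lerDl ?ltW// mulr_gt0//.
by rewrite exprn_gt0 ?invr_gt0.
by rewrite mulr_gt0 ?expR_gt0 ?invr_gt0.
Qed.

(** As [l <= r], a derivative of the cutoff costs no more than one of the Gaussian. The third bound
    rests on [(a b)'' - a b'' = a'' b + 2 a' b']: at least one derivative hits the cutoff, which
    keeps a factor [r^-1]. *)
Lemma dgauss_bound : exists2 C, 0 < C &
  forall m r l x y, (m <= 4)%N -> 0 < l <= r ->
    `|dgauss r l x m y| <= C * l^-1 ^+ m * gh l (y - x) /\
    `|dgauss_t r l x m y| <= C * l^-1 ^+ m.+2 * gh l (y - x) /\
    `|dgauss r l x m.+2 y - dgauss_t r l x m y| <= C * (r^-1 * l^-1 ^+ m.+1) * gh l (y - x).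
Proof.
have [A A0 HA] := @theta_bound R.
have [B B0 HB] := gk_bound_le 6.
have [T T0 HT] : exists2 T : R, 0 < T & forall m, (m <= 4)%N -> 2 ^+ m <= T.
  exists (2 ^+ 4); first by rewrite exprn_gt0.
  by move=> m m4; rewrite ler_weXn2l// ler1n.
(* [T] bounds the number of Leibniz terms, and 3 is the total weight [1 + 2] of the two sums in the
   third bound. *)
exists (T * 3 * (A * B)); first by rewrite !mulr_gt0.
move=> m r l x y m4 /andP[l0 lr].
have r0 : 0 < r := lt_le_trans l0 lr.
have rl : r^-1 <= l^-1 by rewrite lef_pV2 ?posrE.
have gh0 := gh_ge0 (y - x) l0.
have [A0' B0'] := (ltW A0, ltW B0).
have Bg0 : 0 <= B * gh l (y - x) by rewrite mulr_ge0.
have m2 := HT m m4.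
have T0' := ltW T0.
have [g gE] : exists g, g = gh l (y - x) by exists (gh l (y - x)).
rewrite -gE in gh0 Bg0.
have li0 : 0 <= l^-1 by rewrite invr_ge0 ltW.
have ri0 : 0 <= r^-1 by rewrite invr_ge0 ltW.
have HB' k : (k <= 6)%N -> `|gk k l (y - x)| <= B * g * l^-1 ^+ k.
  by move=> k6; rewrite mulrAC gE; exact: HB.
have HA' k : (k <= 6)%N -> `|cutk r y k| <= A * r^-1 ^+ k.
  move=> k6; rewrite /cutk normrM ger0_norm ?exprn_ge0// mulrC ler_wpM2r ?exprn_ge0//.
  exact: HA.
have rlk k : r^-1 ^+ k <= l^-1 ^+ k by rewrite lerXn2r ?nnegrE.
have P2 (Z : R) : 0 <= Z -> 2 ^+ m * Z <= T * Z by move=> Z0; rewrite ler_wpM2r.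
rewrite -gE; split; last split.
- apply: (@le_trans _ _ (2 ^+ m * (A * (B * g)) * l^-1 ^+ m)).
    apply: leib_bound => //; do ?[exact: mulr_ge0|apply: mulr_ge0 => //; exact: mulr_ge0].
      move=> k km; rewrite (le_trans (HA' k _))//; first by apply: leq_trans km _; apply: leq_trans m4 _.
      by rewrite ler_wpM2l// ltW.
    by move=> k km; apply: HB'; apply: leq_trans km _; apply: leq_trans m4 _.
  have Z0 : 0 <= A * (B * g) * l^-1 ^+ m by rewrite !mulr_ge0 ?exprn_ge0.
  rewrite -mulrA; apply: (le_trans (P2 _ Z0)).
  rewrite [X in _ <= X](_ : _ = T * (3 * (A * (B * g) * l^-1 ^+ m))); last by ring.
  by rewrite ler_wpM2l// ler_peMl ?ler1n.
- apply: (@le_trans _ _ (2 ^+ m * (A * (B * g * l^-1 ^+ 2)) * l^-1 ^+ m)).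
    apply: leib_bound => //; do ?[by rewrite mulr_ge0 ?exprn_ge0].
      move=> k km; rewrite (le_trans (HA' k _))//; first by apply: leq_trans km _; apply: leq_trans m4 _.
      by rewrite ler_wpM2l// ltW.
    move=> k km.
    have -> : B * g * l^-1 ^+ 2 * l^-1 ^+ k = B * g * l^-1 ^+ k.+2 by rewrite -mulrA -exprD.
    apply: HB'.
    by rewrite !ltnS; exact: leq_trans km _.
  have Z0 : 0 <= A * (B * g * l^-1 ^+ 2) * l^-1 ^+ m by rewrite !mulr_ge0 ?exprn_ge0.
  rewrite -mulrA; apply: (le_trans (P2 _ Z0)).
  rewrite [X in _ <= X](_ : _ = T * (3 * (A * (B * g * l^-1 ^+ 2) * l^-1 ^+ m))); last first.
    by rewrite -[m.+2]addn2 exprD; ring.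
  by rewrite ler_wpM2l// ler_peMl ?ler1n.
- set a := cutk r y; set b := fun k => gk k l (y - x).
  have -> : dgauss r l x m.+2 y - dgauss_t r l x m y =
      leib m (a \o succn \o succn) b + 2 * leib m (a \o succn) (b \o succn).
    by rewrite /dgauss /dgauss_t /= -/a -/b; ring.
  have h1 : `|leib m (a \o succn \o succn) b| <= 2 ^+ m * ((A * (r^-1 * l^-1)) * (B * g)) * l^-1 ^+ m.
    apply: leib_bound => //; do ?[exact: mulr_ge0|apply: mulr_ge0 => //; exact: mulr_ge0].
      move=> k km; rewrite (le_trans (HA' k.+2 _))//; first by rewrite !ltnS; exact: leq_trans km _.
      rewrite -mulrA ler_wpM2l ?(ltW A0)// exprS -mulrA ler_wpM2l// -exprS//.
    by move=> k km; apply: HB'; apply: leq_trans km _; apply: leq_trans m4 _.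
  have h2 : `|leib m (a \o succn) (b \o succn)| <= 2 ^+ m * ((A * r^-1) * (B * g * l^-1)) * l^-1 ^+ m.
    apply: leib_bound => //; do ?[exact: mulr_ge0|apply: mulr_ge0 => //; exact: mulr_ge0].
      move=> k km; rewrite (le_trans (HA' k.+1 _))//; first by rewrite !ltnS; apply: leq_trans km _; apply: leq_trans m4 _.
      rewrite -mulrA ler_wpM2l ?(ltW A0)// exprS ler_wpM2l//.
    move=> k km.
    have -> : B * g * l^-1 * l^-1 ^+ k = B * g * l^-1 ^+ k.+1 by rewrite -mulrA -exprS.
    apply: HB'.
    by rewrite !ltnS; apply: leq_trans km _; apply: leq_trans m4 _.
  rewrite (le_trans (ler_normD _ _))// normrM (ger0_norm (ler0n _ 2)).
  apply: (le_trans (lerD h1 (ler_wpM2l (ler0n R 2) h2))).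
  set Z := A * B * (r^-1 * l^-1 ^+ m.+1 * g).
  have Z0 : 0 <= Z by rewrite !mulr_ge0 ?exprn_ge0.
  rewrite [X in X <= _](_ : _ = 2 ^+ m * (3 * Z)); last by rewrite /Z exprS; ring.
  rewrite [X in _ <= X](_ : _ = T * (3 * Z)); last by rewrite /Z; ring.
  by apply: P2; rewrite mulr_ge0.
Qed.

End cut_gaussian.

(** * Weighted integrals *)

Section power_integrals.
Context {R : realType}.
Local Notation leb := (@lebesgue_measure R).
Implicit Types (x y z l r a b C rho : R).

(** Up to the constant, [gh l] centred at [x] is the normal density with mean [x] and standard
    deviation [2 l]. *)
Lemma integral_gh l x : 0 < l ->
  (\int[leb]_y (gh l (y - x))%:E = (Num.sqrt (8 * pi))%:E)%E.
Proof.
move=> l0; have s0 : 2 * l != 0 by rewrite gt_eqF// mulr_gt0.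
have p0 : 0 < 8 * pi :> R by rewrite mulr_gt0// pi_gt0.
have E y : gh l (y - x) = Num.sqrt (8 * pi) * normal_pdf x (2 * l) y.
  rewrite normal_pdfE// /normal_peak /normal_fun /gh mulrA; congr (_ * expR _).
    rewrite (_ : (2 * l) ^+ 2 * pi *+ 2 = l ^+ 2 * (8 * pi)); last first.
      by rewrite mulr2n; ring.
    rewrite (sqrtrM (8 * pi) (sqr_ge0 l)) sqrtr_sqr gtr0_norm// invfM mulrCA divff ?mulr1//.
    by rewrite gt_eqF// sqrtr_gt0.
  rewrite (_ : (2 * l) ^+ 2 *+ 2 = 8 * l ^+ 2); last by rewrite mulr2n; ring.
  by field; rewrite gt_eqF.
under eq_integral do rewrite E EFinM.
rewrite ge0_integralZl//.
- by rewrite integral_normal_pdf mule1.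
- by apply/measurable_EFinP; exact: measurable_normal_pdf.
- by move=> y _; rewrite lee_fin normal_pdf_ge0.
Qed.

Lemma gk0_gh l z : 0 < l -> gk 0 l z = (Num.sqrt 2)^-1 * gh (l / Num.sqrt 2) z.
Proof.
move=> l0; have s2 : 0 < Num.sqrt 2 :> R by rewrite sqrtr_gt0.
rewrite /gk /gh /gam /= hornerC mul1r expr1 mulrA; congr (_ * expR _).
  by field; rewrite !gt_eqF.
rewrite invf_div mulrA !expr_div_n exprMn sqr_sqrtr//.
by field; rewrite gt_eqF.
Qed.

Lemma integral_gk0 l x : 0 < l ->
  (\int[leb]_y (gk 0 l (y - x))%:E = ((Num.sqrt 2)^-1 * Num.sqrt (8 * pi))%:E)%E.
Proof.
move=> l0; have s2 : 0 < Num.sqrt 2 :> R by rewrite sqrtr_gt0.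
under eq_integral do rewrite gk0_gh// EFinM.
rewrite ge0_integralZl//.
- by rewrite integral_gh ?divr_gt0.
- apply/measurable_EFinP; apply: continuous_measurable_fun => y.
  apply: cvgM; first exact: cvg_cst.
  apply: (@continuous_comp _ _ _ (fun y => - (((y - x) / (l / Num.sqrt 2)) ^+ 2 / 8)) expR); last exact: continuous_expR.
  apply: cvgN; apply: cvgM; last exact: cvg_cst.
  apply: (@continuous_comp _ _ _ (fun y => (y - x) / (l / Num.sqrt 2)) (fun z => z ^+ 2)); last exact: exprn_continuous.
  apply: cvgM; last exact: cvg_cst.
  by apply: cvgB; [exact: cvg_id|exact: cvg_cst].
- by move=> y _; rewrite lee_fin gh_ge0// divr_gt0.
Qed.

Lemma integral_powR_le b r : 0 < b -> 0 < r ->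
  (\int[leb]_(y in `]0%R, r]) (y `^ (b - 1))%:E <= (b^-1 * r `^ b)%:E)%E.
Proof.
move=> b0 r0.
(* The integrand may be singular at 0, so the fundamental theorem is applied on these intervals and
   the limit is taken by monotone convergence. The [n.+2] keeps every interval nondegenerate. *)
pose F (n : nat) : set R := `[r / n.+2%:R, r]%classic.
have eps0 n : 0 < r / n.+2%:R by rewrite divr_gt0.
have FU : \bigcup_n F n = `]0%R, r]%classic.
  apply/seteqP; split => [y [n _]|y]; rewrite /F /= !in_itv/=.
    by move=> /andP[h ->]; rewrite (lt_le_trans (eps0 n)).
  move=> /andP[y0 yr]; have [n _ /(_ n (leqnn _)) /= h] :=
      near_infty_natSinv_lt (PosNum (divr_gt0 y0 r0)).
  exists n => //; rewrite /= in_itv/= yr andbT ler_pdivrMr//.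
  move: h; rewrite ltr_pdivlMr// mulrC ltr_pdivrMr// => h.
  by rewrite (le_trans (ltW h))// ler_pM2l// ler_nat.
have Fle n : (\int[leb]_(y in F n) (y `^ (b - 1))%:E <= (b^-1 * r `^ b)%:E)%E.
  have er : r / n.+2%:R < r by rewrite ltr_pdivrMr// ltr_pMr// ltr1n.
  have dF y : 0 < y -> is_derive y 1 (fun y => b^-1 * y `^ b) (y `^ (b - 1)).
    move=> y0; have h := @is_derive1_powR _ b y y0.
    apply: (is_derive_eq (@is_deriveZ _ _ _ _ b^-1 _ _ _ h)).
    by rewrite /GRing.scale/= mulKf// gt_eqF.
  have cF y : 0 < y -> {for y, continuous (fun y => b^-1 * y `^ b)}.
    move=> y0; apply: differentiable_continuous; apply/derivable1_diffP.
    by have [] := dF y y0.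
  have cpow y : 0 < y -> {for y, continuous (fun y => y `^ (b - 1))}.
    move=> y0; apply: differentiable_continuous; apply/derivable1_diffP.
    by have [] := @is_derive1_powR _ (b - 1) y y0.
  rewrite /F (@continuous_FTC2 _ (fun y => y `^ (b - 1)) (fun y => b^-1 * y `^ b))//.
  - by rewrite -EFinB lee_fin gerBl mulr_ge0 ?invr_ge0 ?powR_ge0 ?ltW.
  - apply: continuous_in_subspaceT => y; rewrite inE/= in_itv/= => /andP[h _].
    by apply: cpow; exact: lt_le_trans h.
  - split.
    + by move=> y; rewrite in_itv/= => /andP[h _]; have [] := dF y (lt_trans (eps0 n) h).
    + by apply: cvg_at_right_filter; exact: cF.
    + by apply: cvg_at_left_filter; exact: cF.
  - move=> y; rewrite in_itv/= => /andP[h _]; rewrite derive1E.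
    by have [_ ->] := dF y (lt_trans (eps0 n) h).
have mpow : measurable_fun setT (fun y : R => (y `^ (b - 1))%:E).
  by apply/measurable_EFinP; exact: measurable_powR.
have Fcvg := @ge0_nondecreasing_set_cvg_integral _ (measurableTypeR R) _ F (fun y => (y `^ (b - 1))%:E) leb.
rewrite -FU.
have nF : nondecreasing_seq F.
  move=> m n mn; apply/subsetPset => y; rewrite /F /= !in_itv/= => /andP[h ->].
  rewrite andbT (le_trans _ h)// ler_pM2l// lef_pV2 ?posrE//.
  by rewrite ler_nat !ltnS.
have mF i : measurable (F i : set (measurableTypeR R)) by exact: measurable_itv.
have mfF i : measurable_fun (F i : set (measurableTypeR R)) (fun y => (y `^ (b - 1))%:E).
  exact: measurable_funTS.
have f0 i y : F i y -> (0 <= (y `^ (b - 1))%:E)%E by rewrite lee_fin powR_ge0.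
apply: (cvge_to_le (Fcvg nF mF mfF f0)).
by apply: nearW => n; exact: Fle.
Qed.

(* |y|^(-a); the junk value at y = 0 is 0 *)
Definition pw a y : R := `|y| `^ (- a).

Lemma pw_ge0 a y : 0 <= pw a y. Proof. exact: powR_ge0. Qed.

Lemma measurable_pw a : measurable_fun setT (pw a).
Proof.
apply: (measurableT_comp (measurable_powR (- a))).
exact: normr_measurable.
Qed.

Lemma integral_pw_le a r : 0 < a < 1 -> 0 < r ->
  (\int[leb]_y (\1_(`](- r)%R, r[%classic : set R) y * pw a y)%:E <= (2 / (1 - a) * r `^ (1 - a))%:E)%E.
Proof.
move=> /andP[a0 a1] r0.
pose f (y : R) := (y `^ (- a) * \1_(`]0%R, r]%classic : set R) y).
have mf : measurable_fun setT f.
  by apply: measurable_funM; [exact: measurable_powR|exact: measurable_indic].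
have f0 y : 0 <= f y by rewrite mulr_ge0 ?powR_ge0.
have If : (\int[leb]_y (f y)%:E <= ((1 - a)^-1 * r `^ (1 - a))%:E)%E.
  rewrite (_ : \int[leb]_y (f y)%:E = \int[leb]_(y in `]0%R, r]) (y `^ ((1 - a) - 1))%:E)%E.
    by apply: integral_powR_le => //; rewrite subr_gt0.
  rewrite [RHS]integral_mkcond; apply: eq_integral => y _.
  rewrite /f /patch indicE; case: (boolP (y \in _)) => _; last by rewrite mulr0.
  by rewrite mulr1; congr (_ `^ _)%:E; ring.
have IfN : (\int[leb]_y (f (- y)%R)%:E = \int[leb]_y (f y)%:E)%E.
  have mN : measurable_fun [set: measurableTypeR R] (-%R : measurableTypeR R -> measurableTypeR R).
    exact: measurable_funN.
  have mF : measurable_fun setT (fun y : measurableTypeR R => (f y)%:E) by exact/measurable_EFinP.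
  have := @ge0_integral_pushforward _ _ _ _ _ _ mN leb setT (fun y => (f y)%:E) measurableT mF (fun y _ => f0 y).
  rewrite preimage_setT => <-.
  by apply: eq_measure_integral => A mA _; exact: lebesgue_measureN.
have mfN : measurable_fun setT (fun y => f (- y)).
  by apply: measurableT_comp => //; exact: measurable_funN.
apply: (@le_trans _ _ (\int[leb]_y ((f y)%:E + (f (- y)%R)%:E))%E).
  apply: ge0_le_integral => //.
  - by move=> y _; rewrite lee_fin mulr_ge0// pw_ge0.
  - apply/measurable_EFinP; apply: measurable_funM; last exact: measurable_pw.
    exact: measurable_indic.
  - by apply: emeasurable_funD; exact/measurable_EFinP.
  move=> y _; rewrite -EFinD lee_fin /pw !indicE; case: (boolP (y \in _)) => [|_]; last first.
    by rewrite mul0r addr_ge0.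
  rewrite inE/= in_itv/= mul1r => /andP[ry yr].
  have [y0|y0|->] := ltgtP y 0.
  - rewrite ltr0_norm// -[leLHS]add0r lerD// /f indicE mem_set ?mulr1//=.
    by rewrite in_itv/= oppr_gt0 y0/= lerNl ltW.
  - rewrite gtr0_norm// -[leLHS]addr0 lerD// /f indicE mem_set ?mulr1//=.
    by rewrite in_itv/= y0/= ltW.
  - by rewrite normr0 powR0 ?oppr_eq0 ?gt_eqF// addr_ge0.
rewrite ge0_integralD//.
- rewrite IfN (le_trans (leeD If If))// -EFinD lee_fin le_eqVlt; apply/orP; left; apply/eqP; ring.
- by move=> y _; rewrite lee_fin.
- exact/measurable_EFinP.
- by move=> y _; rewrite lee_fin.
- exact/measurable_EFinP.
Qed.

Lemma continuous_gh l x : continuous (fun y => gh l (y - x)).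
Proof.
move=> y.
apply: cvgM; first exact: cvg_cst.
apply: (@continuous_comp _ _ _ (fun y => - (((y - x) / l) ^+ 2 / 8)) expR); last exact: continuous_expR.
apply: cvgN; apply: cvgM; last exact: cvg_cst.
apply: (@continuous_comp _ _ _ (fun y => (y - x) / l) (fun z => z ^+ 2)); last exact: exprn_continuous.
apply: cvgM; last exact: cvg_cst.
by apply: cvgB; [exact: cvg_id|exact: cvg_cst].
Qed.

Lemma gh_norm_le l z : 0 < l -> gh l z * `|z| <= 9.
Proof.
move=> l0; have := normX_expR 1 (z / l); rewrite expr1 normrM normfV (gtr0_norm l0) mulr1 expr1.
rewrite /gh (_ : 1 + 8 = 9 :> R); last by lra.
by rewrite (_ : l^-1 * _ * _ = `|z| / l * expR (- ((z / l) ^+ 2 / 8))) //; ring.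
Qed.

Lemma gh_le l z : 0 < l -> gh l z <= l^-1.
Proof.
move=> l0; rewrite /gh -[X in _ <= X]mulr1 ler_wpM2l ?invr_ge0 ?(ltW l0)// -[X in _ <= X]expR0 ler_expR oppr_le0.
by rewrite divr_ge0// sqr_ge0.
Qed.

(** Outside [|y| < rho] the weight is at most [rho^(-a)] and the Gaussian is integrated; inside, the
    Gaussian is at most [S] and the weight is integrated. *)
Lemma integral_gh_pw_split a l x rho S : 0 < a < 1 -> 0 < l -> 0 < rho -> 0 <= S ->
  (forall y, `|y| < rho -> gh l (y - x) <= S) ->
  (\int[leb]_y (gh l (y - x) * pw a y)%:E <=
    (rho `^ (- a) * Num.sqrt (8 * pi) + S * (2 / (1 - a) * rho `^ (1 - a)))%:E)%E.
Proof.
move=> a01 l0 r0 S0 hS.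
have mg : measurable_fun setT (fun y : R => gh l (y - x)).
  by apply: continuous_measurable_fun; exact: continuous_gh.
have m1 : measurable_fun setT (fun y : R => \1_(`](- rho)%R, rho[%classic : set R) y * pw a y).
  by apply: measurable_funM; [exact: measurable_indic|exact: measurable_pw].
have p0 y : 0 <= \1_(`](- rho)%R, rho[%classic : set R) y * pw a y by rewrite mulr_ge0// pw_ge0.
rewrite EFinD !EFinM -(integral_gh x l0).
apply: (@le_trans _ _ (\int[leb]_y ((rho `^ (- a))%:E * (gh l (y - x))%:E +
   S%:E * (\1_(`](- rho)%R, rho[%classic : set R) y * pw a y)%:E))%E); last first.
  rewrite ge0_integralD//.
  - apply: leeD.
      by rewrite ge0_integralZl ?lee_fin ?powR_ge0//; [exact/measurable_EFinP|move=> y _; rewrite lee_fin gh_ge0].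
    rewrite ge0_integralZl ?lee_fin//; [|exact/measurable_EFinP|by move=> y _; rewrite lee_fin].
    by rewrite -EFinM lee_wpmul2l ?lee_fin//; exact: integral_pw_le.
  - by move=> y _; rewrite -EFinM lee_fin mulr_ge0 ?powR_ge0 ?gh_ge0.
  - apply/measurable_EFinP; apply: measurable_funM => //.
  - by move=> y _; rewrite -EFinM lee_fin mulr_ge0.
  - apply/measurable_EFinP; apply: measurable_funM => //.
apply: ge0_le_integral => //.
- by move=> y _; rewrite lee_fin mulr_ge0 ?gh_ge0 ?pw_ge0.
- by apply/measurable_EFinP; apply: measurable_funM => //; exact: measurable_pw.
- apply/measurable_EFinP; apply: measurable_funD; exact: measurable_funM.
move=> y _; rewrite -!EFinM -EFinD lee_fin indicE.
have [yr|yr] := ltP `|y| rho.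
  rewrite mem_set/= ?in_itv/= -?ltr_norml// mul1r -[leLHS]add0r lerD//.
    by rewrite mulr_ge0 ?powR_ge0 ?gh_ge0.
  by rewrite ler_wpM2r ?pw_ge0// hS.
rewrite memNset/= ?in_itv/=; last by rewrite -ltr_norml ltNge yr.
rewrite mul0r mulr0 addr0 mulrC ler_wpM2r ?gh_ge0// /pw !powRN.
have /andP[a0 _] := a01.
rewrite lef_pV2 ?posrE ?powR_gt0//; last exact: lt_le_trans yr.
by rewrite ge0_ler_powR ?nnegrE ?(ltW a0)// ltW.
Qed.

(** The first bound is the Muckenhoupt [A_1] property of [|y|^(-a)]: Gaussian averages of every
    width are controlled by the weight at the centre. The second makes them vanish at large widths.
    The integral is split at [|x| / 2] for the first and at [l] for the second. *)
Lemma integral_gh_pw a : 0 < a < 1 -> exists2 C, 0 < C & forall l x, 0 < l ->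
  (x != 0 -> (\int[leb]_y (gh l (y - x) * pw a y)%:E <= (C * pw a x)%:E)%E) /\
  (\int[leb]_y (gh l (y - x) * pw a y)%:E <= (C * l `^ (- a))%:E)%E.
Proof.
move=> a01; have /andP[a0 a1] := a01.
set K := Num.sqrt (8 * pi) : R; set A := 2 / (1 - a).
have K0 : 0 <= K by exact: sqrtr_ge0.
have A0 : 0 < A by rewrite divr_gt0// subr_gt0.
have pw1 z : 0 < z -> z `^ (1 - a) = z * z `^ (- a).
  move=> z0; rewrite powRD; first by rewrite powRr1// ltW.
  by rewrite (gt_eqF z0) implybT.
have half : 0 < 2^-1 `^ (- a) :> R by rewrite powR_gt0.
exists (K * 2^-1 `^ (- a) + 9 * A * 2^-1 `^ (- a) + (K + A)).
  have h1 : 0 <= K * 2^-1 `^ (- a) by rewrite mulr_ge0// ltW.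
  have h2 : 0 < 9 * A * 2^-1 `^ (- a) by exact: (mulr_gt0 (mulr_gt0 (ltr0n R 9) A0) half).
  by lra.
move=> l x l0; split => [x0|].
  have nx : 0 < `|x| by rewrite normr_gt0.
  have r0 : 0 < 2^-1 * `|x| by rewrite mulr_gt0.
  (* Where [|y| < |x| / 2], the distance from [y] to [x] exceeds [|x| / 2], and by [gh_norm_le] the
     Gaussian times this distance is at most 9. *)
  have S0 : 0 <= 9 / (2^-1 * `|x|) by rewrite divr_ge0 ?ltW.
  apply: (le_trans (integral_gh_pw_split a01 l0 r0 S0 _)).
    move=> y yr; have h := gh_norm_le (y - x) l0.
    rewrite ler_pdivlMr// (le_trans _ h)// ler_wpM2l ?gh_ge0//.
    have : `|x| <= `|y - x| + `|y|.
      by rewrite distrC -{1}(subrK y x) ler_normD.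
    by lra.
  rewrite lee_fin -/A -/K /pw.
  rewrite (pw1 _ r0).
  rewrite (_ : 9 / (2^-1 * `|x|) * _ = 9 * A * (2^-1 * `|x|) `^ (- a)); last first.
    by field; rewrite gt_eqF.
  rewrite powRM// ?invr_ge0//; have p0 := powR_ge0 `|x| (- a).
  rewrite [X in X <= _](_ : _ = (K * 2^-1 `^ (- a) + 9 * A * 2^-1 `^ (- a)) * `|x| `^ (- a)); last by ring.
  by rewrite ler_wpM2r// lerDl addr_ge0// ltW.
have S0 : 0 <= l^-1 by rewrite invr_ge0 ltW.
apply: (le_trans (integral_gh_pw_split a01 l0 l0 S0 _)).
  by move=> y _; exact: gh_le.
rewrite lee_fin -/A -/K.
rewrite (pw1 _ l0).
rewrite [X in X <= _](_ : _ = (K + A) * l `^ (- a)); last by field; rewrite gt_eqF.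
rewrite ler_wpM2r ?powR_ge0// lerDr.
by rewrite -mulrDl mulr_ge0 ?(ltW half)// addr_ge0// mulr_ge0// (ltW A0).
Qed.

End power_integrals.

(** * Test functions *)

Lemma is_derive_bigprod (R : realType) n (f : 'I_n -> R -> R) (df : 'I_n -> R) (t : R) :
  (forall i, is_derive t 1 (f i) (df i)) ->
  is_derive t 1 (fun t => \prod_i f i t) (\sum_i df i * \prod_(j | j != i) f j t).
Proof.
elim: n f df => [|n ih] f df h.
  rewrite big_ord0 (_ : (fun t => _) = cst (1 : R)); first exact: is_derive_cst.
  by apply/funext => s; rewrite big_ord0.
have {}ih := ih (fun i => f (lift ord0 i)) (fun i => df (lift ord0 i)) (fun i => h (lift ord0 i)).
have := is_deriveM (h ord0) ih.
rewrite (_ : f ord0 * _ = fun t => \prod_i f i t); last first.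
  by apply/funext => s; rewrite big_ord_recl.
move=> d; apply: (is_derive_eq d).
rewrite big_ord_recl /GRing.scale/= addrC; congr (_ + _).
  rewrite mulrC; congr (_ * _); rewrite [RHS]big_mkcond big_ord_recl /= mul1r.
  by apply: eq_bigr => i _.
rewrite mulr_sumr; apply: eq_bigr => i _.
rewrite mulrCA; congr (_ * _); rewrite [RHS]big_mkcond big_ord_recl /=.
by rewrite big_mkcond; congr (_ * _); apply: eq_bigr => j _.
Qed.

Section test_functions.
Context {R : realType} {n : nat}.
Local Notation Rn := 'rV[R]_n.
Local Notation mu := (@lebesgue_rV R n).
Local Notation e_ k := (delta_mx 0 k : Rn).
Implicit Types (r l c t : R) (x y : Rn) (s : seq 'I_n) (k i j : 'I_n).

(* The list s records the directions of differentiation. *)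
Definition psi r l x s y : R :=
  \prod_i dgauss r l (x 0 i) (count_mem i s) (y 0 i).

Definition psi_t r l x s y : R :=
  \sum_i dgauss_t r l (x 0 i) (count_mem i s) (y 0 i) *
    \prod_(j | j != i) dgauss r l (x 0 j) (count_mem j s) (y 0 j).

Definition majorant l x y : R := \prod_i gh l (y 0 i - x 0 i).

(** Only the multiplicities of the directions enter [psi], so the symmetry of mixed derivatives
    needs no calculus. *)
Lemma psi_perm r l x s s' : perm_eq s s' -> psi r l x s = psi r l x s'.
Proof.
move=> /permP ss'; apply/funext => y; rewrite /psi; apply: eq_bigr => i _.
by rewrite ss'.
Qed.

Lemma psi_cons r l x k s y : psi r l x (k :: s) y =
  dgauss r l (x 0 k) (count_mem k s).+1 (y 0 k) *
    \prod_(j | j != k) dgauss r l (x 0 j) (count_mem j s) (y 0 j).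
Proof.
rewrite /psi (bigD1 k)//= eqxx add1n; congr (_ * _).
by apply: eq_bigr => j /negbTE jk; rewrite eq_sym jk add0n.
Qed.

Lemma psi_cons2 r l x k s y : psi r l x (k :: k :: s) y =
  dgauss r l (x 0 k) (count_mem k s).+2 (y 0 k) *
    \prod_(j | j != k) dgauss r l (x 0 j) (count_mem j s) (y 0 j).
Proof.
rewrite psi_cons /= eqxx add1n; congr (_ * _).
by apply: eq_bigr => j /negbTE jk; rewrite eq_sym jk add0n.
Qed.

Lemma count_size s i m : (size s <= m)%N -> (count_mem i s <= m)%N.
Proof. exact/leq_trans/count_size. Qed.

Lemma is_partial_psi r l x s k y : 0 < l -> (size s <= 5)%N ->
  is_partial k (psi r l x s) y (psi r l x (k :: s) y).
Proof.
move=> l0 s5; rewrite /is_partial psi_cons.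
have -> : (fun h : R => psi r l x s (y + h *: e_ k)) =
    (fun h : R => (\prod_(j | j != k) dgauss r l (x 0 j) (count_mem j s) (y 0 j)) *:
      (dgauss r l (x 0 k) (count_mem k s) (y 0 k + h))).
  apply/funext => h; rewrite /psi (bigD1 k)//= mulrC /GRing.scale/=; congr (_ * _).
    by apply: eq_bigr => j /negbTE jk; rewrite !mxE eqxx/= jk mulr0 addr0.
  by rewrite !mxE !eqxx mulr1.
have d1 : is_derive (0 : R) (1 : R) (fun h => y 0 k + h) 1.
  have h := is_deriveD (is_derive_cst (y 0 k) (0 : R) (1 : R)) (is_derive_id (0 : R) (1 : R)).
  by apply: (is_derive_eq h); rewrite add0r.
have := @is_derive_dgauss _ r l (x 0 k) (count_mem k s) (y 0 k + 0) l0 (count_size k s5).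
move=> d2; have := @is_derive1_comp _ (dgauss r l (x 0 k) (count_mem k s)) (fun h => y 0 k + h) _ _ _ d2 d1.
move=> d3; apply: (is_derive_eq (@is_deriveZ _ _ _ _ _ _ _ _ d3)).
by rewrite /GRing.scale/= addr0 mulr1 mulrC.
Qed.

Lemma is_derive_psi_time r c x s y t : t < c ->
  is_derive t 1 (fun t => psi r (Num.sqrt (c - t)) x s y)
    (- psi_t r (Num.sqrt (c - t)) x s y).
Proof.
move=> tc; rewrite /psi /psi_t -sumrN.
under eq_bigr do rewrite -mulNr.
apply: (@is_derive_bigprod _ _ (fun i t => dgauss r (Num.sqrt (c - t)) (x 0 i) (count_mem i s) (y 0 i))) => i.
have d1 : is_derive t 1 (fun t => c - t) (-1).
  have h := is_deriveB (is_derive_cst c t (1 : R)) (is_derive_id t (1 : R)).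
  by apply: (is_derive_eq h); rewrite sub0r.
have ct : 0 < c - t by rewrite subr_gt0.
have d2 := @is_derive_dgauss_time _ r (c - t) (x 0 i) (count_mem i s) (y 0 i) ct.
have := @is_derive1_comp _ (fun u => dgauss r (Num.sqrt u) (x 0 i) (count_mem i s) (y 0 i)) (fun t => c - t) _ _ _ d2 d1.
by rewrite mulrN1.
Qed.

Lemma is_derive_psi_scale r x s y t : 0 < t ->
  is_derive t 1 (fun t => psi r (Num.sqrt t) x s y) (psi_t r (Num.sqrt t) x s y).
Proof.
move=> t0.
by apply: (@is_derive_bigprod _ _ (fun i t => dgauss r (Num.sqrt t) (x 0 i) (count_mem i s) (y 0 i))) => i; exact: is_derive_dgauss_time.
Qed.

Lemma continuous_prod (T : topologicalType) (I : Type) (q : seq I) (P : pred I) (f : I -> T -> R) (z : T) :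
  (forall u : I, {for z, continuous (f u)}) ->
  {for z, continuous (fun z => \prod_(u <- q | P u) f u z)}.
Proof.
move=> cf; elim: q => [|w q ih].
  rewrite (_ : (fun _ => _) = cst 1); first exact: cvg_cst.
  by apply/funext => u; rewrite big_nil.
rewrite (_ : (fun _ => _) = fun u => (if P w then f w u else 1) * \prod_(v <- q | P v) f v u).
  by apply: cvgM => //; case: (P w); [exact: cf|exact: cvg_cst].
by apply/funext => u; rewrite big_cons; case: ifP => //; rewrite mul1r.
Qed.

Lemma continuous_sum (T : topologicalType) (I : Type) (q : seq I) (P : pred I) (f : I -> T -> R) (z : T) :
  (forall u : I, {for z, continuous (f u)}) ->
  {for z, continuous (fun z => \sum_(u <- q | P u) f u z)}.
Proof.
move=> cf; elim: q => [|w q ih].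
  rewrite (_ : (fun _ => _) = cst 0); first exact: cvg_cst.
  by apply/funext => u; rewrite big_nil.
rewrite (_ : (fun _ => _) = fun u => (if P w then f w u else 0) + \sum_(v <- q | P v) f v u).
  by apply: cvgD => //; case: (P w); [exact: cf|exact: cvg_cst].
by apply/funext => u; rewrite big_cons; case: ifP => //; rewrite add0r.
Qed.

Lemma continuous_psi (T : topologicalType) r x s (sg : T -> R) (h : T -> Rn) z :
  (size s <= 5)%N -> 0 < sg z -> {for z, continuous sg} -> {for z, continuous h} ->
  {for z, continuous (fun z => psi r (Num.sqrt (sg z)) x s (h z))}.
Proof.
move=> s5 sg0 csg ch; apply: continuous_prod => i.
apply: (@continuous_dgauss _ _ _ _ _ sg (fun z => h z 0 i)) => //; first exact: count_size.
by apply: (@continuous_comp _ _ _ h (fun y : Rn => y 0 i) z ch); exact: continuous_coord.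
Qed.

Lemma continuous_psi_t (T : topologicalType) r x s (sg : T -> R) (h : T -> Rn) z :
  (size s <= 5)%N -> 0 < sg z -> {for z, continuous sg} -> {for z, continuous h} ->
  {for z, continuous (fun z => psi_t r (Num.sqrt (sg z)) x s (h z))}.
Proof.
move=> s5 sg0 csg ch; apply: continuous_sum => i.
have ci j : {for z, continuous (fun z => h z 0 j)}.
  by apply: (@continuous_comp _ _ _ h (fun y : Rn => y 0 j) z ch); exact: continuous_coord.
apply: cvgM.
  by apply: (@continuous_dgauss_t _ _ _ _ _ sg (fun z => h z 0 i)) => //; exact: count_size.
apply: continuous_prod => j.
by apply: (@continuous_dgauss _ _ _ _ _ sg (fun z => h z 0 j)) => //; exact: count_size.
Qed.

Lemma not_box r y : ~ box r y -> exists i, r < `|y 0 i|.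
Proof.
move=> yr; apply: contrapT => h; apply: yr => i.
by rewrite leNgt; apply/negP => ri; apply: h; exists i.
Qed.

Lemma psi_out r l x s y : 0 < r -> ~ box r y -> psi r l x s y = 0.
Proof.
move=> r0 /not_box[i yi]; rewrite /psi (bigD1 i)//= dgauss_out ?mul0r//.
exact: ltW.
Qed.

Lemma psi_t_out r l x s y : 0 < r -> ~ box r y -> psi_t r l x s y = 0.
Proof.
move=> r0 /not_box[i yi]; rewrite /psi_t big1// => k _.
have [->|ki] := eqVneq k i; first by rewrite dgauss_t_out ?mul0r// ltW.
by rewrite (bigD1 i) 1?eq_sym//= dgauss_out ?mul0r ?mulr0// ltW.
Qed.

Lemma majorant_ge0 l x y : 0 < l -> 0 <= majorant l x y.
Proof. by move=> l0; rewrite prodr_ge0// => i _; exact: gh_ge0. Qed.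

Lemma prod_count (a : R) s : \prod_i a ^+ count_mem i s = a ^+ size s.
Proof.
elim: s => [|k s ih]; first by rewrite big1.
rewrite (bigD1 k)//= eqxx add1n !exprS -mulrA; congr (_ * _).
rewrite -ih [in RHS](bigD1 k)//=; congr (_ * _); apply: eq_bigr => i /negbTE ik.
by rewrite eq_sym ik add0n.
Qed.

Lemma psi_bound : exists2 C, 0 < C & forall r l x s y, (size s <= 4)%N -> 0 < l <= r ->
  [/\ `|psi r l x s y| <= C * l^-1 ^+ size s * majorant l x y,
      `|psi_t r l x s y| <= C * l^-1 ^+ (size s).+2 * majorant l x y &
      `|\sum_k psi r l x (k :: k :: s) y - psi_t r l x s y| <=
        C * (r^-1 * l^-1 ^+ (size s).+1) * majorant l x y].
Proof.
have [C C0 HC] := @dgauss_bound R.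
(* [C ^+ n] comes from the coordinate factors, and the sums over one distinguished coordinate have
   [n] terms; with [n.+1] the prefactor is at least 1, which also covers the first bound. *)
exists (n.+1%:R * C ^+ n); first by rewrite mulr_gt0 ?exprn_gt0.
move=> r l x s y s4 lr; have /andP[l0 lr'] := lr.
have r0 : 0 < r := lt_le_trans l0 lr'.
pose d i := dgauss r l (x 0 i) (count_mem i s) (y 0 i).
pose b i := C * l^-1 ^+ count_mem i s * gh l (y 0 i - x 0 i).
have b0 i : 0 <= b i.
  by rewrite mulr_ge0 ?gh_ge0// mulr_ge0 ?exprn_ge0 ?invr_ge0// ltW.
have db i : `|d i| <= b i by have [] := HC (count_mem i s) r l (x 0 i) (y 0 i) (count_size i s4) lr.
have pb : \prod_i b i = C ^+ n * l^-1 ^+ size s * majorant l x y.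
  by rewrite /b /majorant !big_split/= prod_count prodr_const card_ord.
have P0 : 0 <= C ^+ n * l^-1 ^+ size s * majorant l x y.
  by rewrite -pb prodr_ge0.
have Nn (A : R) : 0 <= A -> (\sum_(i < n) A) <= n.+1%:R * A.
  by move=> A0; rewrite sumr_const card_ord -[A *+ n]mulr_natl ler_wpM2r// ler_nat.
have key (D : 'I_n -> R) (A : R) : 0 <= A -> (forall i, `|D i| <= A * b i) ->
    `|\sum_i D i * \prod_(j | j != i) d j| <=
      n.+1%:R * (A * (C ^+ n * l^-1 ^+ size s * majorant l x y)).
  move=> A0 hD; rewrite (le_trans (ler_norm_sum _ _ _))//.
  apply: le_trans (Nn _ (mulr_ge0 A0 P0)); apply: ler_sum => i _.
  apply: (@le_trans _ _ (A * b i * \prod_(j | j != i) b j)).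
    rewrite normrM normr_prod ler_pM// ?prodr_ge0//.
    by apply: ler_prod => j _; rewrite normr_ge0 db.
  by rewrite -mulrA -pb [in X in _ <= X](bigD1 i).
split.
- rewrite /psi normr_prod -!(mulrA n.+1%:R).
  apply: (@le_trans _ _ (\prod_i b i)).
    by apply: ler_prod => j _; rewrite normr_ge0 db.
  by rewrite pb; apply: ler_peMl => //; rewrite ler1n.
- have := key (fun i => dgauss_t r l (x 0 i) (count_mem i s) (y 0 i)) (l^-1 ^+ 2).
  move=> /(_ _ _)/le_trans; apply.
  + by rewrite exprn_ge0// invr_ge0 ltW.
  + move=> i; have [_ [h _]] := HC (count_mem i s) r l (x 0 i) (y 0 i) (count_size i s4) lr.
    rewrite (le_trans h)// /b -[(count_mem i s).+2]addn2 exprD le_eqVlt; apply/orP; left; apply/eqP; ring.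
  + rewrite -[(size s).+2]addn2 exprD le_eqVlt; apply/orP; left; apply/eqP; ring.
- rewrite /psi_t -sumrB.
  rewrite (eq_bigr (fun i => (dgauss r l (x 0 i) (count_mem i s).+2 (y 0 i) - dgauss_t r l (x 0 i) (count_mem i s) (y 0 i)) * \prod_(j | j != i) d j)); last first.
    by move=> i _; rewrite psi_cons2 mulrBl.
  have := key (fun i => dgauss r l (x 0 i) (count_mem i s).+2 (y 0 i) - dgauss_t r l (x 0 i) (count_mem i s) (y 0 i)) (r^-1 * l^-1).
  move=> /(_ _ _)/le_trans; apply.
  + by rewrite mulr_ge0// invr_ge0 ltW.
  + move=> i; have [_ [_ h]] := HC (count_mem i s) r l (x 0 i) (y 0 i) (count_size i s4) lr.
    rewrite (le_trans h)// /b exprS le_eqVlt; apply/orP; left; apply/eqP; ring.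
  + rewrite exprS le_eqVlt; apply/orP; left; apply/eqP; ring.
Qed.

Lemma measurable_majorant l x : measurable_fun setT (majorant l x).
Proof.
apply: continuous_measurable_rV => y; apply: continuous_prod => i.
apply: (@continuous_comp _ _ _ (fun y : Rn => y 0 i) (fun z => gh l (z - x 0 i))).
  exact: continuous_coord.
exact: continuous_gh.
Qed.

Lemma integral_majorant l x : 0 < l ->
  (\int[mu]_y (majorant l x y)%:E = (Num.sqrt (8 * pi) ^+ n)%:E)%E.
Proof.
move=> l0; rewrite /majorant (@ge0_integral_prod_rV _ n (fun i t => gh l (t - x 0 i))).
- under eq_bigr do rewrite integral_gh//.
  by rewrite prodEFin prodr_const card_ord.
- by move=> i; apply: continuous_measurable_fun; exact: continuous_gh.
- by move=> i t; exact: gh_ge0.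
Qed.

(** The weight depends on one coordinate, so the integral factors into [n.-1] Gaussian masses and
    one weighted integral on the line, estimated by [integral_gh_pw]. *)
Lemma integral_majorant_pw (k0 : 'I_n) a : 0 < a < 1 -> exists2 C, 0 < C & forall l x, 0 < l ->
  (x 0 k0 != 0 -> (\int[mu]_y (majorant l x y * pw a (y 0 k0))%:E <= (C * pw a (x 0 k0))%:E)%E) /\
  (\int[mu]_y (majorant l x y * pw a (y 0 k0))%:E <= (C * l `^ (- a))%:E)%E.
Proof.
move=> a01; have [C C0 HC] := @integral_gh_pw R a a01.
set K := Num.sqrt (8 * pi) : R.
have K0 : 0 < K by rewrite sqrtr_gt0 mulr_gt0// pi_gt0.
exists (K ^+ n.-1 * C); first by rewrite mulr_gt0// exprn_gt0.
move=> l x l0.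
have E : (\int[mu]_y (majorant l x y * pw a (y 0 k0))%:E =
    (K ^+ n.-1)%:E * \int[@lebesgue_measure R]_t (gh l (t - x 0 k0) * pw a t)%:E)%E.
  pose f i t := gh l (t - x 0 i) * (if i == k0 then pw a t else 1).
  have mg i : measurable_fun setT (fun t => gh l (t - x 0 i)).
    by apply: continuous_measurable_fun; exact: continuous_gh.
  transitivity (\int[mu]_y (\prod_i f i (y 0%R i))%:E)%E.
    apply: eq_integral => y _; congr EFin; rewrite /f big_split/=; congr (_ * _).
    by rewrite -big_mkcond big_pred1_eq.
  rewrite ge0_integral_prod_rV.
  - rewrite (bigD1 k0)//= muleC; congr (_ * _)%E; last by rewrite /f eqxx.
    rewrite (eq_bigr (fun=> K%:E)); last first.
      move=> i /negbTE ik; rewrite /f ik; under eq_integral do rewrite mulr1.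
      exact: integral_gh.
    by rewrite prodEFin prodr_const cardC1 card_ord.
  - move=> i; apply: measurable_funM => //; case: (i == k0) => //; exact: measurable_pw.
  - by move=> i t; rewrite /f mulr_ge0 ?gh_ge0//; case: ifP => // _; exact: pw_ge0.
have [h1 h2] := HC l (x 0 k0) l0.
have Kn0 : (0 <= (K ^+ n.-1)%:E)%E by rewrite lee_fin exprn_ge0// ltW.
split => [x0|]; rewrite E -mulrA EFinM.
  exact: lee_wpmul2l (h1 x0).
exact: lee_wpmul2l h2.
Qed.

End test_functions.

(** * Weak form of the equations *)

Section weak_form.
Context {R : realType} {n : nat}.
Local Notation Rn := 'rV[R]_n.
Local Notation mu := (@lebesgue_rV R n).
Local Notation e_ k := (delta_mx 0 k : Rn).
Implicit Types (f g phi : Rn -> R) (r : R) (s : seq 'I_n).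

Definition vanish r f := forall y, ~ box r y -> f y = 0.

Lemma vanishMl r f phi : vanish r phi -> vanish r (fun y => f y * phi y).
Proof. by move=> h y yr; rewrite h// mulr0. Qed.

Lemma continuous_mul f g : continuous f -> continuous g -> continuous (fun y => f y * g y).
Proof. by move=> cf cg y; exact: (cvgM (cf y) (cg y)). Qed.

Lemma continuous_add f g : continuous f -> continuous g -> continuous (fun y => f y + g y).
Proof. by move=> cf cg y; exact: (cvgD (cf y) (cg y)). Qed.

Lemma continuous_sub f g : continuous f -> continuous g -> continuous (fun y => f y - g y).
Proof. by move=> cf cg y; exact: (cvgB (cf y) (cg y)). Qed.

Lemma integrable_mul r f phi : continuous f -> continuous phi -> vanish r phi ->
  mu.-integrable setT (EFin \o (fun y => f y * phi y)).
Proof.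
move=> cf cphi vphi; apply: (@continuous_cube_integrable _ _ _ r).
  exact: continuous_mul.
exact: vanishMl.
Qed.

Lemma RintegralD_mul r f g phi : continuous f -> continuous g -> continuous phi -> vanish r phi ->
  \int[mu]_y ((f y + g y) * phi y) = \int[mu]_y (f y * phi y) + \int[mu]_y (g y * phi y).
Proof.
move=> cf cg cphi vphi; under eq_Rintegral do rewrite mulrDl.
by rewrite RintegralD//; exact: (@integrable_mul r).
Qed.

Lemma RintegralB_mul r f g phi : continuous f -> continuous g -> continuous phi -> vanish r phi ->
  \int[mu]_y ((f y - g y) * phi y) = \int[mu]_y (f y * phi y) - \int[mu]_y (g y * phi y).
Proof.
move=> cf cg cphi vphi; under eq_Rintegral do rewrite mulrBl.
by rewrite RintegralB//; exact: (@integrable_mul r).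
Qed.

Lemma RintegralB_mulr r f phi psi : continuous f -> continuous phi -> vanish r phi ->
  continuous psi -> vanish r psi ->
  \int[mu]_y (f y * (phi y - psi y)) = \int[mu]_y (f y * phi y) - \int[mu]_y (f y * psi y).
Proof.
move=> cf cphi vphi cpsi vpsi; under eq_Rintegral do rewrite mulrBr.
by rewrite RintegralB//; exact: (@integrable_mul r).
Qed.

Lemma continuous_bigsum (I : Type) (q : seq I) (g : I -> Rn -> R) :
  (forall i, continuous (g i)) -> continuous (fun y => \sum_(i <- q) g i y).
Proof. by move=> cg y; apply: continuous_sum => i; exact: cg. Qed.

Lemma Rintegral_sum_mul (I : Type) (q : seq I) r (g : I -> Rn -> R) phi :
  (forall i, continuous (g i)) -> continuous phi -> vanish r phi ->
  \int[mu]_y ((\sum_(i <- q) g i y) * phi y) = \sum_(i <- q) \int[mu]_y (g i y * phi y).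
Proof.
move=> cg cphi vphi; elim: q => [|i q ih].
  rewrite big_nil; under eq_Rintegral do rewrite big_nil mul0r.
  by rewrite Rintegral_cst// mul0r.
rewrite big_cons -ih -(@RintegralD_mul r)//; last exact: continuous_bigsum.
by apply: eq_Rintegral => y _; rewrite big_cons.
Qed.

Lemma Rintegral_mul_sum (I : Type) (q : seq I) r f (phi : I -> Rn -> R) :
  continuous f -> (forall i, continuous (phi i)) -> (forall i, vanish r (phi i)) ->
  \int[mu]_y (f y * (\sum_(i <- q) phi i y)) = \sum_(i <- q) \int[mu]_y (f y * phi i y).
Proof.
move=> cf cphi vphi; elim: q => [|i q ih].
  rewrite big_nil; under eq_Rintegral do rewrite big_nil mulr0.
  by rewrite Rintegral_cst// mul0r.
rewrite big_cons -ih.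
under eq_Rintegral do rewrite big_cons mulrDr.
rewrite RintegralD//; apply: (@integrable_mul r) => //.
  exact: continuous_bigsum.
by move=> y yr; rewrite big1// => j _; exact: vphi.
Qed.

Lemma int_by_parts k r f df phi dphi :
  (forall y, is_partial k f y (df y)) -> continuous f -> continuous df ->
  (forall y, is_partial k phi y (dphi y)) -> continuous phi -> continuous dphi ->
  vanish r phi -> vanish r dphi ->
  \int[mu]_y (df y * phi y) = - \int[mu]_y (f y * dphi y).
Proof.
move=> fd cf cdf pd cp cdp vp vdp.
have : \int[mu]_y (f y * dphi y + df y * phi y) = 0.
  apply: (@integral_partial0 _ _ k (fun y => f y * phi y) _ r).
  - move=> y; have d1 := fd y; have d2 := pd y.
    apply: (is_derive_eq (is_deriveM d1 d2)).
    by rewrite scale0r addr0 /GRing.scale/= (mulrC (phi y)).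
  - exact: continuous_mul.
  - exact: (continuous_add (continuous_mul cf cdp) (continuous_mul cdf cp)).
  - exact: vanishMl.
  - by move=> y yr; rewrite vdp// vp// !mulr0 addr0.
rewrite RintegralD//; [|exact: (@integrable_mul r)|exact: (@integrable_mul r)].
by move/eqP; rewrite addrC addr_eq0 => /eqP.
Qed.

Section fixed_time.
Variables (V Vt : 'I_n -> Rn -> R) (dV d2V : 'I_n -> 'I_n -> Rn -> R).
Variables (Q : Rn -> R) (dQ : 'I_n -> Rn -> R).
Hypotheses (cV : forall j, continuous (V j)) (cVt : forall j, continuous (Vt j))
  (cdV : forall k j, continuous (dV k j)) (cd2V : forall k j, continuous (d2V k j))
  (cQ : continuous Q) (cdQ : forall k, continuous (dQ k)).
Hypotheses (pV : forall k j y, is_partial k (V j) y (dV k j y))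
  (pdV : forall k j y, is_partial k (dV k j) y (d2V k j y))
  (pQ : forall k y, is_partial k Q y (dQ k y)).
Hypothesis momentum : forall j y,
  Vt j y + \sum_i V i y * dV i j y + dQ j y = \sum_k d2V k j y.
Hypothesis incompressible : forall y, \sum_k dV k k y = 0.

Variables (r : R) (phi : seq 'I_n -> Rn -> R).
Hypotheses (cphi : forall s, (size s <= 4)%N -> continuous (phi s))
  (vphi : forall s, vanish r (phi s))
  (pphi : forall k s y, (size s <= 3)%N -> is_partial k (phi s) y (phi (k :: s) y))
  (phi_perm : forall s s', perm_eq s s' -> phi s = phi s').

Lemma divergence_weak s : (size s <= 3)%N -> \sum_k \int[mu]_y (V k y * phi (k :: s) y) = 0.
Proof.
move=> s3.
have cs : continuous (phi s) by apply: cphi; exact: leq_trans s3 _.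
transitivity (- \sum_k \int[mu]_y (dV k k y * phi s y)).
  rewrite -sumrN; apply: eq_bigr => k _.
  rewrite (@int_by_parts k r (V k) (dV k k) (phi s) (phi (k :: s))) ?opprK//.
  - by move=> y; exact: pphi.
  - exact: cphi.
rewrite -(@Rintegral_sum_mul _ _ r)//.
under eq_Rintegral do rewrite incompressible mul0r.
by rewrite Rintegral_cst// mul0r oppr0.
Qed.

Lemma momentum_weak j s : (size s <= 2)%N ->
  \int[mu]_y (Vt j y * phi s y) =
    \sum_k \int[mu]_y (V j y * phi (k :: k :: s) y) +
    \sum_i \int[mu]_y (V i y * V j y * phi (i :: s) y) +
    \int[mu]_y (Q y * phi (j :: s) y).
Proof.
move=> s2.
have s4 : (size s <= 4)%N by exact: leq_trans s2 _.
have s3 : (size s <= 3)%N by exact: leq_trans s2 _.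
have cs := cphi s4.
have cVV i k : continuous (fun y => V i y * V k y) by exact: continuous_mul.
have cVdV i k l : continuous (fun y => V i y * dV k l y) by exact: continuous_mul.
have visc : \sum_k \int[mu]_y (d2V k j y * phi s y) =
    \sum_k \int[mu]_y (V j y * phi (k :: k :: s) y).
  apply: eq_bigr => k _.
  rewrite (@int_by_parts k r (dV k j) (d2V k j) (phi s) (phi (k :: s)))//; last 2 first.
  - by move=> y; exact: pphi.
  - exact: cphi.
  rewrite (@int_by_parts k r (V j) (dV k j) (phi (k :: s)) (phi (k :: k :: s))) ?opprK//.
  - by move=> y; exact: pphi.
  - exact: cphi.
  - exact: cphi.
have pres : \int[mu]_y (dQ j y * phi s y) = - \int[mu]_y (Q y * phi (j :: s) y).
  apply: (@int_by_parts j r) => //; first by move=> y; exact: pphi.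
  exact: cphi.
(* [V i * dV i j] is completed to the derivative of [V i * V j] in direction [i]; the added terms
   sum to zero by incompressibility. *)
have conv : \sum_i \int[mu]_y (V i y * dV i j y * phi s y) =
    - \sum_i \int[mu]_y (V i y * V j y * phi (i :: s) y).
  have h i : \int[mu]_y ((V i y * dV i j y + dV i i y * V j y) * phi s y) =
      - \int[mu]_y (V i y * V j y * phi (i :: s) y).
    apply: (@int_by_parts i r (fun y => V i y * V j y)) => //.
    - move=> y; have d1 := pV i i y; have d2 := pV i j y.
      apply: (is_derive_eq (is_deriveM d1 d2)).
      by rewrite scale0r addr0 /GRing.scale/=; ring.
    - by apply: (@continuous_add (fun y => V i y * dV i j y) (fun y => dV i i y * V j y)); apply: continuous_mul.
    - by move=> y; exact: pphi.
    - exact: cphi.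
  rewrite -sumrN -(eq_bigr _ (fun i _ => h i)).
  under [in RHS]eq_bigr => i _.
    rewrite (@RintegralD_mul r)//; last exact: continuous_mul.
    over.
  rewrite big_split/= -[LHS]addr0; congr (_ + _); apply/esym.
  rewrite -(@Rintegral_sum_mul _ _ r)//; last by move=> i; exact: continuous_mul.
  under eq_Rintegral do rewrite -mulr_suml incompressible !mul0r.
  by rewrite Rintegral_cst// mul0r.
have cS : continuous (fun y => \sum_k d2V k j y) by exact: continuous_bigsum.
have cC : continuous (fun y => \sum_i V i y * dV i j y) by exact: continuous_bigsum.
transitivity (\int[mu]_y (((\sum_k d2V k j y) - (\sum_i V i y * dV i j y) - dQ j y) * phi s y)).
  by apply: eq_Rintegral => y _; rewrite -momentum; congr (_ * _); ring.
rewrite (@RintegralB_mul r)//; last exact: (@continuous_sub (fun y => \sum_k d2V k j y) (fun y => \sum_i V i y * dV i j y) cS cC).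
rewrite (@RintegralB_mul r)// pres opprK; congr (_ + _).
by rewrite !(@Rintegral_sum_mul _ _ r)// visc conv opprK.
Qed.

(* Testing with the divergence-free field (d_k phi) e_j - (d_j phi) e_k, phi = d_k (phi [::]),
   removes the pressure. *)
Lemma solenoidal_weak j :
  \sum_k (\int[mu]_y (Vt j y * phi [:: k; k] y) - \int[mu]_y (Vt k y * phi [:: j; k] y)) =
  \sum_k (\sum_l \int[mu]_y (V j y * phi [:: l; l; k; k] y) -
          \sum_l \int[mu]_y (V k y * phi [:: l; l; j; k] y)) +
  \sum_k (\sum_i \int[mu]_y (V i y * V j y * phi [:: i; k; k] y) -
          \sum_i \int[mu]_y (V i y * V k y * phi [:: i; j; k] y)).
Proof.
rewrite -big_split/=; apply: eq_bigr => k _.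
rewrite !momentum_weak//.
(* Here the pressure cancels: both momentum equations pair it with the third derivative of the test
   function in the directions [j], [k], [k]. *)
rewrite (@phi_perm [:: j; k; k] [:: k; j; k]); first by ring.
by rewrite (perm_catCA [:: j] [:: k] [:: k]).
Qed.

End fixed_time.

End weak_form.

(** * Flows by components and their pairings with backward heat kernels *)

Section flow.
Context {R : realType} {n : nat}.
Local Notation Rn := 'rV[R]_n.
Local Notation mu := (@lebesgue_rV R n).
Implicit Types (r a b c t : R) (s : seq 'I_n) (x y : Rn).

(* A solution on ]a, b[ by components, with the derivatives of the velocity V and
   of the pressure Q as data: dV k j is the k-th partial derivative of V j. *)
Record flow a b (V Vt : 'I_n -> R -> Rn -> R) (dV d2V : 'I_n -> 'I_n -> R -> Rn -> R)
    (Q : R -> Rn -> R) (dQ : 'I_n -> R -> Rn -> R) : Prop := Flow {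
  flow_cV : forall j t y, a < t < b -> {for (t, y), continuous (fun z : R * Rn => V j z.1 z.2)};
  flow_cVt : forall j t y, a < t < b -> {for (t, y), continuous (fun z : R * Rn => Vt j z.1 z.2)};
  flow_cdV : forall k j t, a < t < b -> continuous (dV k j t);
  flow_cd2V : forall k j t, a < t < b -> continuous (d2V k j t);
  flow_cQ : forall t, a < t < b -> continuous (Q t);
  flow_cdQ : forall k t, a < t < b -> continuous (dQ k t);
  flow_Vt : forall j t y, a < t < b -> is_derive t 1 (fun t => V j t y) (Vt j t y);
  flow_dV : forall k j t y, a < t < b -> is_partial k (V j t) y (dV k j t y);
  flow_d2V : forall k j t y, a < t < b -> is_partial k (dV k j t) y (d2V k j t y);
  flow_dQ : forall k t y, a < t < b -> is_partial k (Q t) y (dQ k t y);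
  flow_momentum : forall j t y, a < t < b ->
    Vt j t y + \sum_i V i t y * dV i j t y + dQ j t y = \sum_k d2V k j t y;
  flow_div : forall t y, a < t < b -> \sum_k dV k k t y = 0 }.

Lemma continuous_slice (G : R -> Rn -> R) t :
  (forall y, {for (t, y), continuous (fun z : R * Rn => G z.1 z.2)}) -> continuous (G t).
Proof.
move=> cG y.
apply: (@continuous_comp _ _ _ (fun y => (t, y)) (fun z : R * Rn => G z.1 z.2)).
  exact: pair_continuous_r.
exact: cG.
Qed.

Definition lap_psi r l x y : R := \sum_k psi r l x [:: k; k] y.

(* What the cutoff leaves of the heat equation: it is O(r^-1). *)
Definition defect r l x s y : R := \sum_k psi r l x (k :: k :: s) y - psi_t r l x s y.

Lemma continuous_psi_space r l x s : 0 < l -> (size s <= 5)%N -> continuous (psi r l x s).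
Proof.
move=> l0 s5 y; have h := @continuous_psi R n Rn r x s (fun _ => l ^+ 2) id y s5 (exprn_gt0 2 l0)
  (@cvg_cst _ _ _ _ _) (@cvg_id _ _).
rewrite sqrtr_sqr gtr0_norm// in h; exact: (h (nbhs_filter y)).
Qed.

Lemma continuous_psi_t_space r l x s : 0 < l -> (size s <= 5)%N -> continuous (psi_t r l x s).
Proof.
move=> l0 s5 y; have h := @continuous_psi_t R n Rn r x s (fun _ => l ^+ 2) id y s5 (exprn_gt0 2 l0)
  (@cvg_cst _ _ _ _ _) (@cvg_id _ _).
rewrite sqrtr_sqr gtr0_norm// in h; exact: (h (nbhs_filter y)).
Qed.

Lemma continuous_psi_rev r x s c u y : (size s <= 5)%N -> u < c ->
  {for (u, y), continuous (fun z : R * Rn => psi r (Num.sqrt (c - z.1)) x s z.2)}.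
Proof.
move=> s5 uc; have cu : 0 < c - u by rewrite subr_gt0.
apply: (@continuous_psi R n (R * Rn)%type r x s (fun z => c - z.1) (fun z => z.2) (u, y) s5 cu _ cvg_snd).
by apply: cvgB; [exact: cvg_cst|exact: cvg_fst].
Qed.

Lemma continuous_psi_t_rev r x s c u y : (size s <= 5)%N -> u < c ->
  {for (u, y), continuous (fun z : R * Rn => psi_t r (Num.sqrt (c - z.1)) x s z.2)}.
Proof.
move=> s5 uc; have cu : 0 < c - u by rewrite subr_gt0.
apply: (@continuous_psi_t R n (R * Rn)%type r x s (fun z => c - z.1) (fun z => z.2) (u, y) s5 cu _ cvg_snd).
by apply: cvgB; [exact: cvg_cst|exact: cvg_fst].
Qed.

Lemma vanish_psi r l x s : 0 < r -> vanish r (psi r l x s).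
Proof. by move=> r0 y; exact: psi_out. Qed.

Lemma vanish_psi_t r l x s : 0 < r -> vanish r (psi_t r l x s).
Proof. by move=> r0 y; exact: psi_t_out. Qed.

Lemma continuous_lap_psi r l x : 0 < l -> continuous (lap_psi r l x).
Proof. by move=> l0; apply: continuous_bigsum => k; exact: continuous_psi_space. Qed.

Lemma vanish_lap_psi r l x : 0 < r -> vanish r (lap_psi r l x).
Proof. by move=> r0 y yr; rewrite /lap_psi big1// => k _; exact: vanish_psi. Qed.

Lemma continuous_defect r l x s : 0 < l -> (size s <= 3)%N -> continuous (defect r l x s).
Proof.
move=> l0 s3.
apply: (@continuous_sub _ _ (fun y => \sum_k psi r l x (k :: k :: s) y) (psi_t r l x s)).
  by apply: continuous_bigsum => k; apply: continuous_psi_space.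
by apply: continuous_psi_t_space => //; exact: leq_trans s3 _.
Qed.

Lemma vanish_defect r l x s : 0 < r -> vanish r (defect r l x s).
Proof.
move=> r0 y yr; rewrite /defect vanish_psi_t// big1 ?subr0// => k _.
exact: vanish_psi.
Qed.

Lemma Rintegral_defect r l x s (f : Rn -> R) : 0 < r -> 0 < l -> (size s <= 3)%N -> continuous f ->
  \int[mu]_y (f y * defect r l x s y) =
  \sum_k \int[mu]_y (f y * psi r l x (k :: k :: s) y) - \int[mu]_y (f y * psi_t r l x s y).
Proof.
move=> r0 l0 s3 cf.
have cp k : continuous (psi r l x (k :: k :: s)) by exact: continuous_psi_space.
rewrite (@RintegralB_mulr _ _ r f (fun y => \sum_k psi r l x (k :: k :: s) y))//.
- by rewrite (@Rintegral_mul_sum _ _ _ _ r)// => k; exact: vanish_psi.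
- exact: continuous_bigsum.
- by move=> y yr; rewrite big1// => k _; exact: vanish_psi.
- by apply: continuous_psi_t_space => //; exact: leq_trans s3 _.
- exact: vanish_psi_t.
Qed.

Lemma is_derive_scale r x s (f : Rn -> R) t : 0 < r -> 0 < t -> (size s <= 5)%N -> continuous f ->
  is_derive t 1 (fun t => \int[mu]_y (f y * psi r (Num.sqrt t) x s y))
    (\int[mu]_y (f y * psi_t r (Num.sqrt t) x s y)).
Proof.
move=> r0 t0 s5 cf.
apply: (@is_derive_integral R n 0 (t + 1) t r (fun t y => f y * psi r (Num.sqrt t) x s y)
  (fun t y => f y * psi_t r (Num.sqrt t) x s y)).
- by rewrite t0 ltrDl ltr01.
- move=> u y /andP[u0 _].
  exact: (@is_deriveZ _ _ _ _ (f y) _ _ _ (is_derive_psi_scale r x s y u0)).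
- move=> u y /andP[u0 _]; apply: cvgM.
    by apply: (@continuous_comp _ _ _ (fun z : R * Rn => z.2) f); [exact: cvg_snd|exact: cf].
  exact: (@continuous_psi R n (R * Rn)%type r x s (fun z => z.1) (fun z => z.2) (u, y) s5 u0 cvg_fst cvg_snd).
- move=> u y /andP[u0 _]; apply: cvgM.
    by apply: (@continuous_comp _ _ _ (fun z : R * Rn => z.2) f); [exact: cvg_snd|exact: cf].
  exact: (@continuous_psi_t R n (R * Rn)%type r x s (fun z => z.1) (fun z => z.2) (u, y) s5 u0 cvg_fst cvg_snd).
- by move=> u y _ yr; rewrite vanish_psi// mulr0.
- by move=> u y _ yr; rewrite vanish_psi_t// mulr0.
Qed.

Section flow_theory.
Variables (a b : R) (V Vt : 'I_n -> R -> Rn -> R) (dV d2V : 'I_n -> 'I_n -> R -> Rn -> R)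
  (Q : R -> Rn -> R) (dQ : 'I_n -> R -> Rn -> R).
Hypothesis fl : flow a b V Vt dV d2V Q dQ.

Lemma flow_cV_space j t : a < t < b -> continuous (V j t).
Proof. by move=> tab; apply: continuous_slice => y; exact: flow_cV fl _ _ _ tab. Qed.

Lemma flow_cVt_space j t : a < t < b -> continuous (Vt j t).
Proof. by move=> tab; apply: continuous_slice => y; exact: flow_cVt fl _ _ _ tab. Qed.

Lemma is_derive_pairing r c x s j t : 0 < r -> a < t < b -> t < c -> (size s <= 5)%N ->
  is_derive t 1 (fun t => \int[mu]_y (V j t y * psi r (Num.sqrt (c - t)) x s y))
    (\int[mu]_y (Vt j t y * psi r (Num.sqrt (c - t)) x s y) -
     \int[mu]_y (V j t y * psi_t r (Num.sqrt (c - t)) x s y)).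
Proof.
move=> r0 tab tc s5; have /andP[at_ tb] := tab.
have l0 : 0 < Num.sqrt (c - t) by rewrite sqrtr_gt0 subr_gt0.
have cV := flow_cV_space (j := j) tab; have cVt := flow_cVt_space (j := j) tab.
have cp : continuous (psi r (Num.sqrt (c - t)) x s) by exact: continuous_psi_space.
have cpt : continuous (psi_t r (Num.sqrt (c - t)) x s) by exact: continuous_psi_t_space.
rewrite -RintegralB//; last 2 first.
- by apply: (@integrable_mul _ _ r) => //; exact: vanish_psi.
- by apply: (@integrable_mul _ _ r) => //; exact: vanish_psi_t.
have tm : a < t < Num.min b c by rewrite at_ lt_min tb tc.
apply: (@is_derive_integral R n a (Num.min b c) t r
  (fun t y => V j t y * psi r (Num.sqrt (c - t)) x s y)
  (fun t y => Vt j t y * psi r (Num.sqrt (c - t)) x s y - V j t y * psi_t r (Num.sqrt (c - t)) x s y)) => //.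
- move=> u y; rewrite lt_min => /and3P[au ub uc].
  have d1 : is_derive u 1 (fun t => V j t y) (Vt j u y) by apply: (flow_Vt fl); rewrite au.
  have d2 := is_derive_psi_time r x s y uc.
  apply: (is_derive_eq (is_deriveM d1 d2)).
  by rewrite /GRing.scale/=; ring.
- move=> u y; rewrite lt_min => /and3P[au ub uc]; apply: cvgM.
    by apply: (flow_cV fl); rewrite au.
  exact: continuous_psi_rev.
- move=> u y; rewrite lt_min => /and3P[au ub uc]; apply: cvgB; apply: cvgM.
  + by apply: (flow_cVt fl); rewrite au.
  + exact: continuous_psi_rev.
  + by apply: (flow_cV fl); rewrite au.
  + exact: continuous_psi_t_rev.
- by move=> u y _ yr; rewrite vanish_psi// mulr0.
- by move=> u y _ yr; rewrite vanish_psi// vanish_psi_t// !mulr0 subrr.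
Qed.

(** The time derivative computed in [is_derive_lap]. Viscosity survives only in the cutoff defect,
    and the quadratic term meets third derivatives of [psi]. *)
Definition flow_rate r l x j t : R :=
  \sum_k (\int[mu]_y (V j t y * defect r l x [:: k; k] y) -
          \int[mu]_y (V k t y * defect r l x [:: j; k] y)) +
  \sum_k (\sum_i \int[mu]_y (V i t y * V j t y * psi r l x [:: i; k; k] y) -
          \sum_i \int[mu]_y (V i t y * V k t y * psi r l x [:: i; j; k] y)).

(** The solenoidal test field differs from [lap_psi] times the [j]-th unit vector by a gradient, and
    a divergence-free flow pairs to zero with gradients. *)
Lemma flow_pairing_lap r l x j t : 0 < r -> 0 < l -> a < t < b ->
  \int[mu]_y (V j t y * lap_psi r l x y) =
  \sum_k (\int[mu]_y (V j t y * psi r l x [:: k; k] y) -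
          \int[mu]_y (V k t y * psi r l x [:: j; k] y)).
Proof.
move=> r0 l0 tab.
have cV i : continuous (V i t) by exact: flow_cV_space.
have cp s : (size s <= 5)%N -> continuous (psi r l x s) by exact: continuous_psi_space.
rewrite sumrB [X in _ = _ - X](_ : _ = 0); last first.
  transitivity (\sum_k \int[mu]_y (V k t y * psi r l x (k :: [:: j]) y)).
    apply: eq_bigr => k _; congr Rintegral; apply/funext => y.
    by rewrite (@psi_perm _ _ r l x [:: j; k] [:: k; j])// (perm_catC [:: j] [:: k]).
  apply: (@divergence_weak _ _ (V^~ t) (fun k j => dV k j t) _ _ _ _ r (psi r l x)) => //.
  - by move=> k i; exact: flow_cdV fl _ _ _ tab.
  - by move=> k i y; exact: flow_dV fl _ _ _ _ tab.
  - by move=> y; exact: flow_div fl _ _ tab.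
  - by move=> s s4; apply: cp; exact: leq_trans s4 _.
  - by move=> s; exact: vanish_psi.
  - by move=> k s y s3; apply: is_partial_psi => //; exact: leq_trans s3 _.
rewrite subr0 /lap_psi (@Rintegral_mul_sum _ _ _ _ r)//.
- by move=> k; exact: cp.
- by move=> k; exact: vanish_psi.
Qed.

Lemma is_derive_lap r c x j t : 0 < r -> a < t < b -> t < c ->
  is_derive t 1 (fun t => \int[mu]_y (V j t y * lap_psi r (Num.sqrt (c - t)) x y))
    (flow_rate r (Num.sqrt (c - t)) x j t).
Proof.
move=> r0 tab tc; have /andP[at_ tb] := tab.
have l0 u : u < c -> 0 < Num.sqrt (c - u) by move=> uc; rewrite sqrtr_gt0 subr_gt0.
(* The derivative is taken on the solenoidal form of the pairing, to which [solenoidal_weak]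
   applies. The two forms agree at times where the flow and the kernel exist, hence near [t]. *)
apply: (@near_eq_is_derive _ _ _ (\sum_(k < n)
    (fun t => \int[mu]_y (V j t y * psi r (Num.sqrt (c - t)) x [:: k; k] y) -
       \int[mu]_y (V k t y * psi r (Num.sqrt (c - t)) x [:: j; k] y)))).
  have : \forall u \near t, a < u < Num.min b c.
    have : t \in `]a, (Num.min b c)[ by rewrite in_itv/= at_ lt_min tb tc.
    by move=> /near_in_itvoo; apply: filterS => u; rewrite in_itv.
  apply: filterS => u; rewrite lt_min => /and3P[au ub uc].
  by rewrite fct_sumE flow_pairing_lap ?au ?l0.
pose l := Num.sqrt (c - t).
have d k := is_deriveB (is_derive_pairing x j (s := [:: k; k]) r0 tab tc isT)
  (is_derive_pairing x k (s := [:: j; k]) r0 tab tc isT).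
have := @is_derive_sum _ _ _ n _ t 1 _ d.
move=> D; apply: (is_derive_eq D).
rewrite /flow_rate -/l.
have cV i : continuous (V i t) by exact: flow_cV_space.
have cp s : (size s <= 5)%N -> continuous (psi r l x s) by apply: continuous_psi_space; exact: l0.
under [in RHS]eq_bigr => k _.
  rewrite !Rintegral_defect//; [|exact: l0..].
  over.
have h2 k i : continuous (dV k i t) by exact: flow_cdV fl _ _ _ tab.
have h3 k i : continuous (d2V k i t) by exact: flow_cd2V fl _ _ _ tab.
have h4 : continuous (Q t) by exact: flow_cQ fl _ tab.
have h5 k : continuous (dQ k t) by exact: flow_cdQ fl _ _ tab.
have h6 k i y := flow_dV fl k i y tab.
have h7 k i y := flow_d2V fl k i y tab.
have h8 k y := flow_dQ fl k y tab.
have h9 i y := flow_momentum fl i y tab.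
have h10 y := flow_div fl y tab.
have h11 s : (size s <= 4)%N -> continuous (psi r l x s).
  by move=> s4; apply: cp; exact: leq_trans s4 _.
have h12 s : vanish r (psi r l x s) by exact: vanish_psi.
have h13 k s y : (size s <= 3)%N -> is_partial k (psi r l x s) y (psi r l x (k :: s) y).
  by move=> s3; apply: is_partial_psi => //; [exact: l0|exact: leq_trans s3 _].
have S := @solenoidal_weak _ _ (V^~ t) (Vt^~ t) (fun k j => dV k j t) (fun k j => d2V k j t)
  (Q t) (dQ^~ t) cV h2 h3 h4 h5 h6 h7 h8 h9 h10 r (psi r l x) h11 h12 h13 (@psi_perm _ _ r l x) j.
rewrite -[LHS](_ : \sum_k (\int[mu]_y (Vt j t y * psi r l x [:: k; k] y) - \int[mu]_y (Vt k t y * psi r l x [:: j; k] y)) -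
  \sum_k (\int[mu]_y (V j t y * psi_t r l x [:: k; k] y) - \int[mu]_y (V k t y * psi_t r l x [:: j; k] y)) = _).
  rewrite S -/l addrAC -sumrB; congr (_ + _).
  by apply: eq_bigr => k _; ring.
by rewrite -sumrB; apply: eq_bigr => k _; rewrite -/l; ring.
Qed.

End flow_theory.

End flow.

(** * Estimates of pairings *)

(** Replaces the bound of an integral in time by the integral of a majorant: with an explicit
    antiderivative [g], both [g - f] and [g + f] are nondecreasing by the mean value theorem. *)
Lemma derivative_comparison (R : realType) (f df g dg : R -> R) (u v : R) : u <= v ->
  (forall t, u <= t <= v -> is_derive t 1 f (df t)) ->
  (forall t, u <= t <= v -> is_derive t 1 g (dg t)) ->
  (forall t, u <= t <= v -> `|df t| <= dg t) ->
  `|f v - f u| <= g v - g u.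
Proof.
move=> uv hf hg hfg.
have key (h dh : R -> R) : (forall t, u <= t <= v -> is_derive t 1 h (dh t)) ->
    (forall t, u <= t <= v -> 0 <= dh t) -> h u <= h v.
  move=> hh dh0; have [||c cuv E] := @MVT_segment R h dh u v uv.
  - by move=> t /[!in_itv]/= /andP[ut tv]; apply: hh; rewrite !ltW.
  - apply: derivable_within_continuous => t; rewrite in_itv/= => tuv.
    by have [] := hh t tuv.
  rewrite -subr_ge0 E mulr_ge0 ?subr_ge0// dh0//.
have h1 : (g - f) u <= (g - f) v.
  apply: (key (g - f) (fun t => dg t - df t)) => t tuv.
    by apply: is_deriveB; [exact: hg|exact: hf].
  by rewrite subr_ge0 (le_trans (ler_norm _))// hfg.
have h2 : (g + f) u <= (g + f) v.
  apply: (key (g + f) (fun t => dg t + df t)) => t tuv.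
    by apply: is_deriveD; [exact: hg|exact: hf].
  by have := hfg t tuv; rewrite ler_norml => /andP[]; lra.
by move: h1 h2; rewrite !fctE ler_norml => h1 h2; apply/andP; split; lra.
Qed.

Section pairing_estimates.
Context {R : realType} {n : nat}.
Local Notation Rn := 'rV[R]_n.
Local Notation mu := (@lebesgue_rV R n).
Implicit Types (r l M B N eps t : R) (s : seq 'I_n) (x y : Rn).

Lemma hyperplane_null (k : 'I_n) : mu [set y | y 0 k = 0] = 0%E.
Proof.
pose A (i : 'I_n) : set R := if i == k then [set 0] else setT.
have mA i : measurable (A i) by rewrite /A; case: ifP.
transitivity (mu [set y : Rn | forall i, A i (y 0 i)]).
  congr (mu _); apply/seteqP; split => [y yk i|y /(_ k)]; last by rewrite /A eqxx.
  by rewrite /A; case: ifP => // /eqP ->.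
apply: (etrans (lebesgue_rV_box mA)).
by rewrite (bigD1 k)//= /A eqxx lebesgue_measure_set1 mul0e.
Qed.

(** The bounds [g] in use contain the weight [pw] of the [k]-th coordinate, whose value where this
    coordinate is 0 is junk; that hyperplane is null, so a bound off it is enough. *)
Lemma normr_Rintegral_le (k : 'I_n) r (f phi g : Rn -> R) B :
  continuous f -> continuous phi -> vanish r phi ->
  measurable_fun setT g -> (forall y, 0 <= g y) ->
  (forall y, y 0 k != 0 -> `|f y * phi y| <= g y) ->
  (\int[mu]_y (g y)%:E <= B%:E)%E ->
  `|\int[mu]_y (f y * phi y)| <= B.
Proof.
move=> cf cphi vphi mg g0 fg gB.
have ifp := integrable_mul cf cphi vphi.
have ifpn : mu.-integrable setT (EFin \o (fun y => `|f y * phi y|)).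
  exact: integrable_norm ifp.
apply: (le_trans (le_normr_Rintegral measurableT ifp)).
rewrite -lee_fin /Rintegral fineK; last exact: integrable_fin_num ifpn.
apply: le_trans gB; apply: ae_ge0_le_integral => //.
- by case/integrableP : ifpn.
- by move=> y _; rewrite lee_fin.
- exact/measurable_EFinP.
exists [set y : Rn | y 0 k = 0]; split.
- rewrite (_ : mkset _ = (fun y : Rn => y 0 k) @^-1` [set 0])//.
  by rewrite -[X in measurable X]setTI; apply: measurable_coord => //; exact: measurable_set1.
- exact: hyperplane_null.
move=> y /= ny; apply: contrapT => yk; apply: ny => _.
by rewrite lee_fin fg//; apply/eqP.
Qed.

(** Three bounds for three uses: the supremum bound for the cutoff defects, the weighted one for the
    quadratic term, and the decay in [l] for the heat extension at large scales. *)
Lemma pairing_bound (k : 'I_n) a : 0 < a < 1 -> exists2 C, 0 < C &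
  forall r l x (f phi : Rn -> R) M B, 0 < l -> 0 <= M -> 0 <= B ->
    continuous f -> continuous phi -> vanish r phi ->
    (forall y, `|phi y| <= B * majorant l x y) ->
    ((forall y, `|f y| <= M) -> `|\int[mu]_y (f y * phi y)| <= C * M * B) /\
    ((forall y, y 0 k != 0 -> `|f y| <= M * pw a (y 0 k)) ->
      (x 0 k != 0 -> `|\int[mu]_y (f y * phi y)| <= C * M * B * pw a (x 0 k)) /\
      `|\int[mu]_y (f y * phi y)| <= C * M * B * l `^ (- a)).
Proof.
move=> a01; have [C C0 HC] := @integral_majorant_pw R n k a a01.
set K := Num.sqrt (8 * pi) ^+ n : R.
have K0 : 0 <= K by rewrite exprn_ge0// sqrtr_ge0.
exists (K + C); first by rewrite ltr_wpDl.
move=> r l x f phi M B l0 M0 B0 cf cphi vphi phiB.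
have [h1 h2] := HC l x l0.
have mm := @measurable_majorant R n l x.
have maj0 y : 0 <= majorant l x y by exact: majorant_ge0.
have MB0 : 0 <= M * B by rewrite mulr_ge0.
have mpwk : measurable_fun setT (fun y : Rn => pw a (y 0 k)).
  by apply: measurableT_comp; [exact: measurable_pw|exact: measurable_coord].
split => [fM|fM].
  apply: (@normr_Rintegral_le k r f phi (fun y => M * B * majorant l x y)) => //.
  - exact: measurable_funM.
  - by move=> y; rewrite mulr_ge0.
  - by move=> y _; rewrite normrM -mulrA ler_pM.
  under eq_integral do rewrite EFinM.
  rewrite ge0_integralZl ?lee_fin//; [|exact/measurable_EFinP|by move=> y _; rewrite lee_fin].
  rewrite integral_majorant// -EFinM lee_fin -/K.
  rewrite (_ : (K + C) * M * B = M * B * (K + C)); last by ring.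
  by rewrite ler_wpM2l// lerDl ltW.
have gB Z : 0 <= Z -> (\int[mu]_y (majorant l x y * pw a (y 0 k))%:E <= (C * Z)%:E)%E ->
    `|\int[mu]_y (f y * phi y)| <= (K + C) * M * B * Z.
  move=> Z0 hZ.
  apply: (@normr_Rintegral_le k r f phi (fun y => M * B * (majorant l x y * pw a (y 0 k)))) => //.
  - by apply: measurable_funM => //; exact: measurable_funM.
  - by move=> y; rewrite !mulr_ge0// pw_ge0.
  - move=> y yk; rewrite normrM (_ : M * B * _ = M * pw a (y 0 k) * (B * majorant l x y)); last by ring.
    by rewrite ler_pM// fM.
  under eq_integral do rewrite EFinM.
  rewrite ge0_integralZl ?lee_fin//.
  - apply: (le_trans (lee_wpmul2l _ hZ)); first by rewrite lee_fin.
    rewrite -EFinM lee_fin.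
    rewrite (_ : M * B * (C * Z) = C * (M * B * Z)); last by ring.
    rewrite (_ : (K + C) * M * B * Z = (K + C) * (M * B * Z)); last by ring.
    by rewrite ler_wpM2r ?lerDr// mulr_ge0.
  - by apply/measurable_EFinP; exact: measurable_funM.
  - by move=> y _; rewrite lee_fin mulr_ge0// pw_ge0.
split => [xk|]; first by apply: gB => //; [exact: pw_ge0|exact: h1].
by apply: gB => //; exact: powR_ge0.
Qed.

Lemma normr_sum_le (g : 'I_n -> R) B : 0 <= B -> (forall i, `|g i| <= B) ->
  `|\sum_i g i| <= n%:R * B.
Proof.
move=> B0 gB; apply: (le_trans (ler_norm_sum _ _ _)).
apply: (@le_trans _ _ (\sum_(i < n) B)); first exact: ler_sum.
by rewrite sumr_const card_ord -[B *+ n]mulr_natl.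
Qed.

(** The quadratic terms are differenced as [U (U - V) + (U - V) V], with [e] for one factor and the
    weight for the other; three derivatives of [psi] give [l^-3]. The defects carry the same [l^-3]
    and an extra [r^-1], so the supremum bound [2 e] of the difference is enough for them. *)
Lemma rate_bound (k0 : 'I_n) a : 0 < a < 1 -> exists2 C, 0 < C &
  forall (U V : 'I_n -> R -> Rn -> R) t e N r l x j,
    (forall i, continuous (U i t)) -> (forall i, continuous (V i t)) ->
    0 < l <= r -> 0 <= e -> 0 <= N -> x 0 k0 != 0 ->
    (forall i y, `|U i t y| <= e) -> (forall i y, `|V i t y| <= e) ->
    (forall i y, y 0 k0 != 0 -> `|U i t y - V i t y| <= N * pw a (y 0 k0)) ->
    `|flow_rate U r l x j t - flow_rate V r l x j t| <=
       C * e * l^-1 ^+ 3 * (N * pw a (x 0 k0) + r^-1).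
Proof.
move=> a01; have [C C0 HC] := pairing_bound k0 a01.
have [P P0 HP] := @psi_bound R n.
exists (1 + n%:R * 4 * (C * P) + n%:R * (n%:R * 4 * (C * P))).
  have CP0 : 0 <= C * P by rewrite mulr_ge0// ltW.
  move: (C * P) CP0 => c c0.
  by rewrite -addrA; apply: ltr_pwDl => //; rewrite addr_ge0// !mulr_ge0.
move=> U V t e N r l x j cU cV lr e0 N0 xk Ue Ve UV.
have /andP[l0 lr'] := lr; have r0 := lt_le_trans l0 lr'.
have li0 : 0 <= l^-1 by rewrite invr_ge0 ltW.
have ri0 : 0 <= r^-1 by rewrite invr_ge0 ltW.
have p0 : 0 <= pw a (x 0 k0) by exact: pw_ge0.
have cUV i : continuous (fun y => U i t y - V i t y) by exact: continuous_sub.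
have UVe i y : `|U i t y - V i t y| <= 2 * e.
  by rewrite (le_trans (ler_normB _ _))//; have := Ue i y; have := Ve i y; lra.
have hE i s : size s = 2%N -> `|\int[mu]_y (U i t y * defect r l x s y) -
    \int[mu]_y (V i t y * defect r l x s y)| <= 2 * (C * P) * e * l^-1 ^+ 3 * r^-1.
  move=> s2; have s3 : (size s <= 3)%N by rewrite s2.
  have s4 : (size s <= 4)%N by rewrite s2.
  have cd := @continuous_defect R n r l x s l0 s3.
  rewrite -(@RintegralB_mul _ _ r)//; last exact: vanish_defect.
  have := HC r l x (fun y => U i t y - V i t y) (defect r l x s) (2 * e) (P * (r^-1 * l^-1 ^+ 3)) l0.
  case=> //.
  - by rewrite mulr_ge0.
  - by rewrite !mulr_ge0 ?exprn_ge0// ltW.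
  - exact: vanish_defect.
  - by move=> y; have [_ _] := HP r l x s y s4 lr; rewrite s2.
  move=> /(_ (UVe i)) h _; apply: (le_trans h).
  by rewrite le_eqVlt; apply/orP; left; apply/eqP; ring.
have hF i k s : size s = 3%N -> `|\int[mu]_y (U i t y * U k t y * psi r l x s y) -
    \int[mu]_y (V i t y * V k t y * psi r l x s y)| <=
    2 * (C * P) * e * l^-1 ^+ 3 * (N * pw a (x 0 k0)).
  move=> s3; have s5 : (size s <= 5)%N by rewrite s3.
  have s4 : (size s <= 4)%N by rewrite s3.
  have cp := @continuous_psi_space R n r l x s l0 s5.
  have cUU : continuous (fun y => U i t y * U k t y) by exact: continuous_mul.
  have cVV : continuous (fun y => V i t y * V k t y) by exact: continuous_mul.
  have vp := @vanish_psi _ _ r l x s r0.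
  rewrite -(@RintegralB_mul _ _ r)//.
  have := HC r l x (fun y => U i t y * U k t y - V i t y * V k t y) (psi r l x s)
    (2 * e * N) (P * l^-1 ^+ 3) l0.
  case=> //.
  - by rewrite !mulr_ge0.
  - by rewrite !mulr_ge0 ?exprn_ge0// ltW.
  - exact: continuous_sub.
  - by move=> y; have [] := HP r l x s y s4 lr; rewrite s3.
  move=> _; case.
    move=> y yk; rewrite (_ : _ - _ = U i t y * (U k t y - V k t y) + (U i t y - V i t y) * V k t y); last by ring.
    rewrite (le_trans (ler_normD _ _))// !normrM.
    rewrite (_ : 2 * e * N * _ = e * (N * pw a (y 0 k0)) + (N * pw a (y 0 k0)) * e); last by ring.
    by rewrite lerD// ler_pM// ?UV.
  move=> /(_ xk) h _; apply: (le_trans h).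
  by rewrite le_eqVlt; apply/orP; left; apply/eqP; ring.
have [X XE] : exists X, X = e * l^-1 ^+ 3 * r^-1 by eexists.
have [Y YE] : exists Y, Y = e * l^-1 ^+ 3 * (N * pw a (x 0 k0)) by eexists.
have X0 : 0 <= X by rewrite XE !mulr_ge0 ?exprn_ge0.
have Y0 : 0 <= Y by rewrite YE !mulr_ge0 ?exprn_ge0.
have CP0 : 0 <= C * P by rewrite mulr_ge0// ltW.
have hE' i s : size s = 2%N -> `|\int[mu]_y (U i t y * defect r l x s y) -
    \int[mu]_y (V i t y * defect r l x s y)| <= 2 * (C * P) * X.
  move=> /(hE i) h; apply: (le_trans h).
  by rewrite XE le_eqVlt; apply/orP; left; apply/eqP; ring.
have hF' i k s : size s = 3%N -> `|\int[mu]_y (U i t y * U k t y * psi r l x s y) -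
    \int[mu]_y (V i t y * V k t y * psi r l x s y)| <= 2 * (C * P) * Y.
  move=> /(hF i k) h; apply: (le_trans h).
  by rewrite YE le_eqVlt; apply/orP; left; apply/eqP; ring.
have sub4 (A B D E : R) : A - B - (D - E) = A - D - (B - E) by ring.
clear hE hF; move: (C * P) CP0 hE' hF' => c CP0 hE' hF'.
rewrite (_ : _ * (N * _ + r^-1) = (1 + n%:R * 4 * c + n%:R * (n%:R * 4 * c)) * (X + Y)); last first.
  by rewrite XE YE; ring.
rewrite /flow_rate opprD addrACA -!sumrB.
apply: (le_trans (ler_normD _ _)).
apply: (@le_trans _ _ (n%:R * (4 * c * X) + n%:R * (n%:R * (4 * c * Y)))); last first.
  have h1 : 0 <= n%:R * (4 * c) * Y by rewrite !mulr_ge0.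
  have h2 : 0 <= n%:R * n%:R * (4 * c) * X by rewrite !mulr_ge0.
  have h3 : 0 <= X + Y by rewrite addr_ge0.
  by move: h1 h2 h3; clear; move: (n%:R) => m; lra.
apply: lerD.
  apply: normr_sum_le; first by rewrite !mulr_ge0.
  move=> k; rewrite sub4; apply: (le_trans (ler_normB _ _)).
  by have := hE' j [:: k; k] erefl; have := hE' k [:: j; k] erefl; lra.
apply: normr_sum_le; first by rewrite !mulr_ge0.
move=> k; rewrite sub4 -!sumrB; apply: normr_sum_le; first by rewrite !mulr_ge0.
move=> i; apply: (le_trans (ler_normB _ _)).
by have := hF' i j [:: i; k; k] erefl; have := hF' i k [:: i; j; k] erefl; lra.
Qed.

End pairing_estimates.

(** * Approximate identity *)

Section approximate_identity.
Context {R : realType} {n : nat}.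
Local Notation Rn := 'rV[R]_n.
Local Notation mu := (@lebesgue_rV R n).
Implicit Types (r l M eta : R) (x y : Rn).

(** Equal to [2 sqrt pi], the mass of the unnormalized kernel [gk 0 l], in the form produced by
    [integral_gk0]. *)
Definition gauss_mass : R := (Num.sqrt 2)^-1 * Num.sqrt (8 * pi).

Lemma gauss_mass_gt0 : 0 < gauss_mass.
Proof. by rewrite mulr_gt0 ?invr_gt0 ?sqrtr_gt0// mulr_gt0// pi_gt0. Qed.

Definition gauss_rV l x y : R := \prod_i gk 0 l (y 0 i - x 0 i).

Lemma gk0_ge0 l z : 0 < l -> 0 <= gk 0 l z :> R.
Proof. by move=> l0; rewrite gk0_gh// mulr_ge0 ?invr_ge0 ?sqrtr_ge0// gh_ge0// divr_gt0// sqrtr_gt0. Qed.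

Lemma continuous_gk0 l (x0 : R) : 0 < l -> continuous (fun z : R => gk 0 l (z - x0)).
Proof.
move=> l0 z; apply: differentiable_continuous; apply/derivable1_diffP.
by have [] := is_derive_gk 0 x0 z l0.
Qed.

Lemma continuous_gauss_rV l x : 0 < l -> continuous (gauss_rV l x).
Proof.
move=> l0 y; apply: continuous_prod => i.
apply: (@continuous_comp _ _ _ (fun y : Rn => y 0 i) (fun z => gk 0 l (z - x 0 i))).
  exact: continuous_coord.
exact: continuous_gk0.
Qed.

Lemma integral_gauss_rV l x : 0 < l ->
  (\int[mu]_y (gauss_rV l x y)%:E = (gauss_mass ^+ n)%:E)%E.
Proof.
move=> l0; rewrite /gauss_rV (@ge0_integral_prod_rV _ n (fun i t => gk 0 l (t - x 0 i))).
- under eq_bigr do rewrite integral_gk0//.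
  by rewrite prodEFin prodr_const card_ord.
- by move=> i; apply: continuous_measurable_fun; exact: continuous_gk0.
- by move=> i t; exact: gk0_ge0.
Qed.

(** The extra factor is a built-in Chebyshev inequality: at distance [d] from the centre it gains
    [l^2 / d^2] while an integrable majorant remains. *)
Lemma gk0_bound : exists2 C : R, 1 <= C & forall l z, 0 < l ->
  gk 0 l z * (1 + (z / l) ^+ 2) <= C * gh l z.
Proof.
have [C C0 HC] := @poly_expR_bound R (1 + 'X^2).
exists (1 + C); first by rewrite lerDl ltW.
move=> l z l0; rewrite /gk /gam /= hornerC mul1r expr1 /gh.
set q := z / l.
have -> : - (q ^+ 2 / 4) = - (q ^+ 2 / 8) + - (q ^+ 2 / 8) by field.
rewrite expRD.
have h := HC q; rewrite hornerD hornerC hornerXn ger0_norm in h; last by rewrite addr_ge0// sqr_ge0.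
have e0 := expR_ge0 (- (q ^+ 2 / 8)).
have li0 : 0 <= l^-1 by rewrite invr_ge0 ltW.
move: h e0; move: (expR _) => e h e0.
rewrite (_ : l^-1 * (e * e) * _ = (l^-1 * e) * ((1 + q ^+ 2) * e)); last by ring.
rewrite [leRHS]mulrC ler_wpM2l ?mulr_ge0// (le_trans h)// lerDr//.
Qed.

Lemma gauss_rV_bound : exists2 C : R, 1 <= C & forall l x y, 0 < l ->
  gauss_rV l x y <= C * majorant l x y /\
  forall d i, 0 < d -> d <= `|y 0 i - x 0 i| ->
    gauss_rV l x y <= C * (l ^+ 2 / d ^+ 2) * majorant l x y.
Proof.
have [C C1 HC] := gk0_bound.
exists (C ^+ n); first by rewrite exprn_ege1.
move=> l x y l0.
have h1 i : gk 0 l (y 0 i - x 0 i) <= C * gh l (y 0 i - x 0 i).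
  apply: le_trans (HC l _ l0); rewrite ler_peMr ?gk0_ge0// lerDl sqr_ge0//.
have g0 i := gk0_ge0 (y 0 i - x 0 i) l0.
have CM : C ^+ n * majorant l x y = \prod_i (C * gh l (y 0 i - x 0 i)).
  by rewrite [RHS]big_split/= prodr_const card_ord.
split => [|d i d0 di].
  by rewrite CM; apply: ler_prod => i _; rewrite g0 h1.
rewrite mulrAC CM (bigD1 i)//= /gauss_rV (bigD1 i)//=.
rewrite [leRHS]mulrAC ler_pM//.
- by rewrite prodr_ge0.
- have h := HC l (y 0 i - x 0 i) l0.
  apply: le_trans (ler_wpM2r _ h); last by rewrite divr_ge0 ?sqr_ge0.
  rewrite -mulrA ler_peMr// ?g0//.
  rewrite (_ : (1 + ((y 0 i - x 0 i) / l) ^+ 2) * (l ^+ 2 / d ^+ 2) =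
     l ^+ 2 / d ^+ 2 + (y 0 i - x 0 i) ^+ 2 / d ^+ 2); last by field; rewrite !gt_eqF.
  have : 1 <= (y 0 i - x 0 i) ^+ 2 / d ^+ 2.
    rewrite ler_pdivlMr ?exprn_gt0// mul1r -[leRHS]real_normK ?num_real//.
    by rewrite lerXn2r ?nnegrE// ltW.
  have : 0 <= l ^+ 2 / d ^+ 2 by rewrite divr_ge0 ?sqr_ge0.
  by move=> *; lra.
- by apply: ler_prod => k _; rewrite g0 h1.
Qed.

Lemma integrable_gauss_mul l x (f : Rn -> R) M : 0 < l -> measurable_fun setT f ->
  (forall y, `|f y| <= M) -> mu.-integrable setT (EFin \o (fun y => f y * gauss_rV l x y)).
Proof.
move=> l0 mf fM.
have mg : measurable_fun setT (gauss_rV l x).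
  by apply: continuous_measurable_rV; exact: continuous_gauss_rV.
have g0 y : 0 <= gauss_rV l x y by rewrite prodr_ge0// => i _; exact: gk0_ge0.
apply/integrableP; split; first by apply/measurable_EFinP; exact: measurable_funM.
apply: (@le_lt_trans _ _ (\int[mu]_y ((M%:E * (gauss_rV l x y)%:E)))%E).
  apply: ge0_le_integral => //.
  - by apply/measurable_EFinP; apply: measurableT_comp => //; exact: measurable_funM.
  - by apply/measurable_EFinP; apply: measurable_funM.
  - by move=> y _; rewrite -EFinM lee_fin normrM (ger0_norm (g0 y)) ler_wpM2r.
have M0 : 0 <= M by rewrite (le_trans _ (fM 0)).
rewrite ge0_integralZl ?lee_fin//; [|exact/measurable_EFinP|by move=> y _; rewrite lee_fin].
by rewrite integral_gauss_rV// -EFinM ltry.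
Qed.

Lemma psi_nil r l x y : psi r l x [::] y =
  (\prod_i theta 0 (r^-1 * y 0 i)) * gauss_rV l x y.
Proof.
rewrite /psi /gauss_rV -big_split/=; apply: eq_bigr => i _.
by rewrite /dgauss /= /cutk expr0 mul1r mulrC [y 0 i / r]mulrC mulrC.
Qed.

Lemma theta0_itv (z : R) : 0 <= theta 0 z <= 1.
Proof.
rewrite /theta; case: ifPn => [z1|_]; last by rewrite lexx ler01.
have z2 : z ^+ 2 <= 1.
  by rewrite -real_normK ?num_real// -[leRHS](expr1n _ 2) lerXn2r ?nnegrE// ltW.
have E : (1 - 'X^2 : {poly R}).[z] = 1 - z ^+ 2 by rewrite !hornerE.
have z0 := sqr_ge0 z.
rewrite /cutp derivn0 horner_exp E exprn_ge0 ?subr_ge0//=.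
by rewrite exprn_ile1 ?subr_ge0// lerBlDr lerDl.
Qed.

Lemma approximate_identity (w : Rn -> R) M x eta : continuous w ->
  (forall y, `|w y| <= M) -> 0 < eta ->
  exists2 s0, 0 < s0 & exists2 r0, 0 < r0 & forall s r, 0 < s <= s0 -> r0 <= r ->
    `|\int[mu]_y (w y * psi r (Num.sqrt s) x [::] y) - gauss_mass ^+ n * w x| <= eta.
Proof.
move=> cw wM eta0.
have M0 : 0 <= M by rewrite (le_trans _ (wM 0)).
have M1 : 0 < 1 + M by rewrite ltr_pwDl.
have [C C1 HC] := gauss_rV_bound.
have C0 : 0 < C by rewrite (lt_le_trans _ C1).
set K := Num.sqrt (8 * pi) ^+ n : R.
have K0 : 0 < K by rewrite exprn_gt0// sqrtr_gt0 mulr_gt0// pi_gt0.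
pose e1 := eta / (2 * C * K).
have e10 : 0 < e1 by rewrite divr_gt0// !mulr_gt0.
(* The cutoff is parametrized by [q = 1 / r], so that large [r] becomes joint continuity at
   [(0, x)], where the cutoff equals 1. *)
pose Th (q : R) y := \prod_i theta 0 (q * y 0 i) : R.
have cTh : {for (0, x), continuous (fun z : R * Rn => w z.2 * Th z.1 z.2)}.
  apply: cvgM; first by apply: (@continuous_comp _ _ _ (fun z : R * Rn => z.2) w); [exact: cvg_snd|exact: cw].
  apply: continuous_prod => i.
  apply: (@continuous_comp _ _ _ (fun z : R * Rn => z.1 * z.2 0 i) (theta 0)); last exact: continuous_theta.
  apply: cvgM; first exact: cvg_fst.
  by apply: (@continuous_comp _ _ _ (fun z : R * Rn => z.2) (fun y : Rn => y 0 i)); [exact: cvg_snd|exact: continuous_coord].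
have Th0 : Th 0 x = 1 by rewrite /Th big1// => i _; rewrite mul0r theta0_0.
have Th01 q y : 0 <= Th q y <= 1.
  rewrite /Th; apply/andP; split; first by rewrite prodr_ge0// => i _; have /andP[] := theta0_itv (q * y 0 i).
  by rewrite prodr_ile1// => i _; exact: theta0_itv.
have [d d0 [q0 q00 Hd]] : exists2 d, 0 < d & exists2 q0, 0 < q0 & forall q y, `|q| < q0 ->
    (forall i, `|x 0 i - y 0 i| < d) -> `|w y * Th q y - w x| <= e1.
  move: cTh => /cvgrPdist_le /(_ _ e10) [[A B] /= [[q0 /= q00 hA] hB] hAB].
  have [d d0 hd] := nbhs_box hB.
  exists d => //; exists q0 => // q y qq hy.
  have := hAB (q, y); rewrite /= Th0 mulr1 distrC; apply; split => /=; last exact: hd.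
  by apply: hA; rewrite /= sub0r normrN.
(* For [s] up to this value the part at distance at least [d], bounded by [2 M C K s / d^2], is at
   most [eta / 2]; the near part is [e1 C K = eta / 2] by the choice of [e1]. *)
exists (eta * d ^+ 2 / (4 * C * K * (1 + M))).
  by rewrite divr_gt0// ?mulr_gt0// exprn_gt0.
exists (q0^-1 + 1); first by rewrite addr_gt0 ?invr_gt0.
move=> s r /andP[s0 ss0] rr0.
have r0 : 0 < r by rewrite (lt_le_trans _ rr0)// addr_gt0 ?invr_gt0.
set l := Num.sqrt s; have l0 : 0 < l by rewrite sqrtr_gt0.
have l2 : l ^+ 2 = s by rewrite sqr_sqrtr// ltW.
have qr : `|r^-1| < q0.
  rewrite gtr0_norm ?invr_gt0// -[q0]invrK ltf_pV2 ?posrE ?invr_gt0//.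
  by rewrite (lt_le_trans _ rr0)// ltrDl.
pose F y := (w y * Th r^-1 y - w x) * gauss_rV l x y.
have g0 y : 0 <= gauss_rV l x y by rewrite prodr_ge0// => i _; exact: gk0_ge0.
have cThr : continuous (Th r^-1).
  move=> y; apply: continuous_prod => i.
  apply: (@continuous_comp _ _ _ (fun y : Rn => r^-1 * y 0 i) (theta 0)); last exact: continuous_theta.
  apply: (@continuous_comp _ _ _ (fun y : Rn => y 0 i) (fun z : R => r^-1 * z)).
    exact: continuous_coord.
  exact: mulrl_continuous.
have mwT : measurable_fun setT (fun y => w y * Th r^-1 y).
  by apply: continuous_measurable_rV; exact: continuous_mul.
have wTM y : `|w y * Th r^-1 y| <= M.
  have /andP[h1 h2] := Th01 r^-1 y.
  by rewrite normrM (ger0_norm h1) (le_trans _ (wM y))// ler_piMr.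
have iF : mu.-integrable setT (EFin \o F).
  apply: (@integrable_gauss_mul _ _ _ (M + M)) => //; first exact: measurable_funB.
  by move=> y; rewrite (le_trans (ler_normB _ _))// lerD.
have -> : \int[mu]_y (w y * psi r l x [::] y) - gauss_mass ^+ n * w x = \int[mu]_y F y.
  have i1 : mu.-integrable setT (EFin \o (fun y => w y * Th r^-1 y * gauss_rV l x y)).
    exact: (@integrable_gauss_mul _ _ _ M).
  have i2 : mu.-integrable setT (EFin \o (fun y => w x * gauss_rV l x y)).
    exact: (@integrable_gauss_mul _ _ (fun _ => w x) M).
  rewrite /F; under [in RHS]eq_Rintegral do rewrite mulrBl.
  rewrite RintegralB//; congr (_ - _).
    by apply: eq_Rintegral => y _; rewrite psi_nil mulrA.
  rewrite /Rintegral; under [in RHS]eq_integral do rewrite EFinM.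
  rewrite integralZl//; last first.
    have := @integrable_gauss_mul l x (fun _ => 1) 1 l0 _ _.
    rewrite (_ : (fun y => 1 * gauss_rV l x y) = gauss_rV l x); last by apply/funext => y; rewrite mul1r.
    by apply => // y; rewrite normr1.
  by rewrite integral_gauss_rV//= mulrC.
apply: (le_trans (le_normr_Rintegral measurableT iF)).
have iFn : mu.-integrable setT (EFin \o (fun y => `|F y|)) by exact: integrable_norm iF.
rewrite -lee_fin /Rintegral fineK; last exact: integrable_fin_num iFn.
pose B := e1 * C + 2 * M * (C * (l ^+ 2 / d ^+ 2)).
have ld0 : 0 <= l ^+ 2 / d ^+ 2 by rewrite divr_ge0 ?sqr_ge0.
have E0 : 0 <= e1 * C := mulr_ge0 (ltW e10) (ltW C0).
have D0 : 0 <= 2 * M * (C * (l ^+ 2 / d ^+ 2)) :=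
  mulr_ge0 (mulr_ge0 (ler0n R 2) M0) (mulr_ge0 (ltW C0) ld0).
have B0 : 0 <= B := addr_ge0 E0 D0.
apply: (@le_trans _ _ (\int[mu]_y (B%:E * (majorant l x y)%:E))%E).
  have maj0 y : 0 <= majorant l x y by exact: majorant_ge0.
  apply: ge0_le_integral => //.
  - by case/integrableP : iFn.
  - by apply/measurable_EFinP; apply: measurable_funM => //; exact: measurable_majorant.
  move=> y _; rewrite -EFinM lee_fin /F normrM (ger0_norm (g0 y)).
  have [h1 h2] := HC l x y l0.
  have [hy|hy] := pselect (forall i, `|x 0 i - y 0 i| < d).
    apply: (@le_trans _ _ (e1 * (C * majorant l x y))).
      by rewrite ler_pM// Hd.
    by rewrite mulrA ler_wpM2r// lerDl.
  have [i hi] : exists i, d <= `|y 0 i - x 0 i|.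
    apply: contrapT => h; apply: hy => i; rewrite ltNge; apply/negP => hi.
    by apply: h; exists i; rewrite distrC.
  apply: (@le_trans _ _ (2 * M * (C * (l ^+ 2 / d ^+ 2) * majorant l x y))).
    rewrite ler_pM//; last exact: h2 hi.
    by rewrite (le_trans (ler_normB _ _))// mulr_natl mulr2n lerD.
  by rewrite mulrA ler_wpM2r// lerDr.
rewrite ge0_integralZl//.
- rewrite integral_majorant// -EFinM lee_fin -/K /B.
  have E1 : e1 * C * K = eta / 2 by rewrite /e1; field; rewrite !gt_eqF.
  have E2 : 2 * M * (C * (l ^+ 2 / d ^+ 2)) * K <= eta / 2.
    rewrite l2; apply: (@le_trans _ _ (2 * (1 + M) * (C * (eta * d ^+ 2 / (4 * C * K * (1 + M)) / d ^+ 2)) * K)).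
      rewrite ler_wpM2r ?(ltW K0)// ler_pM//.
      + by rewrite mulr_ge0.
      + by rewrite mulr_ge0 ?(ltW C0)// divr_ge0 ?ltW// exprn_gt0.
      + by rewrite ler_wpM2l// lerDr.
      + by rewrite ler_wpM2l ?(ltW C0)// ler_wpM2r// invr_ge0 sqr_ge0.
    rewrite le_eqVlt; apply/orP; left; apply/eqP.
    by field; rewrite !gt_eqF.
  by rewrite mulrDl E1; lra.
- by apply/measurable_EFinP; exact: measurable_majorant.
- by move=> y _; rewrite lee_fin majorant_ge0.
Qed.

End approximate_identity.

(** * The core estimate *)

Section core.
Context {R : realType} {n : nat}.
Local Notation Rn := 'rV[R]_n.
Local Notation mu := (@lebesgue_rV R n).
Implicit Types (r l a b c e N s t u : R) (x y : Rn).

Lemma is_derive_powR_shift (t0 q u : R) : t0 < u ->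
  is_derive u 1 (fun u => (u - t0) `^ q) (q * (u - t0) `^ (q - 1)).
Proof.
move=> tu; have d1 : is_derive u 1 (fun u => u - t0) 1.
  have h := is_deriveB (is_derive_id u (1 : R)) (is_derive_cst t0 u (1 : R)).
  by apply: (is_derive_eq h); rewrite subr0.
have u0 : 0 < u - t0 by rewrite subr_gt0.
have d2 := @is_derive1_powR _ q (u - t0) u0.
have h := @is_derive1_comp _ (fun z => z `^ q) (fun u => u - t0) _ _ _ d2 d1.
by apply: (is_derive_eq h); rewrite mulr1.
Qed.

Lemma is_derive_sqrt_inv c u : u < c ->
  is_derive u 1 (fun u => 2 / Num.sqrt (c - u)) ((Num.sqrt (c - u))^-1 ^+ 3).
Proof.
move=> uc; have cu0 : 0 < c - u by rewrite subr_gt0.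
have d1 : is_derive u 1 (fun u => c - u) (-1).
  have h := is_deriveB (is_derive_cst c u (1 : R)) (is_derive_id u (1 : R)).
  by apply: (is_derive_eq h); rewrite sub0r.
have d2 := is_derive1_sqrt cu0.
have d3 := @is_derive1_comp _ Num.sqrt (fun u => c - u) _ _ _ d2 d1.
have l0 : 0 < Num.sqrt (c - u) by rewrite sqrtr_gt0.
have d4 := @is_deriveV _ (fun u => Num.sqrt (c - u)) u _ 1 (lt0r_neq0 l0) d3.
have d5 := @is_deriveZ _ _ _ _ 2 _ _ _ d4.
by apply: (is_derive_eq d5); rewrite /GRing.scale/=; field; rewrite gt_eqF.
Qed.

Lemma is_derive_inv_sqrt_shift (h s : R) : 0 < h + s ->
  is_derive s 1 (fun s => (Num.sqrt (h + s))^-1) (- (2^-1 * (Num.sqrt (h + s))^-1 ^+ 3)).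
Proof.
move=> hs0.
have d1 : is_derive s 1 (fun s => h + s) 1.
  have k := is_deriveD (is_derive_cst h s (1 : R)) (is_derive_id s (1 : R)).
  by apply: (is_derive_eq k); rewrite add0r.
have d2 := is_derive1_sqrt hs0.
have d3 := @is_derive1_comp _ Num.sqrt (fun s => h + s) _ _ _ d2 d1.
have l0 : 0 < Num.sqrt (h + s) by rewrite sqrtr_gt0.
have d4 := @is_deriveV _ (fun s => Num.sqrt (h + s)) s _ 1 (lt0r_neq0 l0) d3.
by apply: (is_derive_eq d4); rewrite /GRing.scale/=; field; rewrite gt_eqF.
Qed.

Lemma is_derive_sqrt_shift (h s : R) : 0 < h + s ->
  is_derive s 1 (fun s => Num.sqrt (h + s)) (2^-1 * (Num.sqrt (h + s))^-1).
Proof.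
move=> hs0.
have d1 : is_derive s 1 (fun s => h + s) 1.
  have k := is_deriveD (is_derive_cst h s (1 : R)) (is_derive_id s (1 : R)).
  by apply: (is_derive_eq k); rewrite add0r.
have d2 := is_derive1_sqrt hs0.
have d3 := @is_derive1_comp _ Num.sqrt (fun s => h + s) _ _ _ d2 d1.
by apply: (is_derive_eq d3); rewrite mulr1 invfM.
Qed.

Section two_flows.
Variables (k0 : 'I_n) (a : R).
Hypothesis a01 : 0 < a < 1.
Variables (t0 b : R) (U Ut V Vt : 'I_n -> R -> Rn -> R)
  (dU d2U dV d2V : 'I_n -> 'I_n -> R -> Rn -> R)
  (P Q : R -> Rn -> R) (dP dQ : 'I_n -> R -> Rn -> R).
Hypotheses (fU : flow t0 b U Ut dU d2U P dP) (fV : flow t0 b V Vt dV d2V Q dQ).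
Variables (e N : R).
Hypotheses (e0 : 0 <= e) (N0 : 0 <= N).
Hypothesis Ue : forall i t y, t0 < t < b -> `|U i t y| <= e * (t - t0) `^ (- 2^-1).
Hypothesis Ve : forall i t y, t0 < t < b -> `|V i t y| <= e * (t - t0) `^ (- 2^-1).
Hypothesis UV : forall i t y, t0 < t < b -> y 0 k0 != 0 ->
  `|U i t y - V i t y| <= N * (t - t0) `^ (- ((1 - a) / 2)) * pw a (y 0 k0).

(** The Gaussian has time [c - t]: up to the cutoff it solves the backward heat equation in [t], and
    it becomes singular at [t = c]. *)
Definition lap_pairing r c x j t : R :=
  \int[mu]_y ((U j t y - V j t y) * lap_psi r (Num.sqrt (c - t)) x y).

Hypothesis initial : forall r c x j, 0 < r -> t0 < c ->
  lap_pairing r c x j t @[t --> t0^'+] --> 0.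

Let cU j t : t0 < t < b -> continuous (U j t).
Proof. exact: flow_cV_space fU j t. Qed.

Let cV j t : t0 < t < b -> continuous (V j t).
Proof. exact: flow_cV_space fV j t. Qed.

Let cUV j t : t0 < t < b -> continuous (fun y => U j t y - V j t y).
Proof. by move=> tb; apply: continuous_sub; [exact: cU|exact: cV]. Qed.

Lemma is_derive_lap_pairing r c x j t : 0 < r -> t0 < t < b -> t < c ->
  is_derive t 1 (lap_pairing r c x j)
    (flow_rate U r (Num.sqrt (c - t)) x j t - flow_rate V r (Num.sqrt (c - t)) x j t).
Proof.
move=> r0 tb tc; have /andP[t0t tb'] := tb.
have d := is_deriveB (is_derive_lap fU x j r0 tb tc) (is_derive_lap fV x j r0 tb tc).
apply: near_eq_is_derive d.
have : \forall u \near t, t0 < u < Num.min b c.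
  have : t \in `]t0, (Num.min b c)[ by rewrite in_itv/= t0t lt_min tb' tc.
  by move=> /near_in_itvoo; apply: filterS => u; rewrite in_itv.
apply: filterS => u; rewrite lt_min => /and3P[au ub uc].
have uab : t0 < u < b by rewrite au.
have l0 : 0 < Num.sqrt (c - u) by rewrite sqrtr_gt0 subr_gt0.
rewrite /lap_pairing !fctE (@RintegralB_mul _ _ r)//.
- exact: cU.
- exact: cV.
- exact: continuous_lap_psi.
- exact: vanish_lap_psi.
Qed.

Section rate.
Variable C : R.
Hypothesis C0 : 0 < C.
Hypothesis HC : forall (U V : 'I_n -> R -> Rn -> R) t e N r l x j,
    (forall i, continuous (U i t)) -> (forall i, continuous (V i t)) ->
    0 < l <= r -> 0 <= e -> 0 <= N -> x 0 k0 != 0 ->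
    (forall i y, `|U i t y| <= e) -> (forall i y, `|V i t y| <= e) ->
    (forall i y, y 0 k0 != 0 -> `|U i t y - V i t y| <= N * pw a (y 0 k0)) ->
    `|flow_rate U r l x j t - flow_rate V r l x j t| <=
       C * e * l^-1 ^+ 3 * (N * pw a (x 0 k0) + r^-1).

(** The exponent [a / 2 - 1] is the sum of [- 1 / 2] and [- (1 - a) / 2]; it exceeds [-1] because
    [a > 0]. The condition on [r] keeps the width of the Gaussian below the cutoff radius. *)
Lemma lap_rate_le r c x j u : 0 < r -> t0 < u < b -> u < c -> c - u <= r ^+ 2 -> x 0 k0 != 0 ->
  `|flow_rate U r (Num.sqrt (c - u)) x j u - flow_rate V r (Num.sqrt (c - u)) x j u| <=
  (Num.sqrt (c - u))^-1 ^+ 3 * (C * e * N * pw a (x 0 k0) * (u - t0) `^ (a / 2 - 1) +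
     C * e * r^-1 * (u - t0) `^ (- 2^-1)).
Proof.
move=> r0 ub uc cur xk; have /andP[t0u _] := ub.
have u0 : 0 < u - t0 by rewrite subr_gt0.
have l0 : 0 < Num.sqrt (c - u) by rewrite sqrtr_gt0 subr_gt0.
have lr : Num.sqrt (c - u) <= r.
  by rewrite -(ger0_norm (ltW r0)) -sqrtr_sqr ler_wsqrtr.
have := @HC U V u (e * (u - t0) `^ (- 2^-1)) (N * (u - t0) `^ (- ((1 - a) / 2))) r
  (Num.sqrt (c - u)) x j.
move=> /(_ _ _ _ _ _ xk _ _ _)/le_trans; apply => //.
- by move=> i; exact: cU.
- by move=> i; exact: cV.
- by rewrite l0.
- by rewrite mulr_ge0// powR_ge0.
- by rewrite mulr_ge0// powR_ge0.
- by move=> i y; exact: Ue.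
- by move=> i y; exact: Ve.
- by move=> i y yk; exact: UV.
have -> : (u - t0) `^ (a / 2 - 1) = (u - t0) `^ (- 2^-1) * (u - t0) `^ (- ((1 - a) / 2)).
  rewrite -powRD; first by congr (_ `^ _); field.
  by rewrite (gt_eqF u0) implybT.
by rewrite le_eqVlt; apply/orP; left; apply/eqP; ring.
Qed.

(* The two halves of ]t0, t] are compared with different antiderivatives: the heat
   kernel is singular at t only, the nonlinear term at t0 only. *)
Lemma lap_pairing_le r s x j t h A1 A2 : h = (t - t0) / 2 ->
  A1 = C * e * N * pw a (x 0 k0) -> A2 = C * e * r^-1 -> 0 < r -> 0 < s -> t0 < t < b ->
  t + s - t0 <= r ^+ 2 -> x 0 k0 != 0 ->
  `|lap_pairing r (t + s) x j t| <=
    A1 * (2 / a * h `^ (a / 2) * (Num.sqrt (h + s))^-1 ^+ 3 +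
          2 * h `^ (a / 2 - 1) * ((Num.sqrt s)^-1 - (Num.sqrt (h + s))^-1)) +
    A2 * (2 * h `^ 2^-1 * (Num.sqrt (h + s))^-1 ^+ 3 +
          2 * h `^ (- 2^-1) * ((Num.sqrt s)^-1 - (Num.sqrt (h + s))^-1)).
Proof.
move=> hE A1E A2E r0 s0 tb tsr xk; have /andP[t0t tb'] := tb.
have /andP[a0 a1] := a01.
have h0 : 0 < h by rewrite hE divr_gt0// subr_gt0.
pose c := t + s; pose m := t0 + h.
have t0m : t0 < m by rewrite ltrDl.
have mt : m < t by rewrite /m hE; lra.
have cm : c - m = h + s by rewrite /c /m hE; field.
have ct : c - t = s by rewrite /c addrAC subrr add0r.
have mt0 : m - t0 = h by rewrite /m addrAC subrr add0r.
have A10 : 0 <= A1 by rewrite A1E !mulr_ge0 ?pw_ge0 ?(ltW C0).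
have A20 : 0 <= A2 by rewrite A2E !mulr_ge0 ?invr_ge0 ?(ltW C0) ?(ltW r0).
set la := Num.sqrt (h + s).
have la0 : 0 < la by rewrite sqrtr_gt0 addr_gt0.
have rate u : t0 < u <= t -> `|flow_rate U r (Num.sqrt (c - u)) x j u - flow_rate V r (Num.sqrt (c - u)) x j u| <=
    (Num.sqrt (c - u))^-1 ^+ 3 * (A1 * (u - t0) `^ (a / 2 - 1) + A2 * (u - t0) `^ (- 2^-1)).
  move=> /andP[t0u ut]; rewrite A1E A2E; apply: lap_rate_le => //.
  - by rewrite t0u (le_lt_trans ut).
  - by rewrite (le_lt_trans ut)// ltrDl.
  - by apply: le_trans tsr; rewrite lerD2l lerN2 ltW.
have sm u : t0 < u -> 0 <= A1 * (u - t0) `^ (a / 2 - 1) + A2 * (u - t0) `^ (- 2^-1).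
  by move=> _; rewrite addr_ge0// mulr_ge0// powR_ge0.
have early u : t0 < u <= m -> `|lap_pairing r c x j m - lap_pairing r c x j u| <=
    la^-1 ^+ 3 * (A1 * (2 / a * h `^ (a / 2)) + A2 * (2 * h `^ 2^-1)).
  move=> /andP[t0u um].
  pose g z := la^-1 ^+ 3 * (A1 * (2 / a * (z - t0) `^ (a / 2)) + A2 * (2 * (z - t0) `^ 2^-1)).
  pose dg z := la^-1 ^+ 3 * (A1 * (z - t0) `^ (a / 2 - 1) + A2 * (z - t0) `^ (- 2^-1)).
  have := @derivative_comparison R (lap_pairing r c x j) _ g dg u m um _ _ _.
  move=> /(_ (fun u => flow_rate U r (Num.sqrt (c - u)) x j u - flow_rate V r (Num.sqrt (c - u)) x j u)).
  move=> H; apply: le_trans (H _ _ _) _.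
  - move=> z /andP[uz zm]; apply: is_derive_lap_pairing => //.
      by rewrite (lt_le_trans t0u uz) (le_lt_trans zm)// (lt_trans mt).
    by rewrite (le_lt_trans zm)// (lt_trans mt)// ltrDl.
  - move=> z /andP[uz zm]; have t0z := lt_le_trans t0u uz.
    have d1 := @is_deriveZ _ _ _ _ (A1 * (2 / a)) _ _ _ (is_derive_powR_shift (a / 2) t0z).
    have d2 := @is_deriveZ _ _ _ _ (A2 * 2) _ _ _ (is_derive_powR_shift 2^-1 t0z).
    have d3 := @is_deriveZ _ _ _ _ (la^-1 ^+ 3) _ _ _ (is_deriveD d1 d2).
    have -> : g = la^-1 ^+ 3 \*: ((A1 * (2 / a)) \*: (fun u => (u - t0) `^ (a / 2)) +
      (A2 * 2) \*: (fun u => (u - t0) `^ 2^-1)).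
      by apply/funext => w; rewrite /g /GRing.scale/= !fctE !mulrA.
    apply: (is_derive_eq d3); rewrite /dg /GRing.scale/=.
    rewrite (_ : 2^-1 - 1 = - 2^-1 :> R); last by field.
    by field; rewrite !gt_eqF.
  - move=> z /andP[uz zm]; have t0z := lt_le_trans t0u uz.
    apply: le_trans (rate z _) _; first by rewrite t0z (le_trans zm)// ltW.
    rewrite /dg ler_wpM2r ?sm// lerXn2r ?nnegrE ?invr_ge0 ?sqrtr_ge0//.
    rewrite lef_pV2 ?posrE//.
      by rewrite ler_wsqrtr// -cm lerD2l lerN2.
    by rewrite sqrtr_gt0 subr_gt0 (le_lt_trans zm)// (lt_trans mt)// ltrDl.
  rewrite /g mt0 gerBl mulr_ge0 ?exprn_ge0 ?invr_ge0 ?(ltW la0)//.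
  by rewrite addr_ge0// mulr_ge0// mulr_ge0 ?powR_ge0// divr_ge0// ltW.
(* The early estimate is uniform in its left endpoint, which tends to [t0]; the initial condition
   removes the pairing there. *)
have Pm : `|lap_pairing r c x j m| <=
    la^-1 ^+ 3 * (A1 * (2 / a * h `^ (a / 2)) + A2 * (2 * h `^ 2^-1)).
  have t0c : t0 < c by rewrite (lt_trans t0t)// ltrDl.
  have ini := @initial r c x j r0 t0c.
  have lim : `|lap_pairing r c x j m - lap_pairing r c x j u| @[u --> t0^'+] --> `|lap_pairing r c x j m - 0|.
    by apply: cvg_norm; apply: cvgB => //; exact: cvg_cst.
  rewrite subr0 in lim; apply: (cvgr_to_le lim).
  have : \forall u \near t0^'+, t0 < u < m.
    by apply: filterS2 (nbhs_right_gt t0) (nbhs_right_lt t0m) => u -> ->.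
  by apply: filterS => u /andP[h1 h2]; apply: early; rewrite h1 ltW.
have late : `|lap_pairing r c x j t - lap_pairing r c x j m| <=
    (A1 * h `^ (a / 2 - 1) + A2 * h `^ (- 2^-1)) * (2 / Num.sqrt s) -
    (A1 * h `^ (a / 2 - 1) + A2 * h `^ (- 2^-1)) * (2 / la).
  have [S SE] : exists S, S = A1 * h `^ (a / 2 - 1) + A2 * h `^ (- 2^-1) by eexists.
  rewrite -SE; pose g z := S * (2 / Num.sqrt (c - z)).
  have -> : S * (2 / Num.sqrt s) - S * (2 / la) = g t - g m by rewrite /g ct cm.
  apply: (@derivative_comparison R _ (fun u => flow_rate U r (Num.sqrt (c - u)) x j u - flow_rate V r (Num.sqrt (c - u)) x j u)
    g (fun z => S * (Num.sqrt (c - z))^-1 ^+ 3)); first exact: ltW.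
  - move=> z /andP[mz zt]; apply: is_derive_lap_pairing => //.
      by rewrite (lt_le_trans t0m mz) (le_lt_trans zt).
    by rewrite (le_lt_trans zt)// ltrDl.
  - move=> z /andP[mz zt].
    have zc : z < c by rewrite (le_lt_trans zt)// ltrDl.
    exact: (@is_deriveZ _ _ _ _ S _ _ _ (is_derive_sqrt_inv zc)).
  - move=> z /andP[mz zt]; have t0z := lt_le_trans t0m mz.
    apply: le_trans (rate z _) _; first by rewrite t0z.
    rewrite [leLHS]mulrC ler_wpM2r ?exprn_ge0 ?invr_ge0 ?sqrtr_ge0//.
    have hz : h <= z - t0 by rewrite -mt0 lerD2r.
    have pdec q : 0 <= q -> (z - t0) `^ (- q) <= h `^ (- q).
      move=> q0; rewrite !powRN lef_pV2 ?posrE ?powR_gt0 ?subr_gt0//.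
      by rewrite ge0_ler_powR ?nnegrE ?(ltW h0)// subr_ge0 ltW.
    have aE : a / 2 - 1 = - (1 - a / 2) by ring.
    have a2 : 0 <= 1 - a / 2 by rewrite subr_ge0 ler_pdivrMr// mul1r (le_trans (ltW a1))// ler1n.
    have p1 := ler_wpM2l A10 (pdec _ a2); rewrite -aE in p1.
    have i2 : 0 <= 2^-1 :> R by rewrite invr_ge0.
    by rewrite SE; exact: lerD p1 (ler_wpM2l A20 (pdec _ i2)).
rewrite -/c -/la.
have -> : lap_pairing r c x j t = (lap_pairing r c x j t - lap_pairing r c x j m) + lap_pairing r c x j m by rewrite subrK.
apply: (le_trans (ler_normD _ _)); apply: (le_trans (lerD late Pm)).
by rewrite le_eqVlt; apply/orP; left; apply/eqP; ring.
Qed.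

Variables (Cp Pc : R).
Hypotheses (Cp0 : 0 < Cp) (Pc0 : 0 < Pc).
Hypothesis HCp : forall r l x (f phi : Rn -> R) (M B : R), 0 < l -> 0 <= M -> 0 <= B ->
    continuous f -> continuous phi -> vanish r phi ->
    (forall y, `|phi y| <= B * majorant l x y) ->
    ((forall y, `|f y| <= M) -> `|\int[mu]_y (f y * phi y)| <= Cp * M * B) /\
    ((forall y, y 0 k0 != 0 -> `|f y| <= M * pw a (y 0 k0)) ->
      (x 0 k0 != 0 -> `|\int[mu]_y (f y * phi y)| <= Cp * M * B * pw a (x 0 k0)) /\
      `|\int[mu]_y (f y * phi y)| <= Cp * M * B * l `^ (- a)).
Hypothesis HP : forall r l x (s : seq 'I_n) y, (size s <= 4)%N -> 0 < l <= r ->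
  [/\ `|psi r l x s y| <= Pc * l^-1 ^+ size s * majorant l x y,
      `|psi_t r l x s y| <= Pc * l^-1 ^+ (size s).+2 * majorant l x y &
      `|\sum_k psi r l x (k :: k :: s) y - psi_t r l x s y| <=
        Pc * (r^-1 * l^-1 ^+ (size s).+1) * majorant l x y].

Variables (j : 'I_n) (t : R) (x : Rn).
Hypotheses (tb : t0 < t < b) (xk : x 0 k0 != 0).

Let w y := U j t y - V j t y.
Let L := t - t0.
Let h := L / 2.
Let A1 := C * e * N * pw a (x 0 k0).
Let M := 2 * e * L `^ (- 2^-1).

Let L0 : 0 < L. Proof. by rewrite subr_gt0; case/andP : tb. Qed.
Let h0 : 0 < h. Proof. by rewrite divr_gt0. Qed.
Let M0 : 0 <= M. Proof. by rewrite !mulr_ge0 ?powR_ge0. Qed.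
Let A10 : 0 <= A1. Proof. by rewrite !mulr_ge0 ?pw_ge0// ltW. Qed.
Let cw : continuous w.
Proof. by apply: continuous_sub; [exact: flow_cV_space fU j t tb|exact: flow_cV_space fV j t tb]. Qed.
Let wM y : `|w y| <= M.
Proof.
by rewrite (le_trans (ler_normB _ _))//; have := Ue j y tb; have := Ve j y tb; rewrite /M -/L; lra.
Qed.

(** The cut-off heat extension of [w] at [x] and heat time [s], up to normalization. The real time
    [t] stays fixed from here on. *)
Let H r s : R := \int[mu]_y (w y * psi r (Num.sqrt s) x [::] y).
Let dH r s : R := \int[mu]_y (w y * psi_t r (Num.sqrt s) x [::] y).

Let is_derive_H r s : 0 < r -> 0 < s -> is_derive s 1 (H r) (dH r s).
Proof. by move=> r0 s0; exact: is_derive_scale. Qed.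

(** Up to the cutoff defect, the [s]-derivative of the extension is its Laplacian; the Gaussian time
    [c - t] equals [s] for [c = t + s]. *)
Let dHE r s : 0 < r -> 0 < s -> dH r s = lap_pairing r (t + s) x j t -
  \int[mu]_y (w y * defect r (Num.sqrt s) x [::] y).
Proof.
move=> r0 s0; have l0 : 0 < Num.sqrt s by rewrite sqrtr_gt0.
rewrite Rintegral_defect// /lap_pairing [t + s]addrC addrK.
rewrite /lap_psi (@Rintegral_mul_sum _ _ _ _ r)//; last 2 first.
- by move=> k; exact: continuous_psi_space.
- by move=> k; exact: vanish_psi.
by rewrite opprB addrC subrK.
Qed.

Let defect_le r s : 0 < r -> 0 < s -> s <= r ^+ 2 ->
  `|\int[mu]_y (w y * defect r (Num.sqrt s) x [::] y)| <=
  Cp * M * (Pc * (r^-1 * (Num.sqrt s)^-1)).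
Proof.
move=> r0 s0 sr; have l0 : 0 < Num.sqrt s by rewrite sqrtr_gt0.
have lr : Num.sqrt s <= r by rewrite -(ger0_norm (ltW r0)) -sqrtr_sqr ler_wsqrtr.
have B0 : 0 <= Pc * (r^-1 * (Num.sqrt s)^-1).
  by rewrite !mulr_ge0 ?invr_ge0 ?(ltW Pc0) ?(ltW r0) ?(ltW l0).
have c1 : continuous (defect r (Num.sqrt s) x [::]) by exact: continuous_defect.
have bd y : `|defect r (Num.sqrt s) x [::] y| <= Pc * (r^-1 * (Num.sqrt s)^-1) * majorant (Num.sqrt s) x y.
  have lrr : 0 < Num.sqrt s <= r by rewrite l0.
  by have [_ _] := HP x y (s := [::]) isT lrr; rewrite expr1.
have [+ _] := HCp l0 M0 B0 cw c1 (@vanish_defect _ _ r _ x [::] r0) bd.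
exact.
Qed.

(** All cutoff errors are collected in [D * r^-1]. The [D] found here grows as [s1] tends to 0, so
    [r] has to be chosen after [s1]. *)
Let growth s1 : 0 < s1 -> exists2 D, 0 <= D & forall r s, 0 < r -> s1 <= s -> L + s <= r ^+ 2 ->
  `|dH r s| <= A1 * (2 / a * h `^ (a / 2) * (Num.sqrt (h + s))^-1 ^+ 3 +
          2 * h `^ (a / 2 - 1) * ((Num.sqrt s)^-1 - (Num.sqrt (h + s))^-1)) + D * r^-1.
Proof.
move=> s10; set l1 := (Num.sqrt s1)^-1.
have l10 : 0 <= l1 by rewrite invr_ge0 sqrtr_ge0.
have p1 : 0 <= 2 * h `^ 2^-1 by rewrite mulr_ge0 ?powR_ge0.
have p2 : 0 <= 2 * h `^ (- 2^-1) by rewrite mulr_ge0 ?powR_ge0.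
have q0 : 0 <= C * e * (2 * h `^ 2^-1 * l1 ^+ 3 + 2 * h `^ (- 2^-1) * l1).
  by rewrite mulr_ge0 ?(mulr_ge0 (ltW C0) e0)// addr_ge0// mulr_ge0// exprn_ge0.
have q1 : 0 <= Cp * M * (Pc * l1) by rewrite (mulr_ge0 (mulr_ge0 (ltW Cp0) M0) (mulr_ge0 (ltW Pc0) l10)).
exists (C * e * (2 * h `^ 2^-1 * l1 ^+ 3 + 2 * h `^ (- 2^-1) * l1) + Cp * M * (Pc * l1)).
  exact: addr_ge0.
move=> r s r0 ss Lsr; have s0 := lt_le_trans s10 ss.
have sl : (Num.sqrt s)^-1 <= l1 by rewrite lef_pV2 ?posrE ?sqrtr_gt0// ler_wsqrtr.
have hl : (Num.sqrt (h + s))^-1 <= l1.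
  rewrite lef_pV2 ?posrE ?sqrtr_gt0 ?addr_gt0// ler_wsqrtr// (le_trans ss)// lerDr ltW//.
have ri0 : 0 <= r^-1 by rewrite invr_ge0 ltW.
rewrite dHE//; apply: (le_trans (ler_normB _ _)).
have sr : s <= r ^+ 2 by rewrite (le_trans _ Lsr)// lerDr ltW.
have Lsr' : t + s - t0 <= r ^+ 2 by rewrite addrAC.
have d := defect_le r0 s0 sr.
have lp := lap_pairing_le j erefl erefl erefl r0 s0 tb Lsr' xk.
apply: (le_trans (lerD lp d)); rewrite -/L -/h -/A1 -addrA lerD2l [X in _ <= X]mulrC [X in _ <= X]mulrDr.
apply: lerD.
  rewrite (_ : C * e * r^-1 * _ = r^-1 * (C * e * (2 * h `^ 2^-1 * (Num.sqrt (h + s))^-1 ^+ 3 +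
     2 * h `^ (- 2^-1) * ((Num.sqrt s)^-1 - (Num.sqrt (h + s))^-1)))); last by ring.
  rewrite ler_wpM2l// ler_wpM2l ?mulr_ge0 ?(ltW C0)// lerD// ler_wpM2l//.
    by rewrite lerXn2r// nnegrE invr_ge0 sqrtr_ge0.
  by rewrite (le_trans _ sl)// gerBl invr_ge0 sqrtr_ge0.
rewrite (_ : Cp * M * (Pc * (r^-1 * _)) = r^-1 * (Cp * M * (Pc * (Num.sqrt s)^-1))); last by ring.
exact: (ler_wpM2l ri0 (ler_wpM2l (mulr_ge0 (ltW Cp0) M0) (ler_wpM2l (ltW Pc0) sl))).
Qed.

(** The scaling balance: both halves of the time interval give the power of time that hypothesis
    [UV] started from. *)
Let powR_kappa : h `^ (a / 2) * (Num.sqrt h)^-1 = h `^ (- ((1 - a) / 2)) /\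
  h `^ (a / 2 - 1) * Num.sqrt h = h `^ (- ((1 - a) / 2)).
Proof.
have E q r : h `^ q * h `^ r = h `^ (q + r) by rewrite powRD// (gt_eqF h0) implybT.
rewrite -!powR12_sqrt ?(ltW h0)// -powRN !E.
by split; congr (_ `^ _); field.
Qed.

(** The inverse root [s^(-1/2)] is not integrable at infinity, but its difference with
    [(h + s)^(-1/2)] is, with integral at most [2 sqrt h]. Hence the main term depends on neither
    [s1] nor [s2]. *)
Let scale_increment s1 : 0 < s1 -> exists2 D, 0 <= D & forall r s2, 0 < r -> s1 <= s2 -> L + s2 <= r ^+ 2 ->
  `|H r s2 - H r s1| <= A1 * ((4 / a + 4) * h `^ (- ((1 - a) / 2))) + D * r^-1 * (s2 - s1).
Proof.
move=> s10; have [D D0 HD] := growth s10; exists D => // r s2 r0 s12 Lsr.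
have /andP[a0 a1] := a01.
(* An antiderivative of the bound in [growth]; [0 + s] lets one derivative lemma serve both
   roots. *)
pose g s := A1 * (2 / a * h `^ (a / 2)) * (- 2 * (Num.sqrt (h + s))^-1) +
  A1 * (2 * h `^ (a / 2 - 1)) * (2 * (Num.sqrt (0 + s) - Num.sqrt (h + s))) + D * r^-1 * s.
apply: (@le_trans _ _ (g s2 - g s1)).
  pose dg s := A1 * (2 / a * h `^ (a / 2) * (Num.sqrt (h + s))^-1 ^+ 3 +
          2 * h `^ (a / 2 - 1) * ((Num.sqrt s)^-1 - (Num.sqrt (h + s))^-1)) + D * r^-1.
  have := @derivative_comparison R (H r) (dH r) g dg s1 s2 s12; apply.
  - by move=> s /andP[ss _]; apply: is_derive_H => //; exact: lt_le_trans ss.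
  - move=> s /andP[ss _]; have s0 := lt_le_trans s10 ss.
    have hs0 : 0 < h + s by rewrite addr_gt0.
    have s00 : 0 < 0 + s by rewrite add0r.
    have d1 := @is_deriveZ _ _ _ _ (- 2) _ _ _ (is_derive_inv_sqrt_shift hs0).
    have d2 := @is_deriveZ _ _ _ _ (A1 * (2 / a * h `^ (a / 2))) _ _ _ d1.
    have d3 := is_deriveB (is_derive_sqrt_shift s00) (is_derive_sqrt_shift hs0).
    have d4 := @is_deriveZ _ _ _ _ 2 _ _ _ d3.
    have d5 := @is_deriveZ _ _ _ _ (A1 * (2 * h `^ (a / 2 - 1))) _ _ _ d4.
    have d6 := @is_deriveZ _ _ _ _ (D * r^-1) _ _ _ (is_derive_id s (1 : R)).
    have d7 := is_deriveD (is_deriveD d2 d5) d6.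
    have -> : g = A1 * (2 / a * h `^ (a / 2)) \*: (- 2 \*: (fun s => (Num.sqrt (h + s))^-1)) +
      A1 * (2 * h `^ (a / 2 - 1)) \*: (2 \*: ((fun s => Num.sqrt (0 + s)) - (fun s => Num.sqrt (h + s)))) +
      D * r^-1 \*: id by [].
    apply: (is_derive_eq d7); rewrite /dg /GRing.scale/= add0r.
    move: (h `^ (a / 2)) (h `^ (a / 2 - 1)) (Num.sqrt s)^-1 (Num.sqrt (h + s))^-1 => z1 z2 z3 z4.
    by field; rewrite !gt_eqF.
  - move=> s /andP[ss s2s]; apply: HD => //.
    by rewrite (le_trans _ Lsr)// lerD2l.
have s20 := lt_le_trans s10 s12.
have sq0 : 0 < Num.sqrt h by rewrite sqrtr_gt0.
have e1 : 0 <= (Num.sqrt (h + s2))^-1 by rewrite invr_ge0 sqrtr_ge0.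
have e2 : (Num.sqrt (h + s1))^-1 <= (Num.sqrt h)^-1.
  by rewrite lef_pV2 ?posrE ?sqrtr_gt0 ?addr_gt0// ler_wsqrtr// lerDl ltW.
have e3 : Num.sqrt s2 <= Num.sqrt (h + s2) by rewrite ler_wsqrtr// lerDr ltW.
have e4 : Num.sqrt (h + s1) <= Num.sqrt h + Num.sqrt s1.
  rewrite -(@ler_pXn2r _ 2) ?nnegrE ?sqrtr_ge0 ?addr_ge0 ?sqrtr_ge0//.
  rewrite sqrrD !sqr_sqrtr ?(ltW h0) ?(ltW s10) ?addr_ge0 ?(ltW h0) ?(ltW s10)//.
  by rewrite addrAC lerDl mulrn_wge0// mulr_ge0 ?sqrtr_ge0.
rewrite /g !add0r; have [k1 k2] := powR_kappa.
set z1 := 2 / a * h `^ (a / 2); set z2 := 2 * h `^ (a / 2 - 1).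
have z10 : 0 <= A1 * z1 by rewrite mulr_ge0// mulr_ge0 ?powR_ge0// divr_ge0// ltW.
have z20 : 0 <= A1 * z2 by rewrite mulr_ge0// mulr_ge0 ?powR_ge0.
have -> : A1 * ((4 / a + 4) * h `^ (- ((1 - a) / 2))) =
   A1 * z1 * (2 * (Num.sqrt h)^-1) + A1 * z2 * (2 * Num.sqrt h).
  rewrite mulrDl -{1}k1 -k2 /z1 /z2.
  move: (h `^ (a / 2)) (h `^ (a / 2 - 1)) => y1 y2.
  by field; rewrite !gt_eqF.
set v1 := A1 * z1; set v2 := A1 * z2.
have f1 : v1 * (- 2 * (Num.sqrt (h + s2))^-1) - v1 * (- 2 * (Num.sqrt (h + s1))^-1) <= v1 * (2 * (Num.sqrt h)^-1).
  by rewrite -mulrBr ler_wpM2l//; lra.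
have f2 : v2 * (2 * (Num.sqrt s2 - Num.sqrt (h + s2))) - v2 * (2 * (Num.sqrt s1 - Num.sqrt (h + s1))) <= v2 * (2 * Num.sqrt h).
  by rewrite -mulrBr ler_wpM2l//; lra.
rewrite (_ : _ - _ = (v1 * (- 2 * (Num.sqrt (h + s2))^-1) - v1 * (- 2 * (Num.sqrt (h + s1))^-1)) +
  (v2 * (2 * (Num.sqrt s2 - Num.sqrt (h + s2))) - v2 * (2 * (Num.sqrt s1 - Num.sqrt (h + s1)))) +
  D * r^-1 * (s2 - s1)); last by ring.
by rewrite lerD2r lerD.
Qed.

(** The weighted bound [UV] yields the decay [s^(-a/2)]; a supremum bound on [w] would give none, as
    constants are fixed by the heat flow. *)
Let H_far r s : 0 < r -> 0 < s -> s <= r ^+ 2 ->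
  `|H r s| <= Cp * (N * L `^ (- ((1 - a) / 2))) * Pc * Num.sqrt s `^ (- a).
Proof.
move=> r0 s0 sr; have l0 : 0 < Num.sqrt s by rewrite sqrtr_gt0.
have lr : Num.sqrt s <= r by rewrite -(ger0_norm (ltW r0)) -sqrtr_sqr ler_wsqrtr.
have N1 : 0 <= N * L `^ (- ((1 - a) / 2)) by rewrite mulr_ge0 ?powR_ge0.
have c1 : continuous (psi r (Num.sqrt s) x [::]) by exact: continuous_psi_space.
have bd y : `|psi r (Num.sqrt s) x [::] y| <= Pc * majorant (Num.sqrt s) x y.
  have lrr : 0 < Num.sqrt s <= r by rewrite l0.
  by have [+ _ _] := HP x y (s := [::]) isT lrr; rewrite expr0 mulr1.
have [_ +] := HCp l0 N1 (ltW Pc0) cw c1 (@vanish_psi _ _ r _ x [::] r0) bd.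
by case=> // y yk; exact: UV.
Qed.

(** [m * w x] telescopes into the error of the approximate identity at a small scale [s1], the
    increment from [s1] to [s2], and the value at a large scale [s2]. The choices are made in the
    order [s1], [s2], [r], and each of the three errors takes a third of [eta]. *)
Lemma core_le : `|w x| <= 2 * C * (4 / a + 4) / (@gauss_mass R) ^+ n * e * N * L `^ (- ((1 - a) / 2)) * pw a (x 0 k0).
Proof.
have /andP[a0 a1] := a01.
set m := gauss_mass ^+ n; have m0 : 0 < m by rewrite exprn_gt0// gauss_mass_gt0.
set kap := (1 - a) / 2; have kap0 : 0 <= kap by rewrite divr_ge0// subr_ge0 ltW.
(* Passing from [h = L / 2] to [L] costs at most a factor 2, since [kap <= 1]. *)
have hL : h `^ (- kap) <= 2 * L `^ (- kap).
  have -> : L = 2 * h by rewrite /h; field.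
  rewrite powRM// ?(ltW h0)// mulrA ler_peMl ?powR_ge0//.
  rewrite -{1}(powRr1 (ler0n R 2)) -powRD; last by rewrite pnatr_eq0 implybT.
  by rewrite -[leLHS](powRr0 2) ler_powR ?ler1n// /kap; lra.
suff : m * `|w x| <= A1 * ((4 / a + 4) * h `^ (- kap)).
  rewrite mulrC -ler_pdivlMr// => /le_trans; apply.
  rewrite (_ : _ * pw a (x 0 k0) = A1 * ((4 / a + 4) * (2 * L `^ (- kap))) / m); last first.
    by rewrite /A1; field; rewrite !gt_eqF.
  have c0 : 0 <= 4 / a + 4 by rewrite addr_ge0// divr_ge0// ltW.
  by rewrite ler_wpM2r ?invr_ge0 ?(ltW m0)// ler_wpM2l// ler_wpM2l.
apply/ler_addgt0Pr => eta eta0.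
have e30 : 0 < eta / 3 by rewrite divr_gt0.
have [s1 s10 [r0 r00 Hap]] := approximate_identity x cw wM e30.
have [D D0 HD] := scale_increment s10.
set A3 := Cp * (N * L `^ (- kap)) * Pc.
have A30 : 0 <= A3 by rewrite !mulr_ge0 ?powR_ge0// ltW.
have [s2 s12 far] : exists2 s2, s1 <= s2 & A3 * Num.sqrt s2 `^ (- a) <= eta / 3.
  (* The root of [(A3 + 1) z^(-a) = eta / 3]; the added 1 keeps it positive when [A3 = 0]. It
     suffices that [sqrt s2] reaches [z]. *)
  pose z := ((A3 + 1) / (eta / 3)) `^ a^-1.
  have y0 : 0 < (A3 + 1) / (eta / 3) by rewrite divr_gt0// ltr_wpDl.
  have z0 : 0 < z by rewrite powR_gt0.
  exists (z ^+ 2 + s1); first by rewrite lerDr exprn_ge0// ltW.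
  have zl : z <= Num.sqrt (z ^+ 2 + s1).
    by rewrite -[leLHS](ger0_norm (ltW z0)) -sqrtr_sqr ler_wsqrtr// lerDl ltW.
  apply: (@le_trans _ _ ((A3 + 1) * z `^ (- a))).
    rewrite ler_pM ?powR_ge0// ?lerDl// !powRN lef_pV2 ?posrE ?powR_gt0//.
      by rewrite ge0_ler_powR ?nnegrE ?sqrtr_ge0 ?(ltW a0) ?(ltW z0).
    by rewrite (lt_le_trans z0).
  rewrite powRN /z -powRrM mulVf ?gt_eqF// powRr1 ?(ltW y0)//.
  rewrite le_eqVlt; apply/orP; left; apply/eqP.
  by field; rewrite !gt_eqF// ltr_wpDl.
have [r [rr0 rL rD]] : exists r, [/\ r0 <= r, L + s2 <= r ^+ 2 & D * r^-1 * (s2 - s1) <= eta / 3].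
  pose B := D * (s2 - s1); have B0 : 0 <= B by rewrite mulr_ge0// subr_ge0.
  have s20 : 0 < s2 by rewrite (lt_le_trans s10).
  (* One summand per requirement: the approximate identity, [L + s2 <= (1 + (L + s2))^2], and
     smallness of the [r^-1] error. *)
  exists (r0 + (1 + (L + s2)) + B / (eta / 3)).
  have q0 : 0 <= B / (eta / 3) by rewrite divr_ge0// ltW.
  have q1 : 0 < L + s2 by rewrite addr_gt0.
  split.
  - by move: q0 q1; lra.
  - apply: (@le_trans _ _ ((1 + (L + s2)) ^+ 2)); last first.
      rewrite lerXn2r ?nnegrE; [|by move: q0 q1 r00; lra..].
      by move: q0 q1 r00; lra.
    by move: q1; move: (L + s2) => q q1; nra.
  - rewrite mulrAC -/B ler_pdivrMr; last by move: q0 q1 r00; lra.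
    rewrite mulrDr [X in _ <= _ + X](_ : _ = B); last by field; rewrite gt_eqF.
    by rewrite lerDr mulr_ge0 ?(ltW e30)//; move: q0 q1 r00; lra.
have rgt0 : 0 < r by rewrite (lt_le_trans r00).
have k1 : `|H r s1 - m * w x| <= eta / 3 by apply: Hap => //; rewrite s10 lexx.
have k2 := HD r s2 rgt0 s12 rL.
have s2r : s2 <= r ^+ 2 by rewrite (le_trans _ rL)// lerDr ltW.
have k3 := le_trans (H_far rgt0 (lt_le_trans s10 s12) s2r) far.
have -> : m * `|w x| = `|m * w x| by rewrite normrM (gtr0_norm m0).
have -> : m * w x = - (H r s1 - m * w x) - (H r s2 - H r s1) + H r s2.
  by move: (m * w x) (H r s1) (H r s2) => z1 z2 z3; ring.
apply: (le_trans (ler_normD _ _)); apply: (le_trans (lerD (ler_normB _ _) (lexx _))).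
rewrite normrN; move: k1 k2 k3 rD; rewrite -/kap.
move: (A1 * _) (D * _ * _) `|_ - m * _| `|H r s2 - _| `|H r s2| => z1 z2 z3 z4 z5.
lra.
Qed.

End rate.

End two_flows.

(** [C] is chosen before the flows, the interval, [e] and [N]. This uniformity permits iteration in
    [N] and restarting at later time origins. *)
Lemma core_estimate (k0 : 'I_n) a : 0 < a < 1 -> exists2 C, 0 < C &
  forall t0 b (U Ut V Vt : 'I_n -> R -> Rn -> R) (dU d2U dV d2V : 'I_n -> 'I_n -> R -> Rn -> R)
    (P Q : R -> Rn -> R) (dP dQ : 'I_n -> R -> Rn -> R) e N,
  flow t0 b U Ut dU d2U P dP -> flow t0 b V Vt dV d2V Q dQ -> 0 <= e -> 0 <= N ->
  (forall i t y, t0 < t < b -> `|U i t y| <= e * (t - t0) `^ (- 2^-1)) ->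
  (forall i t y, t0 < t < b -> `|V i t y| <= e * (t - t0) `^ (- 2^-1)) ->
  (forall i t y, t0 < t < b -> y 0 k0 != 0 ->
    `|U i t y - V i t y| <= N * (t - t0) `^ (- ((1 - a) / 2)) * pw a (y 0 k0)) ->
  (forall r c x j, 0 < r -> t0 < c -> lap_pairing U V r c x j t @[t --> t0^'+] --> 0) ->
  forall i t y, t0 < t < b -> y 0 k0 != 0 ->
    `|U i t y - V i t y| <= C * e * N * (t - t0) `^ (- ((1 - a) / 2)) * pw a (y 0 k0).
Proof.
move=> a01; have /andP[a0 a1] := a01.
have [C C0 HC] := @rate_bound R n k0 a a01.
have [Cp Cp0 HCp] := @pairing_bound R n k0 a a01.
have [Pc Pc0 HP] := @psi_bound R n.
exists (2 * C * (4 / a + 4) / (@gauss_mass R) ^+ n).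
  by rewrite divr_gt0 ?exprn_gt0 ?gauss_mass_gt0// !mulr_gt0// addr_gt0// divr_gt0.
move=> t0 b U Ut V Vt dU d2U dV d2V P Q dP dQ e N fU fV e0 N0 Ue Ve UV ini i t y tb yk.
exact: (core_le a01 fU fV e0 N0 Ue Ve UV ini C0 HC Cp0 Pc0 HCp HP i tb yk).
Qed.

End core.

(** * Regularity of Navier-Stokes solutions *)

Section extraction.
Context {R : realType} {n : nat}.
Local Notation Rn := 'rV[R]_n.
Local Notation mu := (@lebesgue_rV R n).
Local Notation e_ k := (delta_mx 0 k : Rn).

Section smooth_theory.
Context {V W : normedModType R}.
Implicit Types (A : set V) (f : V -> W).

Lemma smooth_continuous A f x : smooth A f -> A x -> {for x, continuous f}.
Proof. by move=> /(_ 0%N) [+ _] => /[apply]. Qed.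

Lemma smooth_derivable A f x v : smooth A f -> A x -> derivable f x v.
Proof. by move=> /(_ 1%N) [_ /(_ v) [+ _]] => /[apply]. Qed.

Lemma smooth_derive A f v : smooth A f -> smooth A (fun x => 'D_v f x).
Proof. by move=> sf k; have [_ /(_ v) []] := sf k.+1. Qed.

Lemma derivable_line f x v : derivable f x v ->
  is_derive (0 : R) (1 : R) (fun s : R => f (x + s *: v)) ('D_v f x).
Proof.
have E : (fun h : R => h^-1 *: (((fun s : R => f (x + s *: v)) \o shift 0) (h *: (1 : R)) - f (x + 0 *: v))) =
    (fun h => h^-1 *: ((f \o shift x) (h *: v) - f x)).
  by apply/funext => h /=; rewrite addr0 scale0r addr0 [h *: 1]mulr1 [x + _]addrC.
by move=> d; split; rewrite /derivable /derive ?E.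
Qed.

End smooth_theory.

Implicit Types (t b : R) (x y : Rn).

Lemma is_derive_coord (V : normedModType R) (F : V -> Rn) z w d j :
  is_derive z w F d -> is_derive z w (fun s => F s 0 j) (d 0 j).
Proof.
move=> [dF <-]; split; first by move/derivable_mxP : dF; exact.
by rewrite derive_mx// mxE.
Qed.

Lemma derive_time (W : normedModType R) (f : R -> Rn -> W) t y :
  'D_(1, 0) (fun z : R * Rn => f z.1 z.2) (t, y) = derive1 (fun s => f s y) t.
Proof.
rewrite /derive /derive1; set d := (fun _ : R => _); set d' := (fun _ : R => _).
suff -> : d = d' by []; apply/funext => h; rewrite /d /d' /=.
by rewrite scaler0 add0r [h *: 1]mulr1.
Qed.

Lemma derive_space (W : normedModType R) (f : R -> Rn -> W) k t y :
  'D_(0, e_ k) (fun z : R * Rn => f z.1 z.2) (t, y) = partial k (f t) y.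
Proof.
rewrite /partial /derive; set d := (fun _ : R => _); set d' := (fun _ : R => _).
suff -> : d = d' by []; apply/funext => h; rewrite /d /d' /=.
by rewrite scaler0 add0r.
Qed.

Section regular.
Context {W : normedModType R}.
Variables (T : \bar R) (f : R -> Rn -> W).
Hypothesis sf : smooth (slab T) (fun z : R * Rn => f z.1 z.2).

Lemma smooth_time : smooth (slab T) (fun z : R * Rn => derive1 (fun s => f s z.2) z.1).
Proof.
have := smooth_derive ((1, 0) : R * Rn) sf.
by congr smooth; apply/funext => -[t y]; rewrite derive_time.
Qed.

Lemma smooth_space k : smooth (slab T) (fun z : R * Rn => partial k (f z.1) z.2).
Proof.
have := smooth_derive ((0, e_ k) : R * Rn) sf.
by congr smooth; apply/funext => -[t y]; rewrite derive_space.
Qed.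

Lemma smooth_slice t y : slab T (t, y) -> {for y, continuous (f t)}.
Proof.
move=> ty; apply: (@continuous_comp _ _ _ (fun y => (t, y)) (fun z : R * Rn => f z.1 z.2)).
  exact: pair_continuous_r.
exact: (smooth_continuous sf).
Qed.

Lemma smooth_is_derive_time t y : slab T (t, y) ->
  is_derive t 1 (fun s => f s y) (derive1 (fun s => f s y) t).
Proof.
move=> ty; have d := smooth_derivable (v := (1, 0) : R * Rn) sf ty.
have E : (fun h : R => h^-1 *: (((fun s => f s y) \o shift t) (h *: (1 : R)) - f t y)) =
    (fun h => h^-1 *: (((fun z : R * Rn => f z.1 z.2) \o shift (t, y)) (h *: (1, 0)) - f t y)).
  by apply/funext => h /=; rewrite scaler0 add0r.
split; last by rewrite derive1E.
by rewrite /derivable E.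
Qed.

Lemma smooth_is_derive_space k t y : slab T (t, y) ->
  is_derive (0 : R) (1 : R) (fun s : R => f t (y + s *: e_ k)) (partial k (f t) y).
Proof.
move=> ty; have := derivable_line (smooth_derivable (v := (0, e_ k) : R * Rn) sf ty).
rewrite derive_space; congr is_derive; apply/funext => s /=.
by rewrite scaler0 addr0.
Qed.

Lemma smooth_derivable_space k t y : slab T (t, y) -> derivable (f t) y (e_ k).
Proof.
move=> ty; have := smooth_derivable (v := (0, e_ k) : R * Rn) sf ty.
rewrite /derivable; set d := (fun _ : R => _); set d' := (fun _ : R => _).
suff -> : d = d' by []; apply/funext => h; rewrite /d /d' /=.
by rewrite scaler0 add0r.
Qed.

End regular.

Lemma smooth_coord A (F : R * Rn -> Rn) z j : smooth A F -> A z ->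
  {for z, continuous (fun z => F z 0 j)}.
Proof.
move=> sF Az; apply: (@continuous_comp _ _ _ F (fun y : Rn => y 0 j)).
  exact: (smooth_continuous sF).
exact: continuous_coord.
Qed.

(** The passage from joint smoothness of vector-valued maps to componentwise data: a component of a
    vector derivative is the derivative of that component. *)
Lemma NS_flow (T : \bar R) v pr b : NS_solution T v pr -> (b%:E <= T)%E ->
  flow 0 b (fun j t y => v t y 0 j) (fun j t y => derive1 (fun s => v s y) t 0 j)
    (fun k j t y => partial k (v t) y 0 j) (fun k j t y => partial k (partial k (v t)) y 0 j)
    pr (fun k t y => partial k (pr t) y).
Proof.
move=> [sv sp eqs] bT.
have slb t y : 0 < t < b -> slab T (t, y).
  by move=> /andP[t0 tb]; split => //=; apply: lt_le_trans bT; rewrite lte_fin.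
have sk k := smooth_space sv k.
have sc (f : R -> Rn -> Rn) j t : smooth (slab T) (fun z : R * Rn => f z.1 z.2) ->
    0 < t < b -> continuous (fun y => f t y 0 j).
  move=> sf tb y; apply: (@continuous_comp _ _ _ (f t) (fun y : Rn => y 0 j)).
    exact: (smooth_slice sf (slb _ _ tb)).
  exact: continuous_coord.
have ic (f : R -> Rn -> Rn) k j t y : smooth (slab T) (fun z : R * Rn => f z.1 z.2) ->
    0 < t < b -> is_partial k (fun y => f t y 0 j) y (partial k (f t) y 0 j).
  by move=> sf tb; apply: is_derive_coord; exact: smooth_is_derive_space (slb _ _ tb).
split.
- by move=> j t y tb; exact: (smooth_coord (j := j) sv (slb _ y tb)).
- by move=> j t y tb; exact: (smooth_coord (j := j) (smooth_time sv) (slb _ y tb)).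
- by move=> k j t tb; exact: (sc (fun t => partial k (v t)) j t (sk k) tb).
- by move=> k j t tb; exact: (sc (fun t => partial k (partial k (v t))) j t (@smooth_space _ T (fun t => partial k (v t)) (sk k) k) tb).
- by move=> t tb y; exact: (smooth_slice sp (slb _ _ tb)).
- by move=> k t tb y; exact: (@smooth_slice _ _ (fun t => partial k (pr t)) (smooth_space sp k) _ _ (slb t y tb)).
- by move=> j t y tb; apply: is_derive_coord; exact: (smooth_is_derive_time sv (slb _ _ tb)).
- by move=> k j t y tb; exact: ic.
- by move=> k j t y tb; exact: (ic (fun t => partial k (v t))).
- by move=> k t y tb; exact: (smooth_is_derive_space sp k (slb _ _ tb)).
- move=> j t y tb; have [+ _] := eqs t y (slb _ _ tb).
  move=> /(congr1 (fun M : Rn => M 0 j)); rewrite !mxE !summxE => <-.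
  by congr (_ + _ + _); apply: eq_bigr => i _; rewrite mxE.
- move=> t y tb; have [_ D] := eqs t y (slb _ _ tb); rewrite -[RHS]D.
  apply: eq_bigr => i _.
  by rewrite /partial (derive_mx (smooth_derivable_space (k := i) sv (slb _ y tb))) mxE.
Qed.

End extraction.

(** * Pointwise bounds *)

Section pointwise.
Context {R : realType} {n : nat}.
Local Notation Rn := 'rV[R]_n.
Local Notation mu := (@lebesgue_rV R n).
Implicit Types (t a b c D M : R) (x y : Rn) (u : Rn -> Rn).

Lemma enorm_ge0 x : 0 <= enorm x. Proof. exact: sqrtr_ge0. Qed.

Lemma coord_le_enorm x j : `|x 0 j| <= enorm x.
Proof.
rewrite -sqrtr_sqr ler_wsqrtr// (bigD1 j)//= lerDl sumr_ge0// => i _.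
exact: sqr_ge0.
Qed.

Lemma continuous_enorm : continuous (@enorm R n).
Proof.
move=> x; apply: (@continuous_comp _ _ _ (fun x : Rn => \sum_i x 0 i ^+ 2) Num.sqrt).
  suff : continuous (fun x : Rn => \sum_i x 0 i ^+ 2) by exact.
  apply: continuous_bigsum => i y.
  rewrite [X in continuous_at _ X](_ : _ = (fun x : Rn => x 0 i * x 0 i)).
    by apply: continuous_mul => z; exact: continuous_coord.
  by apply/funext => z; rewrite expr2.
exact: sqrt_continuous.
Qed.

Lemma measurable_enorm : measurable_fun setT (@enorm R n).
Proof. by apply: continuous_measurable_rV; exact: continuous_enorm. Qed.

Lemma open_box_gt0 x e : 0 < e -> (0 < mu [set y : Rn | forall i, (`](x 0 i - e), (x 0 i + e)[%classic : set R) (y 0 i)]%R)%E.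
Proof.
move=> e0; have mA (i : 'I_n) : measurable (`](x 0 i - e), (x 0 i + e)[%classic : set R).
  exact: measurable_itv.
apply: (@lt_le_trans _ _ (\prod_(i < n) (2 * e)%:E)%E).
  by rewrite prodEFin lte_fin prodr_gt0// => i _; rewrite mulr_gt0.
rewrite (lebesgue_rV_box mA) le_eqVlt; apply/orP; left; apply/eqP.
apply: eq_bigr => i _; rewrite lebesgue_measure_itv/= lte_fin.
rewrite (_ : _ < _ = true); last by lra.
by rewrite -EFinD; congr EFin; ring.
Qed.

(** If [f x > c], continuity gives an open box around [x] on which [f > c], and such a box has
    positive measure. *)
Lemma ae_le_continuous (f : Rn -> R) x c : {for x, continuous f} ->
  {ae mu, forall y, f y <= c} -> f x <= c.
Proof.
move=> cf [A [mA A0 fA]]; rewrite leNgt; apply/negP => cfx.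
have /nbhs_box[e e0 he] : nbhs x (f @^-1` [set z | c < z]).
  by apply: cf; apply: open_nbhs_nbhs; split => //; exact: open_gt.
pose B := [set y : Rn | forall i, (`](x 0 i - e), (x 0 i + e)[%classic : set R) (y 0 i)].
have mB : measurable B.
  by apply: (measurable_box (A := fun i => `](x 0 i - e), (x 0 i + e)[%classic)) => i; exact: measurable_itv.
have : (mu B <= mu A)%E.
  apply: le_measure; rewrite ?inE// => y By; apply: fA => /= fy.
  have : c < f y.
    by apply: he => i; have := By i; rewrite /= in_itv/= ltr_norml => /andP[]; lra.
  by rewrite ltNge fy.
by rewrite A0 leNgt open_box_gt0.
Qed.

(** The norm with exponent [+oo] unfolds to an essential supremum only when the whole space has
    positive measure. *)
Lemma mu_setT_gt0 : (0 < mu setT)%E.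
Proof.
apply: (lt_le_trans (open_box_gt0 0 ltr01)); apply: le_measure => //; rewrite ?inE//.
by apply: (measurable_box (A := fun i => `]((0 : Rn) 0 i - 1), ((0 : Rn) 0 i + 1)[%classic)) => i; exact: measurable_itv.
Qed.

Lemma ess_sup_continuous_le (f : Rn -> R) x c : {for x, continuous f} -> (forall y, 0 <= f y) ->
  ('N[mu]_(+oo)[(fun y => (f y)%:E)] <= c%:E)%E -> f x <= c.
Proof.
move=> cf f0; rewrite unlock mu_setT_gt0 => /ess_supP h.
apply: ae_le_continuous => //; apply: filterS h => y /=.
by rewrite lee_fin ger0_norm.
Qed.

Lemma continuous_comp_enorm u x : {for x, continuous u} -> {for x, continuous (fun y => enorm (u y))}.
Proof. by move=> cu; apply: (@continuous_comp _ _ _ u (@enorm R n)) => //; exact: continuous_enorm. Qed.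

Lemma normLp_bound u c x j : continuous u -> (normLp +oo u <= c%:E)%E -> `|u x 0 j| <= c.
Proof.
move=> cu uc; apply: (le_trans (coord_le_enorm _ _)).
apply: (@ess_sup_continuous_le (fun y => enorm (u y))) => //.
- by apply: continuous_comp_enorm; exact: cu.
- by move=> y; exact: enorm_ge0.
Qed.

(** The passage from the radial weight to that of a single coordinate, by [|x_k| <= |x|] and
    [a > 0]. *)
Lemma wnorm_bound a u c x j k : 0 < a -> continuous u -> (wnorm a +oo u <= c%:E)%E ->
  x 0 k != 0 -> `|u x 0 j| <= c * pw a (x 0 k).
Proof.
move=> a0 cu uc xk; have xk0 : 0 < `|x 0 k| by rewrite normr_gt0.
have x0 : 0 < enorm x by rewrite (lt_le_trans xk0)// coord_le_enorm.
have h : enorm (u x) * enorm x `^ a <= c.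
  apply: (@ess_sup_continuous_le (fun y => enorm (u y) * enorm y `^ a)) => //.
  - have c1 : {for x, continuous (fun y => enorm (u y))} by apply: continuous_comp_enorm; exact: cu.
    have c2 : {for x, continuous (fun y => enorm y `^ a)}.
      apply: (@continuous_comp _ _ _ (@enorm R n) (fun z => z `^ a)); first exact: continuous_enorm.
      apply: differentiable_continuous; apply/derivable1_diffP.
      by have [] := @is_derive1_powR _ a _ x0.
    exact: (cvgM c1 c2).
  - by move=> y; rewrite mulr_ge0 ?enorm_ge0// powR_ge0.
rewrite /pw powRN ler_pdivlMr ?powR_gt0//; apply: le_trans h.
rewrite ler_pM// ?powR_ge0// ?coord_le_enorm//.
by rewrite ge0_ler_powR ?nnegrE ?enorm_ge0 ?(ltW a0)// coord_le_enorm.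
Qed.

Lemma lee_scaled c D (X : \bar R) : 0 < c -> (c%:E * X <= D%:E)%E -> (X <= (D * c^-1)%:E)%E.
Proof.
by move=> c0; rewrite -lee_pdivlMl// mulrC EFinM.
Qed.

Lemma decay_bound (p q t D : R) (v : R -> Rn -> Rn) j y : n%:R < p -> 0 < t -> continuous (v t) ->
  (decay p q v t <= D%:E)%E ->
  `|v t y 0 j| <= D * t `^ (- 2^-1) /\
  forall k, y 0 k != 0 -> `|v t y 0 j| <=
    D * t `^ (- ((1 - @alpha R n p) / 2)) * pw (@alpha R n p) (y 0 k).
Proof.
move=> np t0 cv; rewrite /decay => h.
have p0 : 0 < p by rewrite (le_lt_trans _ np).
have a0 : 0 < @alpha R n p by rewrite subr_gt0 ltr_pdivrMr// mul1r.
have tq q' : (0 <= (t `^ q')%:E)%E by rewrite lee_fin powR_ge0.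
have h1 : ((t `^ (n%:R / (2 * p)))%:E * wnorm (@alpha R n p) +oo (v t) <= D%:E)%E.
  by apply: le_trans h; rewrite -addeA leeDl// adde_ge0// mule_ge0// Lnorm_ge0.
have h2 : ((t `^ 2^-1)%:E * normLp +oo (v t) <= D%:E)%E.
  by apply: le_trans h; rewrite -addeA addeCA leeDl// adde_ge0// mule_ge0// Lnorm_ge0.
split.
  apply: normLp_bound => //; rewrite powRN; apply: lee_scaled h2.
  by rewrite powR_gt0.
move=> k yk; apply: (@wnorm_bound _ _ _ _ _ k) => //.
have -> : (1 - @alpha R n p) / 2 = n%:R / (2 * p).
  by rewrite /alpha; field; rewrite gt_eqF.
by rewrite powRN; apply: lee_scaled h1; rewrite powR_gt0.
Qed.

(** Euclidean balls are not balls of the matrix norm; they are treated as sublevel sets of a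
    continuous function. *)
Lemma measurable_eball x (rho : R) : measurable (eball x rho).
Proof.
rewrite (_ : eball x rho = (fun y => enorm (y - x)) @^-1` `]-oo, rho[%classic).
  rewrite -[X in measurable X]setTI.
  apply: (@continuous_measurable_rV _ _ (fun y : Rn => enorm (y - x))) => //.
  move=> y; apply: (@continuous_comp _ _ _ (fun y : Rn => y - x) (@enorm R n)).
    exact: (cvgB cvg_id (cvg_cst _)).
  exact: continuous_enorm.
by apply/seteqP; split => y /=; rewrite in_itv.
Qed.

Lemma local_wnorm_le a (p rho : R) u : 0 < p -> measurable_fun setT u ->
  (local_wnorm a p rho u <= wnorm a p%:E u)%E.
Proof.
move=> p0 mu_; apply: ge_ereal_sup => _ [x _ <-].
rewrite /wnorm unlock gt0_ler_poweR ?invr_ge0 ?(ltW p0)//.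
- by rewrite in_itv/= leey integral_ge0// => y _; rewrite lee_fin mulr_ge0// powR_ge0.
- by rewrite in_itv/= leey integral_ge0// => y _; rewrite poweR_ge0.
rewrite [X in (_ <= X)%E](_ : _ = (\int[mu]_y (enorm (u y) `^ p * enorm y `^ (a * p))%R%:E)%E); last first.
  apply: eq_integral => y _; rewrite abse_EFin ger0_norm; last by rewrite mulr_ge0 ?powR_ge0 ?enorm_ge0.
  by rewrite poweR_EFin powRM ?powR_ge0 ?enorm_ge0// powRrM.
apply: ge0_subset_integral => //; first exact: measurable_eball.
- apply/measurable_EFinP; apply: measurable_funM; apply: (measurableT_comp (measurable_powR _)).
    exact: measurableT_comp measurable_enorm mu_.
  exact: measurable_enorm.
- by move=> y _; rewrite lee_fin mulr_ge0 ?powR_ge0.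
Qed.

(** The right side of [class_bound] is at most a finite constant: local norms are bounded by the
    global one and the exponential by 1. *)
Lemma class_decay_bound (p qX : R) u0 T v pr : n%:R < p -> inwLp (@alpha R n p) p%:E u0 ->
  existence_class p qX u0 T v pr ->
  exists2 D, 0 <= D & forall t, 0 < t -> (t%:E < T)%E -> (decay p (p + 1) v t <= D%:E)%E.
Proof.
move=> np [mu0 u0oo] cl; have p0 : 0 < p by rewrite (le_lt_trans _ np).
(* Any exponent above [p] serves; [p + 1] is fixed here and in [class_decay_small]. *)
have pp1 : p < p + 1 by rewrite ltrDl.
have := class_bound cl pp1; set g := 1 - n%:R / (p + 1).
have g0 : 0 <= g.
  by rewrite subr_ge0 ler_pdivrMr ?addr_gt0// mul1r (le_trans (ltW np))// lerDl.
move=> /= [rho [c0 [c1 [c [rho0 c00 c10 cgt0 H]]]]].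
set W := wnorm _ _ u0 in u0oo H; have W0 : (0 <= W)%E by exact: Lnorm_ge0.
pose K' := ((c0 + c1)%:E * W)%E.
have K'0 : (0 <= K')%E by rewrite mule_ge0// lee_fin addr_ge0// ltW.
have K'oo : (K' < +oo)%E by rewrite lte_mul_pinfty// lee_fin addr_ge0// ltW.
pose B := (K' + c%:E * W `^ (1 - g) * K' `^ g)%E.
have B0 : (0 <= B)%E by rewrite adde_ge0// !mule_ge0 ?poweR_ge0// lee_fin ltW.
have Boo : (B < +oo)%E.
  rewrite lte_add_pinfty//; apply: lte_mul_pinfty.
  - by rewrite mule_ge0 ?poweR_ge0// lee_fin ltW.
  - by rewrite fin_numM// ge0_fin_numE ?poweR_ge0// poweR_lty.
  - exact: poweR_lty.
exists (fine B); first exact: fine_ge0.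
move=> t t0 tT; rewrite fineK ?ge0_fin_numE//.
apply: (le_trans (H t t0 tT)).
have lw : (local_wnorm (@alpha R n p) p rho u0 <= W)%E by exact: local_wnorm_le.
have lw0 : (0 <= local_wnorm (@alpha R n p) p rho u0)%E.
  apply: le_ereal_sup_tmp; eexists; first by exists 0.
  exact: poweR_ge0.
have ex : expR (- (rho ^+ 2 / (8 * t))) <= 1.
  by rewrite -expR0 ler_expR oppr_le0 divr_ge0 ?sqr_ge0// mulr_ge0// ltW.
have KK : (K p u0 c0 c1 t rho <= K')%E.
  rewrite /K' EFinD ge0_muleDl ?lee_fin ?(ltW c00) ?(ltW c10)//.
  apply: leeD; first by rewrite lee_wpmul2l// lee_fin ltW.
  by rewrite lee_wpmul2r// lee_fin ler_piMr// ltW.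
have K0 : (0 <= K p u0 c0 c1 t rho)%E.
  by rewrite adde_ge0// mule_ge0// lee_fin ?mulr_ge0 ?expR_ge0// ltW.
apply: leeD => //; rewrite lee_wpmul2l ?mule_ge0 ?poweR_ge0 ?lee_fin ?(ltW cgt0)//.
by rewrite gt0_ler_poweR ?in_itv/= ?leey ?K0 ?K'0.
Qed.

Lemma class_decay_small (p qX : R) u0 T v pr e : 0 < e -> existence_class p qX u0 T v pr ->
  exists2 b, 0 < b & forall t, 0 < t < b -> (decay p (p + 1) v t <= e%:E)%E.
Proof.
move=> e0 cl; have pp1 : p < p + 1 by rewrite ltrDl.
have L := class_limit0 cl pp1.
have : \forall t \near 0^'+, (decay p (p + 1) v t < e%:E)%E.
  apply: (L [set z | (z < e%:E)%E]); apply: open_nbhs_nbhs; split => /=.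
    exact: open_ereal_lt_ereal.
  by rewrite lte_fin.
move=> [b /= b0 hb]; exists b => // t /andP[t0 tb].
by apply/ltW/hb => //=; rewrite sub0r normrN gtr0_norm.
Qed.

End pointwise.

(** * Initial values *)

(** The integral of a nonnegative function is a supremum over the simple functions below it, so this
    monotonicity also applies to integrands such as those built from [rearrangement]. *)
Lemma nnsup_le_integral d (T : measurableType d) (R : realType)
    (m : {measure set T -> \bar R}) (f g : T -> \bar R) :
  (forall x, 0 <= f x)%E -> (forall x, f x <= g x)%E ->
  (\int[m]_x f x <= \int[m]_x g x)%E.
Proof.
move=> f0 fg; rewrite !ge0_integralTE//; last by move=> x; exact: le_trans (fg x).
apply: ereal_sup_le => _ [h hf <-]; exists h => // x.
exact: le_trans (hf x) (fg x).
Qed.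

Lemma hoelder_conjugateE (R : realType) (p : R) : 1 < p ->
  hoelder_conjugate p%:E = (p / (p - 1))%:E.
Proof.
move=> p1; rewrite /hoelder_conjugate /= eqe gt_eqF ?(lt_trans _ p1)//.
by rewrite -EFinB inver subr_eq0 gt_eqF// -EFinM.
Qed.

Section test_fields.
Context {R : realType} {n : nat}.
Local Notation Rn := 'rV[R]_n.
Local Notation mu := (@lebesgue_rV R n).
Implicit Types (r t a b c B : R) (x y : Rn).

Lemma continuous_vanish_bounded r (phi : Rn -> R) : continuous phi -> vanish r phi ->
  exists2 B, 0 <= B & forall y, `|phi y| <= B.
Proof.
move=> cphi vphi; have [|M fM] := @bounded_on_cylinder R n (phi \o snd) 0 0 r.
  move=> t y _; apply: (@continuous_comp _ _ _ snd phi); [exact: cvg_snd|exact: cphi].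
exists (Num.max M 0); first by rewrite le_max lexx orbT.
move=> x; have [xr|/vphi ->] := pselect (box r x); last by rewrite normr0 le_max lexx orbT.
by rewrite le_max (fM 0)// lexx.
Qed.

Lemma ae_integral_le (k : 'I_n) (f g : Rn -> R) : measurable_fun setT f -> measurable_fun setT g ->
  (forall y, 0 <= f y) -> (forall y, 0 <= g y) -> (forall y, y 0 k != 0 -> f y <= g y) ->
  (\int[mu]_y (f y)%:E <= \int[mu]_y (g y)%:E)%E.
Proof.
move=> mf mg f0 g0 fg; apply: ae_ge0_le_integral => //.
- by move=> y _; rewrite lee_fin.
- exact/measurable_EFinP.
- by move=> y _; rewrite lee_fin.
- exact/measurable_EFinP.
exists [set y : Rn | y 0 k = 0]; split.
- rewrite (_ : mkset _ = (fun y : Rn => y 0 k) @^-1` [set 0])//.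
  by rewrite -[X in measurable X]setTI; apply: measurable_coord => //; exact: measurable_set1.
- exact: hyperplane_null.
move=> y /= ny; apply: contrapT => yk; apply: ny => _.
by rewrite lee_fin fg//; apply/eqP.
Qed.

Lemma integral_box_pw (k : 'I_n) a r : 0 < a < 1 -> 0 < r ->
  (\int[mu]_y (\1_(box r) y * pw a (y 0 k))%:E < +oo)%E.
Proof.
move=> a01 r0; pose J := (`[(- r)%R, r]%classic : set R).
pose f (i : 'I_n) t : R := \1_J t * (if i == k then pw a t else 1).
have f0 i t : 0 <= f i t by rewrite mulr_ge0//; case: ifP => // _; rewrite pw_ge0.
have -> : (\int[mu]_y (\1_(box r) y * pw a (y 0 k))%:E = \int[mu]_y (\prod_i f i (y 0 i))%:E)%E.
  apply: eq_integral => y _; congr EFin; rewrite /f big_split/=; congr (_ * _).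
    rewrite indicE; case: (boolP (y \in _)) => [|].
      rewrite inE box_itv => yr; rewrite big1// => i _.
      by rewrite indicE mem_set//; exact: yr.
    rewrite notin_setE box_itv => yr.
    have [i Ji] : exists i, ~ J (y 0 i).
      by apply: contrapT => h; apply: yr => i; apply: contrapT => Ji; apply: h; exists i.
    by rewrite (bigD1 i)//= indicE memNset// mul0r.
  by rewrite (bigD1 k)//= eqxx big1 ?mulr1// => i /negPf ->.
rewrite (@ge0_integral_prod_rV _ n f).
- have h i : (\int[lebesgue_measure]_t (f i t)%:E < +oo)%E.
    rewrite /f; case: (i == k).
      apply: le_lt_trans (ltry (2 / (1 - a) * (r + 1) `^ (1 - a))).
      have r10 : 0 < r + 1 by rewrite addr_gt0.
      apply: le_trans (@integral_pw_le R a (r + 1) a01 r10).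
      apply: nnsup_le_integral => t; first by rewrite lee_fin mulr_ge0 ?pw_ge0.
      rewrite lee_fin ler_wpM2r ?pw_ge0// !indicE.
      case: (boolP (t \in J)) => [|//]; rewrite inE /J/= in_itv/= => /andP[t1 t2].
      rewrite mem_set//= in_itv/=; apply/andP; split; lra.
    under eq_integral do rewrite mulr1.
    rewrite integral_indic//; last exact: measurable_itv.
    have JT : (@lebesgue_measure R J < +oo)%E.
      by rewrite /J lebesgue_measure_itv/=; case: ifP => _; rewrite ?ltry// -EFinB ltry.
    by apply: le_lt_trans JT; rewrite setIT.
  have h0 i : (0 <= \int[lebesgue_measure]_t (f i t)%:E)%E.
    by apply: integral_ge0 => t _; rewrite lee_fin f0.
  suff /andP[] : (0 <= \prod_(i < n) \int[lebesgue_measure]_t (f i t)%:E < +oo)%E by [].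
  elim/big_ind : _ => [|u v /andP[u0 uoo] /andP[v0 voo]|i _]; rewrite ?h ?h0 ?lee01 ?ltry//.
  by rewrite mule_ge0//= lte_mul_pinfty// ge0_fin_numE.
- move=> i; apply: measurable_funM; first by apply: measurable_indic; exact: measurable_itv.
  by case: (i == k) => //; exact: measurable_pw.
- by [].
Qed.

Section field.
Variables (r : R) (phi : Rn -> R) (j : 'I_n).
Hypotheses (r0 : 0 < r) (cphi : continuous phi) (vphi : vanish r phi).

Let Phi y : Rn := phi y *: delta_mx 0 j.

Lemma enorm_field y : enorm (Phi y) = `|phi y|.
Proof.
rewrite /enorm (bigD1 j)//= big1 ?addr0; last first.
  by move=> i ij; rewrite !mxE (negPf ij) andbF mulr0 expr0n.
by rewrite !mxE !eqxx mulr1 sqrtr_sqr.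
Qed.

Lemma dot_field (u : Rn) y : dot u (Phi y) = u 0 j * phi y.
Proof.
rewrite /dot (bigD1 j)//= big1 ?addr0; last first.
  by move=> i ij; rewrite !mxE (negPf ij) andbF !mulr0.
by rewrite !mxE !eqxx mulr1.
Qed.

Lemma measurable_field : measurable_fun setT Phi.
Proof.
apply: measurable_fun_rV => i.
rewrite (_ : _ \o _ = (fun y => phi y * (delta_mx 0 j : Rn) 0 i)).
  by apply: measurable_funM => //; exact: continuous_measurable_rV.
by apply/funext => y; rewrite /= /coord_rV mxE.
Qed.

Let mphi : measurable_fun setT phi. Proof. exact: continuous_measurable_rV. Qed.

Lemma inLp_field q : 0 < q -> inLp q%:E Phi.
Proof.
move=> q0; split; first exact: measurable_field.
rewrite /normLp unlock; apply: poweR_lty.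
have [B B0 pB] := continuous_vanish_bounded cphi vphi.
have : mu.-integrable setT (EFin \o (fun y => `|phi y| `^ q)).
  apply: (@integrable_cube R n _ (B `^ q) r).
  - by apply: (measurableT_comp (measurable_powR _)); exact: measurableT_comp.
  - by move=> y; rewrite ger0_norm ?powR_ge0// ge0_ler_powR ?nnegrE ?(ltW q0).
  - by move=> y /vphi ->; rewrite normr0 powR0 ?gt_eqF.
case/integrableP => _; apply: le_lt_trans; rewrite le_eqVlt; apply/orP; left; apply/eqP.
apply: eq_integral => y _; rewrite enorm_field abse_EFin normr_id poweR_EFin.
by rewrite [RHS]gee0_abs// lee_fin powR_ge0.
Qed.

(** Off a hyperplane [|y|^(-a q)] is at most [|y_k|^(-a q)], which is integrable over the box
    because [a q < 1]. *)
Lemma inwLp_field (k : 'I_n) a q : 0 <= a -> 0 < q -> 0 < a * q < 1 -> inwLp (- a) q%:E Phi.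
Proof.
move=> a0 q0 aq; split; first exact: measurable_field.
rewrite /wnorm unlock; apply: poweR_lty.
have [B B0 pB] := continuous_vanish_bounded cphi vphi.
apply: (@le_lt_trans _ _ ((B `^ q)%:E * \int[mu]_y (\1_(box r) y * pw (a * q) (y 0 k))%:E)%E); last first.
  by rewrite lte_mul_pinfty ?lee_fin ?powR_ge0// integral_box_pw.
have mpwk : measurable_fun setT (fun y : Rn => pw (a * q) (y 0 k)).
  by apply: measurableT_comp; [exact: measurable_pw|exact: measurable_coord].
have mb : measurable_fun setT (fun y : Rn => \1_(box r) y * pw (a * q) (y 0 k) : R).
  by apply: measurable_funM => //; apply: measurable_indic; exact: measurable_cube.
rewrite -ge0_integralZl ?lee_fin ?powR_ge0//; [|exact/measurable_EFinP|]; last first.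
  by move=> y _; rewrite lee_fin mulr_ge0// pw_ge0.
rewrite [X in (X <= _)%E](_ : _ = \int[mu]_y (`|phi y| `^ q * (enorm y `^ (- a)) `^ q)%:E)%E; last first.
  apply: eq_integral => y _; rewrite enorm_field abse_EFin ger0_norm ?mulr_ge0 ?powR_ge0//.
  by rewrite poweR_EFin powRM ?powR_ge0.
under [X in (_ <= X)%E]eq_integral do rewrite -EFinM.
apply: (ae_integral_le (k := k)).
- apply: measurable_funM; apply: (measurableT_comp (measurable_powR _)).
    exact: measurableT_comp.
  by apply: (measurableT_comp (measurable_powR _)); exact: measurable_enorm.
- exact: measurable_funM.
- by move=> y; rewrite mulr_ge0 ?powR_ge0.
- by move=> y; rewrite !mulr_ge0 ?powR_ge0 ?pw_ge0.
move=> y yk; have [yr|yr] := pselect (box r y); last first.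
  by rewrite vphi// normr0 powR0 ?gt_eqF// mul0r !mulr_ge0 ?powR_ge0 ?pw_ge0.
rewrite indicE mem_set// mul1r ler_pM ?powR_ge0//.
  by rewrite ge0_ler_powR ?nnegrE ?(ltW q0).
rewrite /pw -powRrM mulNr !powRN lef_pV2 ?posrE ?powR_gt0 ?normr_gt0//.
  by rewrite ge0_ler_powR ?nnegrE ?enorm_ge0 ?coord_le_enorm// mulr_ge0// ltW.
by rewrite (lt_le_trans _ (coord_le_enorm _ k))// normr_gt0.
Qed.

Lemma rearrangement_ge0 (g : Rn -> Rn) t : (0 <= rearrangement g t)%E.
Proof. by apply: le_ereal_inf_tmp => _ [s [s0 _] <-]; rewrite lee_fin. Qed.

(** The rearrangement is at most the supremum [B] and vanishes beyond the measure of the box, so the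
    quasinorm reduces to the integral of [t^(1/q - 1)] over a bounded interval. *)
Lemma inLorentz_field q : 0 < q -> inLorentz q 1 Phi.
Proof.
move=> q0; split; first exact: measurable_field.
rewrite /lorentz_qnorm invr1; apply: poweR_lty.
have [B B0 pB] := continuous_vanish_bounded cphi vphi.
pose m : R := fine (mu (box r)) + 1.
have m0 : 0 < m by rewrite ltr_wpDl// fine_ge0.
have qi0 : 0 < q^-1 by rewrite invr_gt0.
apply: (@le_lt_trans _ _ (B%:E * (q^-1^-1 * m `^ q^-1)%:E)%E); last by rewrite -EFinM ltry.
apply: (@le_trans _ _ (B%:E * \int[lebesgue_measure]_(t in `]0%R, m]) (t `^ (q^-1 - 1))%:E)%E); last first.
  by rewrite lee_wpmul2l ?lee_fin// integral_powR_le.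
rewrite -ge0_integralZl ?lee_fin//; last 2 first.
- apply/measurable_EFinP; apply: measurable_funTS; exact: measurable_powR.
- by move=> y _; rewrite lee_fin powR_ge0.
rewrite [X in (X <= _)%E]integral_mkcond [X in (_ <= X)%E]integral_mkcond; apply: nnsup_le_integral => t.
  rewrite /patch; case: ifPn => // /[!inE]/= /[!in_itv]/= /andP[t0 _].
  by rewrite mule_ge0 ?poweR_ge0// lee_fin invr_ge0 ltW.
rewrite /patch; case: ifPn => [|_]; last first.
  by case: ifPn => // _; rewrite mule_ge0 ?lee_fin ?powR_ge0.
rewrite inE/= in_itv/= => /andP[t0 _].
rewrite poweRe1; last by rewrite mule_ge0 ?lee_fin ?powR_ge0 ?rearrangement_ge0.
have Bt : (rearrangement Phi t <= B%:E)%E.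
  apply: ereal_inf_lbound; exists B => //; split=> //.
  rewrite (_ : [set x | _] = set0) ?measure0 ?lee_fin ?(ltW t0)//.
  by apply/seteqP; split => // y /=; rewrite enorm_field ltNge pB.
case: ifPn => [_|].
  rewrite muleAC -EFinM muleC; apply: (@le_trans _ _ (B%:E * (t `^ q^-1 * t^-1)%:E)%E).
    by rewrite lee_wpmul2r// lee_fin mulr_ge0 ?powR_ge0// invr_ge0 ltW.
  by rewrite -[t^-1]powR_inv1 ?(ltW t0)// -powRD// (gt_eqF t0) implybT.
rewrite notin_setE/= in_itv/= t0/= => /negP; rewrite -ltNge => mt.
suff -> : rearrangement Phi t = 0%E by rewrite mule0 mul0e.
apply/eqP; rewrite eq_le rearrangement_ge0 andbT.
apply: ereal_inf_lbound; exists 0 => //; split=> //=.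
apply: (@le_trans _ _ (mu (box r))).
  apply: le_measure; rewrite ?inE; last 2 first.
  - exact: measurable_cube.
  - move=> y /=; rewrite enorm_field; apply: contraPP => /vphi ->.
    by rewrite normr0 ltxx.
  rewrite (_ : [set x | _] = (fun y => `|phi y|) @^-1` `]0, +oo[%classic).
    rewrite -[X in measurable X]setTI.
    have mp : measurable_fun setT (fun y => `|phi y|) by exact: measurableT_comp.
    by apply: mp => //; exact: measurable_itv.
  by apply/seteqP; split => y /=; rewrite enorm_field in_itv/= andbT.
rewrite -(@fineK _ (mu (box r))) ?ge0_fin_numE ?lebesgue_cube_lty//.
by rewrite lee_fin (le_trans _ (ltW mt))// lerDl.
Qed.

End field.

End test_fields.

(** * The datum condition and the vanishing initial value of the difference *)

Section initial.
Context {R : realType} {n : nat}.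
Local Notation Rn := 'rV[R]_n.
Local Notation mu := (@lebesgue_rV R n).
Implicit Types (r t a b c B : R) (x y : Rn).

(** With [p / (p - 1)] the conjugate exponent, the last product is [(p - n) / (p - 1)], below 1
    because [n > 1]. It makes the singular weight of [X p] integrable along one coordinate. *)
Lemma alpha_conjugate (p : R) : (1 < n)%N -> n%:R < p ->
  [/\ 1 < p, 0 < @alpha R n p < 1 & 0 < @alpha R n p * (p / (p - 1)) < 1].
Proof.
move=> n1 np; have n1' : 1 < n%:R :> R by rewrite ltr1n.
have p1 : 1 < p := lt_trans n1' np.
have p0 : 0 < p by rewrite (lt_trans _ p1).
have q0 : 0 < p - 1 by rewrite subr_gt0.
split=> //.
- rewrite /alpha subr_gt0 ltr_pdivrMr// mul1r np ltrBlDr ltrDl divr_gt0//.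
  exact: lt_trans n1'.
- rewrite (_ : _ * _ = (p - n%:R) / (p - 1)); last first.
    by rewrite /alpha; field; rewrite !gt_eqF.
  by rewrite divr_gt0 ?subr_gt0//= ltr_pdivrMr// mul1r ltrD2l ltrN2.
Qed.

Lemma X_field (k j : 'I_n) (p q r : R) (phi : Rn -> R) : (2 < n)%N -> n%:R < p ->
  (p < 2 * n%:R -> p < q < 2 * n%:R) -> 0 < r -> continuous phi -> vanish r phi ->
  X p q (fun y => phi y *: delta_mx 0 j).
Proof.
move=> n2 np hq r0 cphi vphi.
have [p1 /andP[a0 a1] aq] := alpha_conjugate (ltnW n2) np.
have p0 : 0 < p := lt_trans ltr01 p1.
have n2' : 2 < n%:R :> R by rewrite ltr_nat.
have conj0 (z : R) : 1 < z -> 0 < z / (z - 1) by move=> z1; rewrite divr_gt0 ?subr_gt0// (lt_trans _ z1).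
split.
  rewrite hoelder_conjugateE//; apply: (inwLp_field j r0 cphi vphi k) => //.
  - exact: ltW.
  - exact: conj0.
case: ifPn => [p2n|_].
  have /andP[pq _] := hq p2n; have q1 := lt_trans p1 pq.
  by rewrite hoelder_conjugateE//; exact: (inLp_field j cphi vphi (conj0 _ q1)).
have h2 : 0 < p * (n%:R - 2) + 2 * n%:R.
  by rewrite addr_gt0// mulr_gt0//; lra.
by case: ifPn => _; apply: (@inLorentz_field _ _ r) => //; rewrite divr_gt0// ?mulr_gt0//; lra.
Qed.

(** Hoelder's inequality, with [|y|^alpha] on one factor and its inverse on the other. Finiteness
    allows the two limits in [class_datum] to be subtracted. *)
Lemma pairing_fin_num (k j : 'I_n) (p r : R) (u0 : Rn -> Rn) (phi : Rn -> R) : (1 < n)%N -> n%:R < p ->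
  0 < r -> continuous phi -> vanish r phi -> inwLp (@alpha R n p) p%:E u0 ->
  pairing u0 (fun y => phi y *: delta_mx 0 j) \is a fin_num.
Proof.
move=> n1 np r0 cphi vphi [mu0 u0oo].
have [p1 /andP[a0 a1] aq] := alpha_conjugate n1 np.
have p0 : 0 < p := lt_trans ltr01 p1.
set q := p / (p - 1) in aq; have q0 : 0 < q by rewrite divr_gt0// subr_gt0.
have [mPhi Phioo] := inwLp_field j r0 cphi vphi k (ltW a0) q0 aq.
rewrite /pairing; under eq_integral do rewrite dot_field.
have mphi : measurable_fun setT phi by exact: continuous_measurable_rV.
have mu0j : measurable_fun setT (fun y => u0 y 0 j).
  exact: (measurableT_comp (measurable_coord j) mu0).
have mw b : measurable_fun setT (fun y : Rn => enorm y `^ b).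
  by apply: (measurableT_comp (measurable_powR _)); exact: measurable_enorm.
pose f y := enorm (u0 y) * enorm y `^ @alpha R n p.
pose g y := enorm (phi y *: delta_mx 0 j : Rn) * enorm y `^ (- @alpha R n p).
have mf : measurable_fun setT f.
  by apply: measurable_funM => //; exact: measurableT_comp measurable_enorm mu0.
have mg : measurable_fun setT g.
  by apply: measurable_funM => //; exact: measurableT_comp measurable_enorm mPhi.
have pq : p^-1 + q^-1 = 1 by rewrite /q; field; rewrite !gt_eqF// subr_gt0.
have H := hoelder mu mf mg p0 q0 pq.
have fg : ('N[mu]_1[EFin \o (f \* g)%R] < +oo)%E.
  apply: le_lt_trans H _; rewrite lte_mul_pinfty ?Lnorm_ge0//.
  by rewrite ge0_fin_numE ?Lnorm_ge0.
apply: integrable_fin_num => //.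
apply/integrableP; split; first by apply/measurable_EFinP; exact: measurable_funM.
apply: le_lt_trans fg; rewrite Lnorm1.
rewrite [X in (X <= _)%E](_ : _ = \int[mu]_y (`|u0 y 0 j * phi y|)%:E)%E; last first.
  by apply: eq_integral => y _; rewrite abse_EFin.
rewrite [X in (_ <= X)%E](_ : _ = \int[mu]_y (`|f y * g y|)%:E)%E; last first.
  by apply: eq_integral => y _.
apply: (ae_integral_le (k := k)) => //.
- by apply: measurableT_comp => //; exact: measurable_funM.
- by apply: measurableT_comp => //; exact: measurable_funM.
move=> y yk; have y0 : 0 < enorm y.
  by rewrite (lt_le_trans _ (coord_le_enorm _ k))// normr_gt0.
rewrite /f /g enorm_field (_ : _ * _ * _ = enorm (u0 y) * `|phi y|); last first.
  rewrite powRN mulrACA mulfV ?mulr1// gt_eqF// powR_gt0//.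
rewrite (normrM (u0 y 0 j)) (normrM (enorm _)) normr_id (ger0_norm (enorm_ge0 _)).
by rewrite ler_wpM2r// coord_le_enorm.
Qed.

Lemma Rintegral_field (r : R) (w : Rn -> Rn) (phi : Rn -> R) j : continuous w ->
  continuous phi -> vanish r phi ->
  pairing w (fun y => phi y *: delta_mx 0 j) = (\int[mu]_y (w y 0 j * phi y))%:E.
Proof.
move=> cw cphi vphi; rewrite /pairing; under eq_integral do rewrite dot_field.
rewrite /Rintegral fineK//.
apply: integrable_fin_num => //; apply: (@integrable_mul _ _ r) => // y.
by apply: (@continuous_comp _ _ _ w (fun y : Rn => y 0 j)); [exact: cw|exact: continuous_coord].
Qed.

Lemma normr_Rintegral_box (k : 'I_n) r (f phi : Rn -> R) A B : continuous f -> continuous phi -> vanish r phi ->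
  0 <= A -> 0 <= B -> (forall y, `|f y| <= A) -> (forall y, `|phi y| <= B) ->
  `|\int[mu]_y (f y * phi y)| <= A * B * fine (mu (box r)).
Proof.
move=> cf cphi vphi A0 B0 fA pB.
have mb : measurable_fun setT (\1_(box r) : Rn -> R).
  by apply: measurable_indic; exact: measurable_cube.
apply: (normr_Rintegral_le (k := k) (r := r) (g := fun y => A * B * \1_(box r) y)) => //.
- exact: measurable_funM.
- by move=> y; rewrite !mulr_ge0.
- move=> y _; have [yr|yr] := pselect (box r y); last by rewrite vphi// mulr0 normr0 !mulr_ge0.
  by rewrite indicE mem_set// mulr1 normrM ler_pM.
under eq_integral do rewrite EFinM.
have AB : 0 <= A * B by rewrite mulr_ge0.
rewrite ge0_integralZl ?lee_fin//; [|exact/measurable_EFinP].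
rewrite integral_indic ?setIT//; last exact: measurable_cube.
by rewrite -[X in (_ * X <= _)%E]fineK ?ge0_fin_numE ?lebesgue_cube_lty// -EFinM.
Qed.

(** The test function in [lap_pairing] moves with [t], while [class_datum] concerns fixed ones. Its
    displacement [O(t)] beats the growth [t^(-1/2)] of the velocities. Up to [c / 2] the kernel
    stays away from its singularity. *)
Lemma lap_psi_lipschitz r c x : 0 < r -> 0 < c -> exists2 M, 0 <= M & forall t y, 0 <= t <= c / 2 ->
  `|lap_psi r (Num.sqrt (c - t)) x y - lap_psi r (Num.sqrt c) x y| <= M * t.
Proof.
move=> r0 c0; have c2 : c / 2 < c by rewrite ltr_pdivrMr// mulr_natr mulr2n ltrDl.
have h (k : 'I_n) : exists M, forall t y, 0 <= t <= c / 2 -> box r y ->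
    `|psi_t r (Num.sqrt (c - t)) x [:: k; k] y| <= M.
  apply: (@bounded_on_cylinder R n (fun z => psi_t r (Num.sqrt (c - z.1)) x [:: k; k] z.2)).
  move=> t y /andP[_ tc]; apply: continuous_psi_t_rev => //.
  exact: le_lt_trans c2.
have [M HM] := choice h.
have h' k : exists M, 0 <= M /\ forall t y, 0 <= t <= c / 2 ->
    `|psi r (Num.sqrt (c - t)) x [:: k; k] y - psi r (Num.sqrt c) x [:: k; k] y| <= M * t.
  exists `|M k|; split=> // t y /andP[t0 tc].
  pose F z := psi r (Num.sqrt (c - z)) x [:: k; k] y.
  have -> : psi r (Num.sqrt c) x [:: k; k] y = F 0 by rewrite /F subr0.
  have -> : `|M k| * t = `|M k| * t - `|M k| * 0 by rewrite mulr0 subr0.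
  apply: (@derivative_comparison R F (fun z => - psi_t r (Num.sqrt (c - z)) x [:: k; k] y)
    (fun z => `|M k| * z) (fun _ => `|M k|)) => //.
  - by move=> z /andP[_ zt]; apply: is_derive_psi_time; rewrite (le_lt_trans zt)// (le_lt_trans tc).
  - move=> z _; have d := @is_deriveZ _ _ _ _ `|M k| _ _ _ (is_derive_id z (1 : R)).
    by apply: (is_derive_eq d); rewrite /GRing.scale/= mulr1.
  - move=> z /andP[z0 zt]; rewrite normrN.
    have [yr|yr] := pselect (box r y); last by rewrite vanish_psi_t// normr0.
    by rewrite (le_trans (HM k z y _ yr) (ler_norm _))// z0 (le_trans zt).
have [Mk HMk] := choice h'.
exists (\sum_k Mk k); first by apply: sumr_ge0 => k _; case: (HMk k).
move=> t y tc; rewrite /lap_psi -sumrB mulr_suml (le_trans (ler_norm_sum _ _ _))//.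
by apply: ler_sum => k _; case: (HMk k) => _; exact.
Qed.

Lemma class_datum_difference (k j : 'I_n) (p q r : R) u0 (Tu Tv : \bar R) u v pru prv (phi : Rn -> R) :
  (2 < n)%N -> n%:R < p -> (p < 2 * n%:R -> p < q < 2 * n%:R) -> inwLp (@alpha R n p) p%:E u0 ->
  existence_class p q u0 Tu u pru -> existence_class p q u0 Tv v prv ->
  0 < r -> continuous phi -> vanish r phi ->
  (\int[mu]_y ((u t y 0 j - v t y 0 j) * phi y)) @[t --> 0^'+] --> 0.
Proof.
move=> n2 np hq iu0 cu cv r0 cphi vphi.
have XP := X_field k j n2 np hq r0 cphi vphi.
have fin := pairing_fin_num k j (ltnW n2) np r0 cphi vphi iu0.
have near_c (T : \bar R) w pr : existence_class p q u0 T w pr -> \forall t \near 0^'+, continuous (w t).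
  move=> cw; have [sw _ _] := class_solution cw.
  have [b b0 bT] : exists2 b : R, 0 < b & (b%:E <= T)%E.
    case: (T) (class_time cw) => [b| |//]; first by rewrite lte_fin; exists b.
    by exists 1 => //; rewrite leey.
  apply: filterS2 (nbhs_right_gt 0) (nbhs_right_lt b0) => t t0 tb y.
  by apply: (smooth_slice sw); split => //=; apply: lt_le_trans bT; rewrite lte_fin.
pose Phi y : Rn := phi y *: delta_mx 0 j.
have lim (T : \bar R) w pr : existence_class p q u0 T w pr ->
    (\int[mu]_y (w t y 0 j * phi y)) @[t --> 0^'+] --> fine (pairing u0 Phi).
  move=> cw; have := class_datum cw XP; rewrite -(fineK fin) => /fine_cvg H.
  apply: cvg_trans H; apply: near_eq_cvg.
  apply: filterS (near_c _ _ _ cw) => t ct /=.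
  by rewrite (Rintegral_field j ct cphi vphi).
have H : (\int[mu]_y (u t y 0 j * phi y) - \int[mu]_y (v t y 0 j * phi y)) @[t --> 0^'+] --> 0.
  by have := cvgB (lim _ _ _ cu) (lim _ _ _ cv); rewrite subrr; exact.
have E : \forall t \near 0^'+, \int[mu]_y (u t y 0 j * phi y) - \int[mu]_y (v t y 0 j * phi y) =
    \int[mu]_y ((u t y 0 j - v t y 0 j) * phi y).
  apply: filterS2 (near_c _ _ _ cu) (near_c _ _ _ cv) => t ct1 ct2.
  have cj w : continuous w -> continuous (fun y : Rn => (w y : Rn) 0 j).
    move=> cw y; apply: (@continuous_comp _ _ _ w (fun y : Rn => y 0 j)); first exact: cw.
    exact: continuous_coord.
  by rewrite (@RintegralB_mul _ _ r)//; exact: cj.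
exact: (cvg_trans (near_eq_cvg E) H).
Qed.

Lemma class_initial (k : 'I_n) (p q : R) u0 (Tu Tv : \bar R) u v pru prv :
  (2 < n)%N -> n%:R < p -> (p < 2 * n%:R -> p < q < 2 * n%:R) -> inwLp (@alpha R n p) p%:E u0 ->
  existence_class p q u0 Tu u pru -> existence_class p q u0 Tv v prv ->
  forall r c x j, 0 < r -> 0 < c ->
  lap_pairing (fun j t y => u t y 0 j) (fun j t y => v t y 0 j) r c x j t @[t --> 0^'+] --> 0.
Proof.
move=> n2 np hq iu0 cu cv r c x j r0 c0.
have sc0 : 0 < Num.sqrt c by rewrite sqrtr_gt0.
have D := class_datum_difference k j n2 np hq iu0 cu cv r0 (@continuous_lap_psi R n r _ x sc0) (@vanish_lap_psi R n r _ x r0).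
have [M M0 HM] := lap_psi_lipschitz x r0 c0.
have bd (T : \bar R) w pr : existence_class p q u0 T w pr -> exists2 b, 0 < b & exists2 E, 0 <= E &
    forall t, 0 < t < b -> continuous (w t) /\ forall y, `|w t y 0 j| <= E * t `^ (- 2^-1).
  move=> cw; have [sw _ _] := class_solution cw.
  have [E E0 HE] := class_decay_bound np iu0 cw.
  have [b b0 bT] : exists2 b : R, 0 < b & (b%:E <= T)%E.
    case: (T) (class_time cw) => [b| |//]; first by rewrite lte_fin; exists b.
    by exists 1 => //; rewrite leey.
  exists b => //; exists E => // t /andP[t0 tb].
  have tT : (t%:E < T)%E by apply: lt_le_trans bT; rewrite lte_fin.
  have ct : continuous (w t) by move=> y; apply: (smooth_slice sw).
  by split=> // y; have [] := decay_bound j y np t0 ct (HE t t0 tT).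
have [b1 b10 [E1 E10 H1]] := bd _ _ _ cu; have [b2 b20 [E2 E20 H2]] := bd _ _ _ cv.
set V := fine (mu (box r)).
have V0 : 0 <= V by exact: fine_ge0.
suff : (fun t => lap_pairing (fun j t y => u t y 0 j) (fun j t y => v t y 0 j) r c x j t -
    \int[mu]_y ((u t y 0 j - v t y 0 j) * lap_psi r (Num.sqrt c) x y)) t @[t --> 0^'+] --> 0.
  by move=> /(cvgD D); rewrite addr0; under eq_cvg do rewrite addrC subrK.
pose A := (E1 + E2) * M * V.
have A0 : 0 <= A by rewrite !mulr_ge0// addr_ge0.
apply/cvgrPdist_le => eps eps0.
(* The error is [A t^(-1/2) t = A sqrt t], at most [eps] for [t] below [b3]. *)
pose b3 := (eps / (A + 1)) ^+ 2.
have b30 : 0 < b3 by rewrite exprn_gt0// divr_gt0// ltr_wpDl.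
pose b := Num.min (Num.min b1 b2) (Num.min (c / 2) b3).
have b0 : 0 < b by rewrite !lt_min b10 b20 b30 divr_gt0.
apply: filterS2 (nbhs_right_gt 0) (nbhs_right_lt b0) => t t0.
rewrite !lt_min => /andP[/andP[tb1 tb2] /andP[tc tb3]].
have [|ct1 e1] := H1 t; first by rewrite t0.
have [|ct2 e2] := H2 t; first by rewrite t0.
have cj w : continuous w -> continuous (fun y : Rn => (w y : Rn) 0 j).
  move=> cw y; apply: (@continuous_comp _ _ _ w (fun y : Rn => y 0 j)); first exact: cw.
  exact: continuous_coord.
have cuv : continuous (fun y => u t y 0 j - v t y 0 j) by apply: continuous_sub; exact: cj.
have ltc : t < c by rewrite (lt_trans tc)// ltr_pdivrMr// mulr_natr mulr2n ltrDl.
have sct0 : 0 < Num.sqrt (c - t) by rewrite sqrtr_gt0 subr_gt0.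
rewrite sub0r normrN /lap_pairing -(@RintegralB_mulr _ _ r)//; last 4 first.
- exact: continuous_lap_psi.
- exact: vanish_lap_psi.
- exact: continuous_lap_psi.
- exact: vanish_lap_psi.
have tp : 0 <= t `^ (- 2^-1) by exact: powR_ge0.
apply: le_trans (normr_Rintegral_box k (r := r) (A := (E1 + E2) * t `^ (- 2^-1)) (B := M * t) cuv _ _ _ _ _ _) _.
- by apply: continuous_sub; exact: continuous_lap_psi.
- by move=> y yr; rewrite !vanish_lap_psi// subrr.
- by rewrite mulr_ge0// addr_ge0.
- by rewrite mulr_ge0// ltW.
- by move=> y; rewrite (le_trans (ler_normB _ _))// mulrDl lerD.
- by move=> y; apply: HM; rewrite !ltW.
rewrite -/V.
have -> : (E1 + E2) * t `^ (- 2^-1) * (M * t) * V = A * (t `^ (- 2^-1) * t) by rewrite /A; ring.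
rewrite -{2}(powRr1 (ltW t0)) -powRD ?(gt_eqF t0) ?implybT//.
rewrite (_ : - 2^-1 + 1 = 2^-1 :> R); last by field.
rewrite powR12_sqrt ?(ltW t0)//.
apply: (@le_trans _ _ ((A + 1) * (eps / (A + 1)))); last first.
  by rewrite mulrC divfK// gt_eqF// ltr_wpDl.
rewrite ler_pM ?sqrtr_ge0// ?lerDl//.
rewrite -[leRHS]ger0_norm; last by rewrite divr_ge0 ?(ltW eps0)// addr_ge0.
by rewrite -sqrtr_sqr ler_wsqrtr// ltW.
Qed.

End initial.

(** * Uniqueness *)

Section uniqueness.
Context {R : realType} {n : nat}.
Local Notation Rn := 'rV[R]_n.
Local Notation mu := (@lebesgue_rV R n).
Local Notation e_ k := (delta_mx 0 k : Rn).
Implicit Types (r t a b c D e N : R) (x y : Rn).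

Lemma flow_sub a b a' b' V Vt dV d2V Q dQ : a <= a' -> b' <= b ->
  @flow R n a b V Vt dV d2V Q dQ -> flow a' b' V Vt dV d2V Q dQ.
Proof.
move=> aa bb fl; have sub t : a' < t < b' -> a < t < b.
  by move=> /andP[h1 h2]; rewrite (le_lt_trans aa)// (lt_le_trans h2).
split.
- by move=> j t y /sub; exact: flow_cV fl j t y.
- by move=> j t y /sub; exact: flow_cVt fl j t y.
- by move=> k j t /sub; exact: flow_cdV fl k j t.
- by move=> k j t /sub; exact: flow_cd2V fl k j t.
- by move=> t /sub; exact: flow_cQ fl t.
- by move=> k t /sub; exact: flow_cdQ fl k t.
- by move=> j t y /sub; exact: flow_Vt fl j t y.
- by move=> k j t y /sub; exact: flow_dV fl k j t y.
- by move=> k j t y /sub; exact: flow_d2V fl k j t y.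
- by move=> k t y /sub; exact: flow_dQ fl k t y.
- by move=> j t y /sub; exact: flow_momentum fl j t y.
- by move=> t y /sub; exact: flow_div fl t y.
Qed.

Lemma continuous_zero_off_hyperplane (k : 'I_n) (f : Rn -> R) y : continuous f ->
  (forall x, x 0 k != 0 -> f x = 0) -> f y = 0.
Proof.
move=> cf f0; apply/eqP; rewrite -normr_le0.
have cnf : {for y, continuous (fun y => `|f y|)}.
  apply: (@continuous_comp _ _ _ f (fun z => `|z|)); first exact: cf.
  exact: norm_continuous.
apply: (ae_le_continuous cnf).
exists [set x : Rn | x 0 k = 0]; split.
- rewrite (_ : mkset _ = (fun y : Rn => y 0 k) @^-1` [set 0])//.
  by rewrite -[X in measurable X]setTI; apply: measurable_coord => //; exact: measurable_set1.
- exact: hyperplane_null.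
by move=> x /= h; apply: contrapT => /eqP xk; apply: h; rewrite f0// normr0.
Qed.

Section two_flows.
Variables (U Ut V Vt : 'I_n -> R -> Rn -> R) (dU d2U dV d2V : 'I_n -> 'I_n -> R -> Rn -> R)
    (P Q : R -> Rn -> R) (dP dQ : 'I_n -> R -> Rn -> R).

(** With [C e = 1/2] each use of [core_estimate] halves the admissible [N], so any finite starting
    value is driven to 0. The threshold [e] does not depend on the interval. *)
Lemma contraction (k0 : 'I_n) a : 0 < a < 1 -> exists2 e, 0 < e & forall t0 b N,
  flow t0 b U Ut dU d2U P dP -> flow t0 b V Vt dV d2V Q dQ -> 0 <= N ->
  (forall i t y, t0 < t < b -> `|U i t y| <= e * (t - t0) `^ (- 2^-1)) ->
  (forall i t y, t0 < t < b -> `|V i t y| <= e * (t - t0) `^ (- 2^-1)) ->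
  (forall i t y, t0 < t < b -> y 0 k0 != 0 ->
    `|U i t y - V i t y| <= N * (t - t0) `^ (- ((1 - a) / 2)) * pw a (y 0 k0)) ->
  (forall r c x j, 0 < r -> t0 < c -> lap_pairing U V r c x j t @[t --> t0^'+] --> 0) ->
  forall i t y, t0 < t < b -> U i t y = V i t y.
Proof.
move=> a01; have [C C0 core] := core_estimate k0 a01.
pose e := (2 * C)^-1; have e0 : 0 < e by rewrite invr_gt0 mulr_gt0.
have Ce : C * e = 2^-1 by rewrite /e invfM mulrCA mulfV ?mulr1// gt_eqF.
exists e => // t0 b N fU fV N0 Ue Ve UV ini i t y tb.
have iter m : forall i t y, t0 < t < b -> y 0 k0 != 0 ->
    `|U i t y - V i t y| <= 2^-1 ^+ m * N * (t - t0) `^ (- ((1 - a) / 2)) * pw a (y 0 k0).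
  elim: m => [|m ih]; first by move=> *; rewrite expr0 mul1r; exact: UV.
  have Nm : 0 <= 2^-1 ^+ m * N by rewrite mulr_ge0// exprn_ge0// invr_ge0.
  move=> i' t' y' tb' yk'.
  apply: (le_trans (core _ _ _ _ _ _ _ _ _ _ _ _ _ _ _ _ fU fV (ltW e0) Nm Ue Ve ih ini i' t' y' tb' yk')).
  by rewrite Ce exprS !mulrA.
apply/eqP; rewrite -subr_eq0; apply/eqP.
apply: (@continuous_zero_off_hyperplane k0 (fun y => U i t y - V i t y)).
  by apply: continuous_sub; [exact: flow_cV_space fU i t tb|exact: flow_cV_space fV i t tb].
move=> x xk; apply/eqP; rewrite -normr_le0.
set X := N * (t - t0) `^ (- ((1 - a) / 2)) * pw a (x 0 k0).
have lim : (2^-1 ^+ m * X) @[m --> \oo] --> (0 * X).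
  by apply: cvgM; [apply: cvg_expr; rewrite ger0_norm ?invr_ge0// invf_lt1// ltr1n|exact: cvg_cst].
rewrite mul0r in lim; apply: (cvgr_to_ge lim); apply: nearW => m.
by apply: (le_trans (iter m i t x tb xk)); rewrite /X !mulrA.
Qed.

Lemma flows_eq (k0 : 'I_n) a b D : 0 < a < 1 -> flow 0 b U Ut dU d2U P dP -> flow 0 b V Vt dV d2V Q dQ -> 0 <= D ->
  (forall i t y, 0 < t < b -> `|U i t y| <= D * t `^ (- 2^-1)) ->
  (forall i t y, 0 < t < b -> `|V i t y| <= D * t `^ (- 2^-1)) ->
  (forall i t y, 0 < t < b -> y 0 k0 != 0 ->
    `|U i t y - V i t y| <= D * t `^ (- ((1 - a) / 2)) * pw a (y 0 k0)) ->
  (forall e, 0 < e -> exists2 d, 0 < d & forall i t y, 0 < t < b -> t < d ->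
    `|U i t y| <= e * t `^ (- 2^-1) /\ `|V i t y| <= e * t `^ (- 2^-1)) ->
  (forall r c x j, 0 < r -> 0 < c -> lap_pairing U V r c x j t @[t --> 0^'+] --> 0) ->
  forall i t y, 0 < t < b -> U i t y = V i t y.
Proof.
move=> a01 fU fV D0 UD VD UVD small ini; have /andP[a0 a1] := a01.
have [e e0 contr] := contraction k0 a01.
have [d d0 He] := small e e0.
(* [L] bounds both flows after time [d / 2]. On a window of length at most [z^2] starting at [t1],
   it is below [e (s - t1)^(-1/2)], the form that [contraction] asks for. *)
pose L := D * (d / 2) `^ (- 2^-1); have L0 : 0 <= L by rewrite mulr_ge0 ?powR_ge0.
pose z := e / (L + 1); have z0 : 0 < z by rewrite divr_gt0// ltr_wpDl.
(* Each window runs from [S - del] to [S + del]: its length [2 del] is at most [z^2], and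
   [del <= d / 2] keeps its origin beyond [d / 2]. *)
pose del := Num.min (d / 2) (z ^+ 2 / 2).
have del0 : 0 < del by rewrite lt_min !divr_gt0// exprn_gt0.
have del1 : del <= d / 2 by rewrite ge_min lexx.
have del2 : del + del <= z ^+ 2.
  by rewrite -mulr2n -[del *+ 2]mulr_natr -ler_pdivlMr// ge_min lexx orbT.
have steps m : forall i t y, 0 < t < b -> t < d + m%:R * del -> U i t y = V i t y.
  elim: m => [|m ih] i t y tb.
    rewrite mul0r addr0 => td; have /andP[t0 tb'] := tb.
    have sub s : 0 < s < Num.min b d -> (0 < s < b) /\ s < d by rewrite lt_min => /and3P[-> -> ->].
    apply: (contr 0 (Num.min b d) D) => //.
    - by apply: flow_sub fU => //; rewrite ge_min lexx.
    - by apply: flow_sub fV => //; rewrite ge_min lexx.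
    - by move=> i' t' y' /sub[h1 h2]; rewrite subr0; have [] := He i' t' y' h1 h2.
    - by move=> i' t' y' /sub[h1 h2]; rewrite subr0; have [] := He i' t' y' h1 h2.
    - by move=> i' t' y' /sub[h1 h2]; rewrite subr0; exact: UVD.
    - by rewrite t0 lt_min tb' td.
  have [|St] := ltP t (d + m%:R * del); first by move=> h _; exact: ih.
  set S := d + m%:R * del in ih St.
  have SE : d + m.+1%:R * del = S + del by rewrite /S -natr1; ring.
  rewrite SE => tS; have /andP[t0 tb'] := tb.
  have dS : d <= S by rewrite lerDl mulr_ge0// ltW.
  (* U = V on ]t1, S[, so the initial condition is trivial with the origin at t1 *)
  have [t1 t1E] : exists t1, t1 = S - del by eexists.
  have t1d : d / 2 <= t1 by rewrite t1E; lra.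
  have d20 : 0 < d / 2 by rewrite divr_gt0.
  have t10 : 0 < t1 := lt_le_trans d20 t1d.
  have t1S : t1 < S by rewrite t1E ltrBlDr ltrDl.
  have sub s : t1 < s < Num.min b (S + del) -> 0 < s < b.
    by rewrite lt_min => /and3P[h1 -> _]; rewrite (lt_trans t10).
  have Lle s : t1 < s < Num.min b (S + del) -> D * s `^ (- 2^-1) <= e * (s - t1) `^ (- 2^-1).
    rewrite lt_min => /and3P[h1 _ h3]; have s0 := lt_trans t10 h1.
    have st1 : 0 < s - t1 by rewrite subr_gt0.
    apply: (@le_trans _ _ L).
      rewrite ler_wpM2l// !powRN lef_pV2 ?posrE ?powR_gt0//.
      by rewrite ge0_ler_powR ?nnegrE ?invr_ge0 ?ltW// (le_lt_trans t1d).
    rewrite powRN powR12_sqrt ?(ltW st1)// ler_pdivlMr ?sqrtr_gt0//.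
    apply: (@le_trans _ _ ((L + 1) * z)); last by rewrite mulrC divfK// gt_eqF// ltr_wpDl.
    rewrite ler_pM ?sqrtr_ge0// ?lerDl// -[leRHS]ger0_norm ?(ltW z0)// -sqrtr_sqr.
    by rewrite ler_wsqrtr// (le_trans _ del2)// t1E; lra.
  apply: (contr t1 (Num.min b (S + del)) D) => //.
  - by apply: flow_sub fU; [exact: ltW|rewrite ge_min lexx].
  - by apply: flow_sub fV; [exact: ltW|rewrite ge_min lexx].
  - by move=> i' s y' h; apply: (le_trans (UD _ _ _ (sub s h))); exact: Lle.
  - by move=> i' s y' h; apply: (le_trans (VD _ _ _ (sub s h))); exact: Lle.
  - move=> i' s y' h yk; apply: (le_trans (UVD _ _ _ (sub s h) yk)).
    have /andP[h1 _] := h; have s0 := lt_trans t10 h1.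
    rewrite ler_wpM2r ?pw_ge0// ler_wpM2l// !powRN lef_pV2 ?posrE ?powR_gt0 ?subr_gt0//.
    rewrite ge0_ler_powR ?nnegrE ?subr_ge0 ?(ltW s0) ?(ltW h1)//.
      by rewrite divr_ge0// subr_ge0 ltW.
    by rewrite gerBl ltW.
  - move=> r c x j r0 t1c; apply: cvg_near_cst.
    apply: filterS2 (nbhs_right_gt t1) (nbhs_right_lt t1S) => s s1 s2.
    rewrite /lap_pairing; under eq_Rintegral => w _.
      rewrite (ih j s w) ?s2//; last by rewrite (lt_trans t10 s1) (lt_trans s2)// (le_lt_trans St).
      rewrite subrr mul0r; over.
    by rewrite /Rintegral integral0.
  - by rewrite (lt_le_trans t1S)//= lt_min tb' tS.
move=> i t y tb; have /andP[t0 _] := tb.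
have /archi_boundP := ltW (divr_gt0 t0 del0); set m := Num.bound _ => hm.
apply: (steps m) => //; rewrite ltr_pdivrMr// in hm.
by rewrite (lt_trans hm)// ltrDr.
Qed.

Lemma flows_pressure b : flow 0 b U Ut dU d2U P dP -> flow 0 b V Vt dV d2V Q dQ ->
  (forall i t y, 0 < t < b -> U i t y = V i t y) ->
  forall k t y, 0 < t < b -> dP k t y = dQ k t y.
Proof.
move=> fU fV UV k t y tb.
have uniq (f : R -> R) (s d1 d2 : R) : is_derive s (1 : R) f d1 -> is_derive s (1 : R) f d2 -> d1 = d2.
  by move=> [_ <-] [_ <-].
have E0 j : U j t = V j t by apply/funext => w; exact: UV.
have E1 i j : dU i j t = dV i j t.
  apply/funext => w; have h1 := flow_dV fU i j w tb; have h2 := flow_dV fV i j w tb.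
  by rewrite /is_partial -E0 in h2; exact: (uniq _ _ _ _ h1 h2).
have E2 i j : d2U i j t y = d2V i j t y.
  have h1 := flow_d2V fU i j y tb; have h2 := flow_d2V fV i j y tb.
  by rewrite /is_partial -E1 in h2; exact: (uniq _ _ _ _ h1 h2).
have Et j : Ut j t y = Vt j t y.
  apply: (uniq _ _ _ _ (flow_Vt fU j y tb)).
  apply: near_eq_is_derive (flow_Vt fV j y tb).
  have : t \in `]0, b[ by rewrite in_itv.
  by move=> /near_in_itvoo; apply: filterS => s; rewrite in_itv => sb; rewrite UV.
have := flow_momentum fU k y tb; have := flow_momentum fV k y tb.
rewrite Et; under [in X in _ -> X -> _]eq_bigr do rewrite E0 E1.
under [X in _ -> _ = X -> _]eq_bigr do rewrite E2.
by move=> <- /addrI.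
Qed.

End two_flows.

(** The origin is joined to [y] by a staircase: [tr m] keeps the first [m] coordinates, and
    consecutive points differ along one axis, where [f] has zero derivative. *)
Lemma zero_partials (f : Rn -> R) : (forall k y, is_partial k f y 0) -> forall y, f y = f 0.
Proof.
move=> f0 y; pose tr m : Rn := \row_(i < n) (if (i < m)%N then y 0 i else 0).
have E m : (m <= n)%N -> f (tr m) = f 0.
  elim: m => [_|m ih mn]; first by congr f; apply/rowP => i; rewrite !mxE.
  rewrite -(ih (ltnW mn)); pose k := Ordinal mn.
  have -> : tr m.+1 = tr m + y 0 k *: e_ k.
    apply/rowP => i; rewrite !mxE eqxx/= ltnS leq_eqVlt -val_eqE/=.
    case: (ltngtP i m) => [im|im|im] /=; rewrite ?mulr0 ?addr0//.
    by rewrite mulr1 add0r; congr (y _ _); exact: val_inj.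
  pose g s := f (tr m + s *: e_ k).
  have -> : f (tr m) = g 0 by rewrite /g scale0r addr0.
  have cst u v : u <= v -> g v = g u.
    move=> uv; apply/eqP; rewrite -subr_eq0 -normr_le0 -[leRHS](subrr 0).
    apply: (@derivative_comparison R g (fun _ => 0) (fun _ => 0) (fun _ => 0)) => //.
    - by move=> s _; exact: (@is_derive_line _ _ k f (fun _ => 0)).
    - by move=> s _; rewrite normr0.
  by case: (leP 0 (y 0 k)) => [/cst|/ltW/cst ->].
rewrite -(E n (leqnn n)); congr f; apply/rowP => i.
by rewrite mxE ltn_ord.
Qed.

End uniqueness.

Theorem theorem2 (R : realType) (n : nat) (p qX : R)
    (u0 : 'rV[R]_n -> 'rV[R]_n)
    (Tu Tv : \bar R) (u v : R -> 'rV[R]_n -> 'rV[R]_n)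
    (pru prv : R -> 'rV[R]_n -> R)
    (hn : (3 <= n)%N) (hp : n%:R < p)
    (hqX : p < 2 * n%:R -> p < qX < 2 * n%:R)
    (hu0 : inwLp (@alpha R n p) p%:E u0)
    (hdiv : weakly_divergence_free u0)
    (hu : existence_class p qX u0 Tu u pru)
    (hv : existence_class p qX u0 Tv v prv) :
  (forall (t : R) (x : 'rV[R]_n), 0 < t -> (t%:E < mine Tu Tv)%E ->
     u t x = v t x) /\
  (exists h : R -> R, forall (t : R) (x : 'rV[R]_n), 0 < t ->
     (t%:E < mine Tu Tv)%E -> pru t x - prv t x = h t).
Proof.
have n0 : (0 < n)%N by exact: leq_trans hn.
pose k0 := Ordinal n0.
have [_ a01 _] := alpha_conjugate (ltnW hn) hp.
have [Du Du0 HDu] := class_decay_bound hp hu0 hu.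
have [Dv Dv0 HDv] := class_decay_bound hp hu0 hv.
pose D := Du + Dv; have D0 : 0 <= D by rewrite addr_ge0.
have mu_ : (mine Tu Tv <= Tu)%E by rewrite ge_min lexx.
have mv_ : (mine Tu Tv <= Tv)%E by rewrite ge_min lexx orbT.
(* The existence times may be infinite, whereas a [flow] has a real end time; one beyond [t] is
   picked for each [t]. *)
have horizon t : (t%:E < mine Tu Tv)%E -> exists b, [/\ t < b, (b%:E <= Tu)%E & (b%:E <= Tv)%E].
  move: mu_ mv_; case: (mine Tu Tv) => [b hu1 hv1|hu1 hv1 _|//].
    by rewrite lte_fin => tb; exists b.
  exists (t + 1); rewrite ltrDl ltr01; split=> //.
    by apply: le_trans hu1; rewrite leey.
  by apply: le_trans hv1; rewrite leey.
have sub (T : \bar R) b t : (b%:E <= T)%E -> 0 < t < b -> (t%:E < T)%E.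
  by move=> bT /andP[_ tb]; apply: lt_le_trans bT; rewrite lte_fin.
have cont (T : \bar R) w pr b t : existence_class p qX u0 T w pr -> (b%:E <= T)%E -> 0 < t < b -> continuous (w t).
  move=> cw bT tb y; have [sw _ _] := class_solution cw.
  apply: (smooth_slice sw); split => /=; first by case/andP : tb.
  exact: sub bT tb.
have bound (T : \bar R) w pr b E i t y : existence_class p qX u0 T w pr -> (b%:E <= T)%E -> 0 < t < b ->
    (decay p (p + 1) w t <= E%:E)%E -> `|w t y 0 i| <= E * t `^ (- 2^-1) /\
    forall k, y 0 k != 0 -> `|w t y 0 i| <= E * t `^ (- ((1 - @alpha R n p) / 2)) * pw (@alpha R n p) (y 0 k).
  move=> cw bT tb; apply: decay_bound => //; first by case/andP : tb.
  exact: cont cw bT tb.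
have eqb b : (b%:E <= Tu)%E -> (b%:E <= Tv)%E -> forall i t y, 0 < t < b -> u t y 0 i = v t y 0 i.
  move=> bu bv; have fU := NS_flow (class_solution hu) bu; have fV := NS_flow (class_solution hv) bv.
  have dE (E : R) t : 0 < t < b -> [/\ 0 < t, (t%:E < Tu)%E & (t%:E < Tv)%E].
    by move=> tb; split; [case/andP : tb|exact: sub bu tb|exact: sub bv tb].
  apply: (flows_eq (k0 := k0) a01 fU fV D0).
  - move=> i t y tb; have [t0 tu tv] := dE 0 t tb.
    have [h _] := bound _ _ _ _ _ i t y hu bu tb (HDu t t0 tu).
    by apply: (le_trans h); rewrite ler_wpM2r ?powR_ge0// lerDl.
  - move=> i t y tb; have [t0 tu tv] := dE 0 t tb.
    have [h _] := bound _ _ _ _ _ i t y hv bv tb (HDv t t0 tv).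
    by apply: (le_trans h); rewrite ler_wpM2r ?powR_ge0// lerDr.
  - move=> i t y tb yk; have [t0 tu tv] := dE 0 t tb.
    have [_ /(_ _ yk) h1] := bound _ _ _ _ _ i t y hu bu tb (HDu t t0 tu).
    have [_ /(_ _ yk) h2] := bound _ _ _ _ _ i t y hv bv tb (HDv t t0 tv).
    by rewrite (le_trans (ler_normB _ _))// /D (mulrDl Du) (mulrDl (Du * _)) lerD.
  - move=> e e0; have [d1 d10 H1] := class_decay_small e0 hu.
    have [d2 d20 H2] := class_decay_small e0 hv.
    exists (Num.min d1 d2); first by rewrite lt_min d10.
    move=> i t y tb; rewrite lt_min => /andP[t1 t2]; have /andP[t0 _] := tb.
    split.
      by have [] := bound _ _ _ _ _ i t y hu bu tb (H1 t _); rewrite ?t0.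
    by have [] := bound _ _ _ _ _ i t y hv bv tb (H2 t _); rewrite ?t0.
  - exact: (class_initial k0 hn hp hqX hu0 hu hv).
split => [t x t0 /horizon[b [tb bu bv]]|].
  by apply/rowP => i; apply: (eqb b bu bv); rewrite t0.
exists (fun t => pru t 0 - prv t 0) => t x t0 /horizon[b [tb bu bv]].
have t0b : 0 < t < b by rewrite t0.
have fU := NS_flow (class_solution hu) bu; have fV := NS_flow (class_solution hv) bv.
have gr := flows_pressure fU fV (eqb b bu bv).
apply: (@zero_partials R n (fun y => pru t y - prv t y)) => k y.
have d1 := flow_dQ fU k y t0b; have d2 := flow_dQ fV k y t0b.
by apply: (is_derive_eq (is_deriveB d1 d2)); rewrite (gr k t y t0b) subrr.
Qed.
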